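(* Let $Q>0$. There exists $C=C(Q)$ such that for any $(q^{(1)},h^{(1)},H^{(1)}),(q^{(2)},h^{(2)},H^{(2)})\in P_Q$ with Cauchy data $\{\mathscr N^{(s)},\mathscr N_0^{(s)},\omega^{(s)},\omega_0^{(s)}\}$, $s=1,2$, $$\|q^{(1)}-q^{(2)}\|_{L_2}+|h^{(1)}-h^{(2)}|+|H^{(1)}-H^{(2)}|\le C\big(\|\mathscr N^{(1)}-\mathscr N^{(2)}\|_{L_2}+\|\mathscr N_0^{(1)}-\mathscr N_0^{(2)}\|_{L_2}+|\omega^{(1)}-\omega^{(2)}|+|\omega_0^{(1)}-\omega_0^{(2)}|\big).$$
   Context: For complex $q\in L_2(0,\pi)$, $h,H\in\mathbb C$: let $\varphi(x,\rho)$, $\psi(x,\rho)$ solve $-y''+qy=\rho^2y$ on $(0,\pi)$ with $\varphi(0,\rho)=1,\varphi'(0,\rho)=h$ and $\psi(0,\rho)=0,\psi'(0,\rho)=1$. Put $\Delta(\rho)=\varphi'(\pi,\rho)+H\varphi(\pi,\rho)$, $\Delta_0(\rho)=\psi'(\pi,\rho)+H\psi(\pi,\rho)$, $\omega=h+H+\frac12\int_0^\pi q(t)dt$, $\omega_0=H+\frac12\int_0^\pi q(t)dt$. Then there are unique $\mathscr N,\mathscr N_0\in L_2(0,\pi)$ with $\Delta(\rho)=-\rho\sin\rho\pi+\omega\cos\rho\pi+\int_0^\pi\mathscr N(t)\cos\rho t\,dt$ and $\Delta_0(\rho)=\cos\rho\pi+\omega_0\frac{\sin\rho\pi}{\rho}+\frac1\rho\int_0^\pi\mathscr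 N_0(t)\sin\rho t\,dt$; the collection $\{\mathscr N,\mathscr N_0,\omega,\omega_0\}$ is the Cauchy data of $(q,h,H)$. $P_Q=\{(q,h,H)\in L_2(0,\pi)\times\mathbb C\times\mathbb C:\|q\|_{L_2}+|h|+|H|\le Q\}$. *)

(* Defs.v *)
From HB Require Import structures.
From mathcomp Require Import all_boot all_order all_algebra.
From mathcomp Require Import all_classical all_reals all_analysis.
From mathcomp Require Import complex.
Set Implicit Arguments. Unset Strict Implicit. Unset Printing Implicit Defensive.
Import Order.TTheory GRing.Theory Num.Theory.
Import numFieldNormedType.Exports.
Local Open Scope classical_set_scope.
Local Open Scope ring_scope.
Local Open Scope complex_scope.

Section SturmLiouvilleDefs.
Variable R : realType.
Local Notation C := R[i].
Local Notation mu := (@lebesgue_measure R).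

(* complex-valued functions on (0,pi) are represented by R -> R[i];
   only their values on [0, pi] matter *)

Definition reC (z : C) : R := @complex.Re R z.
Definition imC (z : C) : R := @complex.Im R z.

Definition Ipi : set R := `[0%R, (pi : R)].

Definition csq (z : C) : R := reC z ^+ 2 + imC z ^+ 2.

Definition L2 (f : R -> C) : Prop :=
  measurable_fun Ipi (fun t => reC (f t)) /\
  measurable_fun Ipi (fun t => imC (f t)) /\
  (\int[mu]_(t in Ipi) (csq (f t))%:E < +oo)%E.

Definition L2norm (f : R -> C) : R :=
  Num.sqrt (Rintegral mu Ipi (fun t => csq (f t))).

Definition cint (a b : R) (f : R -> C) : C :=
  Complex (Rintegral mu `[a, b]%classic (fun t => reC (f t)))
          (Rintegral mu `[a, b]%classic (fun t => imC (f t))).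

Definition cabs (z : C) : R := Num.sqrt (csq z).

Definition coshR (b : R) : R := (expR b + expR (- b)) / 2.
Definition sinhR (b : R) : R := (expR b - expR (- b)) / 2.
Definition ccos (z : C) : C :=
  Complex (cos (reC z) * coshR (imC z)) (- (sin (reC z) * sinhR (imC z))).
Definition csin (z : C) : C :=
  Complex (sin (reC z) * coshR (imC z)) (cos (reC z) * sinhR (imC z)).

(* (y, yd) is a (Caratheodory) solution of -y'' + q y = rho^2 y on [0,pi]:
   y, yd continuous on [0,pi], y' = yd and yd' = (q - rho^2) y in integrated
   (absolutely continuous) form. *)
Definition is_solution (q : R -> C) (rho : C) (y yd : R -> C) : Prop :=
  {within Ipi, continuous (fun t => reC (y t))} /\
  {within Ipi, continuous (fun t => imC (y t))} /\
  {within Ipi, continuous (fun t => reC (yd t))} /\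
  {within Ipi, continuous (fun t => imC (yd t))} /\
  forall x, 0 <= x <= pi ->
    y x = y 0 + cint 0 x yd /\
    yd x = yd 0 + cint 0 x (fun t => (q t - rho ^+ 2) * y t).

Definition omega (q : R -> C) (h H : C) : C :=
  h + H + (1 / 2%:R) * cint 0 pi q.
Definition omega0 (q : R -> C) (H : C) : C :=
  H + (1 / 2%:R) * cint 0 pi q.

Definition cauchyN (q : R -> C) (h H : C) (N : R -> C) : Prop :=
  forall (rho : C) (phi phid : R -> C), rho != 0 ->
    is_solution q rho phi phid -> phi 0 = 1 -> phid 0 = h ->
    phid pi + H * phi pi =
      - rho * csin (rho * pi%:C) + omega q h H * ccos (rho * pi%:C)
      + cint 0 pi (fun t => N t * ccos (rho * t%:C)).

Definition cauchyN0 (q : R -> C) (H : C) (N0 : R -> C) : Prop :=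
  forall (rho : C) (psi psid : R -> C), rho != 0 ->
    is_solution q rho psi psid -> psi 0 = 0 -> psid 0 = 1 ->
    psid pi + H * psi pi =
      ccos (rho * pi%:C) + omega0 q H * csin (rho * pi%:C) / rho
      + (cint 0 pi (fun t => N0 t * csin (rho * t%:C))) / rho.

Definition in_PQ (Q : R) (q : R -> C) (h H : C) : Prop :=
  L2 q /\ L2norm q + cabs h + cabs H <= Q.

End SturmLiouvilleDefs.

(* Main.v *)
(** Measure the variable from the endpoint pi, where both solutions can be given
    the data (1, H). Variation of constants, iterated as a contraction in a norm
    weighted by exp(lam x), gives phi = cos(rho x) + int K(x,u) cos(2 rho u) du with a
    kernel K supported in |u| <= x/2 and bounded in terms of Q alone. A product
    of two such solutions is therefore
    1/2 + cos(theta x)/2 + int V(x,u) cos(theta u) du, where theta = 2 rho.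

    By the Wronskian identity, int (q1 - q2) phi1 phi2 is a combination of the values of
    Delta and Delta_0 for the two problems. After subtracting the mean, it is the cosine
    transform at theta of W = (q1 - q2)/2 + (a Volterra term in q1 - q2), and it is
    bounded by the differences of the Cauchy data, with a factor 1/rho in front of the
    differences of omega and omega_0. At the frequencies theta = k + 1/2, where the cosines are
    orthogonal on (0, pi) and cos(theta t/2), sin(theta t/2) are orthogonal on
    (0, 2 pi), Bessel's inequality bounds the sum of the squared transforms,
    completeness of the cosines bounds W, and Gronwall's inequality bounds q1 - q2.
    The differences of h and H then follow from those of omega, omega_0 and q. *)
Require Import Defs.
From HB Require Import structures.
From mathcomp Require Import all_boot all_order all_algebra.
From mathcomp Require Import all_classical all_reals all_analysis.
From mathcomp Require Import complex measurable_realfun ring lra.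
Set Implicit Arguments. Unset Strict Implicit. Unset Printing Implicit Defensive.
Import Order.TTheory GRing.Theory Num.Theory.
Import numFieldNormedType.Exports.
Local Open Scope classical_set_scope.
Local Open Scope ring_scope.

(** Two problems are compared and nothing is reconstructed, so only the forward problem at real
    positive [rho] enters. Starting at pi lets one solution serve both characteristic functions: at
    the far endpoint its value is Delta_0 and its derivative is Delta - h Delta_0, since the
    Wronskian is constant. Its data (1, H) do not involve h. The obstacle is the unknown mean of q1
    - q2. In the Wronskian identity it occurs together with H1 - H2 exactly as the difference of
    omega_0. What is left after subtraction is either a transform of the differences of N and N_0 or
    carries 1/rho, and both are square summable. Half-integer frequencies keep rho at or above 1/4.
    Completeness of the cosines is proved by hand: the squared distance from the indicator of [0, y]
    to their span, integrated over y, is the remainder of sum 1/theta_k^2 = pi^2/2. This controls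
    primitives; symmetric difference quotients, Lebesgue differentiation and Fatou's lemma lead back
    to the function. As q is only square integrable, derivatives exist in integrated form, and the
    product rule for them comes from Fubini. *)

Section RealIntegral.
Variable R : realType.
Local Notation mu := (@lebesgue_measure R).
Implicit Types (f g h : R -> R) (a b c x y : R) (n : nat).

(** * Integrals over the real line, segments as indicators, changes of variable *)

Lemma ler_of_eq x y : x = y -> x <= y :> R.
Proof. by move=> ->. Qed.

Definition integ (f : R -> R) : Prop := mu.-integrable setT (EFin \o f).
Definition RI (f : R -> R) : R := Rintegral mu setT f.

Lemma integ_meas f : integ f -> measurable_fun setT f.
Proof. by move=> /measurable_int/measurable_EFinP. Qed.

Lemma integ_le f g : measurable_fun setT f -> integ g ->
  (forall x, `|f x| <= g x) -> integ f.
Proof.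
move=> mf ig fg; apply: (le_integrable measurableT _ _ ig).
  exact/measurable_EFinP.
by move=> x _ /=; rewrite lee_fin (le_trans (fg x))// ler_norm.
Qed.

Lemma integ_eq f g : f =1 g -> integ f -> integ g.
Proof. by move=> /funext ->. Qed.

Lemma integD f g : integ f -> integ g -> integ (fun x => f x + g x).
Proof.
move=> f1 g1; have := integrableD measurableT f1 g1.
by apply: eq_integrable.
Qed.

Lemma integN f : integ f -> integ (fun x => - f x).
Proof. by move=> f1; have := integrableN f1; apply: eq_integrable. Qed.

Lemma integB f g : integ f -> integ g -> integ (fun x => f x - g x).
Proof. by move=> f1 /integN; exact: integD. Qed.

Lemma integZ c f : integ f -> integ (fun x => c * f x).
Proof.
by move=> f1; have := integrableZl measurableT c f1; apply: eq_integrable.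
Qed.

Lemma integ_norm f : integ f -> integ (fun x => `|f x|).
Proof. exact: integrable_norm. Qed.

Lemma integ0 : integ (fun=> 0).
Proof. by have := @integrable0 _ _ _ mu setT; apply: eq_integrable. Qed.

Lemma integ_sum n (f : nat -> R -> R) : (forall k, integ (f k)) ->
  integ (fun x => \sum_(k < n) f k x).
Proof.
move=> h; elim: n => [|n IH].
  by apply: integ_eq integ0 => x; rewrite big_ord0.
by apply: integ_eq (integD IH (h n)) => x; rewrite big_ord_recr.
Qed.

Lemma integMb f g M : integ f -> measurable_fun setT g ->
  (forall x, `|g x| <= M) -> integ (fun x => f x * g x).
Proof.
move=> f1 mg gM; apply: (integ_le (g := fun x => M * `|f x|)).
- by apply: measurable_funM => //; exact: integ_meas.
- by apply: integZ; exact: integ_norm.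
- by move=> x; rewrite normrM mulrC ler_wpM2r.
Qed.

Lemma eq_RI f g : f =1 g -> RI f = RI g.
Proof. by move=> /funext ->. Qed.

Lemma RID f g : integ f -> integ g -> RI (fun x => f x + g x) = RI f + RI g.
Proof. exact: RintegralD. Qed.

Lemma RIB f g : integ f -> integ g -> RI (fun x => f x - g x) = RI f - RI g.
Proof. exact: RintegralB. Qed.

Lemma RIZ c f : integ f -> RI (fun x => c * f x) = c * RI f.
Proof. exact: RintegralZl. Qed.

Lemma RI0 : RI (fun=> 0) = 0.
Proof. by rewrite /RI /Rintegral integral0. Qed.

Lemma RIN f : integ f -> RI (fun x => - f x) = - RI f.
Proof.
by move=> f1; rewrite -mulN1r -RIZ//; apply: eq_RI => x; rewrite mulN1r.
Qed.

Lemma RI_sum n (f : nat -> R -> R) : (forall k, integ (f k)) ->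
  RI (fun x => \sum_(k < n) f k x) = \sum_(k < n) RI (f k).
Proof.
move=> h; elim: n => [|n IH].
  by rewrite big_ord0 -[RHS]RI0; apply: eq_RI => x; rewrite big_ord0.
rewrite big_ord_recr/= -IH -RID//; last exact: integ_sum.
by apply: eq_RI => x; rewrite big_ord_recr.
Qed.

Lemma RI_ge0 f : (forall x, 0 <= f x) -> 0 <= RI f.
Proof. by move=> h; apply: Rintegral_ge0 => x _. Qed.

Lemma RI_le f g : integ f -> integ g -> (forall x, f x <= g x) -> RI f <= RI g.
Proof. by move=> f1 g1 h; apply: le_Rintegral. Qed.

Lemma RI_abs f : integ f -> `|RI f| <= RI (fun x => `|f x|).
Proof. by move=> f1; apply: le_normr_Rintegral. Qed.

Lemma RI_abs_le f g : integ f -> integ g -> (forall x, `|f x| <= g x) ->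
  `|RI f| <= RI g.
Proof.
by move=> f1 g1 h; apply: le_trans (RI_abs f1) _; apply: RI_le => //;
  exact: integ_norm.
Qed.

Lemma RI_set (D : set R) f : measurable D ->
  Rintegral mu D f = RI (fun x => (x \in D)%:R * f x).
Proof.
move=> mD; rewrite Rintegral_mkcond; apply: eq_RI => x.
by rewrite /patch; case: ifP; rewrite ?mul1r ?mul0r.
Qed.

Lemma integ_set (D : set R) f : measurable D ->
  mu.-integrable D (EFin \o f) <-> integ (fun x => (x \in D)%:R * f x).
Proof.
move=> mD; apply: (iff_trans (integrable_mkcond (mu := mu) (EFin \o f) mD)).
suff -> : (EFin \o f) \_ D = EFin \o (fun x => (x \in D)%:R * f x) by [].
by apply/funext => x; rewrite /patch/=; case: ifP; rewrite ?mul1r ?mul0r.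
Qed.

(** A real-valued indicator: an integral over a segment becomes an integral over the line of
    [seg a b x * f x], so shifts, reflections and Fubini never alter a domain of integration. *)
Definition seg (a b x : R) : R := (a <= x <= b)%R%:R.

Lemma segE a b x : seg a b x = (x \in `[a, b]%classic)%:R.
Proof. by rewrite /seg; congr (_%:R); rewrite mem_setE in_itv. Qed.

Lemma seg_in a b x : a <= x <= b -> seg a b x = 1.
Proof. by rewrite /seg => ->. Qed.

Lemma seg_out a b x : ~~ (a <= x <= b) -> seg a b x = 0.
Proof. by rewrite /seg => /negbTE ->. Qed.

Lemma seg01 a b x : 0 <= seg a b x <= 1.
Proof. by rewrite /seg ler0n lern1 leq_b1. Qed.

Lemma seg_abs a b x : `|seg a b x| <= 1.
Proof. by have /andP[h1 h2] := seg01 a b x; rewrite ger0_norm. Qed.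

Lemma RI_seg a b f : Rintegral mu `[a, b]%classic f = RI (fun x => seg a b x * f x).
Proof. by rewrite RI_set//; apply: eq_RI => x; rewrite segE. Qed.

Lemma integ_segP a b f : mu.-integrable `[a, b]%classic (EFin \o f) <->
  integ (fun x => seg a b x * f x).
Proof.
rewrite integ_set//; suff -> : (fun x => (x \in `[a, b]%classic)%:R * f x) =
  (fun x => seg a b x * f x) by [].
by apply/funext => x; rewrite segE.
Qed.

Lemma meas_b2r d (T : measurableType d) (b : T -> bool) :
  measurable_fun setT b -> measurable_fun setT (fun x : T => (b x)%:R : R).
Proof.
move=> mb; rewrite (_ : (fun _ => _) = fun x : T => if b x then 1 else 0 : R).
  by apply: measurable_fun_ifT => //; exact: measurable_cst.
by apply/funext => z; case: (b z).
Qed.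

Lemma meas_seg d (T : measurableType d) (a b f : T -> R) :
  measurable_fun setT a -> measurable_fun setT b -> measurable_fun setT f ->
  measurable_fun setT (fun x : T => seg (a x) (b x) (f x)).
Proof.
move=> ma mb mf; apply: meas_b2r; apply: measurable_and.
  exact: measurable_fun_ler.
exact: measurable_fun_ler.
Qed.

Lemma integ_seg a b : integ (seg a b).
Proof.
have -> : seg a b = fun x => seg a b x * 1 by apply/funext => x; rewrite mulr1.
apply/integ_segP; apply: (measurable_bounded_integrable (mu := mu)) => //.
  rewrite /= lebesgue_measure_itv/=; by case: ifP => _; exact: ltry.
by exists 1; split; rewrite ?realE ?ler01// => M M1 x _ /=; rewrite normr1 ltW.
Qed.

Lemma RI_seg1 a b : a <= b -> RI (seg a b) = b - a.
Proof.
move=> ab; rewrite (_ : seg a b = fun x => seg a b x * 1); last first.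
  by apply/funext => x; rewrite mulr1.
rewrite -RI_seg Rintegral_cst// mul1r.
rewrite [X in fine X](_ : _ = if a < b then (b - a)%:E else 0%E); last first.
  by apply: (etrans (lebesgue_measure_itv `[a, b])); rewrite /= lte_fin.
by case: ltP => [//|ba] /=; apply/eqP; rewrite eq_sym subr_eq0 eq_le ba ab.
Qed.

Lemma integ_segM a b f : integ f -> integ (fun x => seg a b x * f x).
Proof.
move=> f1; apply: (integ_eq (f := fun x => f x * seg a b x)) => [x|].
  by rewrite mulrC.
apply: (integMb (M := 1)) => //; last by move=> x; exact: seg_abs.
by apply: meas_seg => //; exact: measurable_cst.
Qed.

Lemma integ_segB a b f M : measurable_fun setT f -> (forall x, `|f x| <= M) ->
  integ (fun x => seg a b x * f x).
Proof. by move=> mf fM; apply: (integMb (M := M)) => //; exact: integ_seg. Qed.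

Lemma integ_cont a b f : {within `[a, b]%classic, continuous f} ->
  integ (fun x => seg a b x * f x).
Proof.
move=> cf; apply/integ_segP; apply: continuous_compact_integrable => //.
exact: segment_compact.
Qed.

(** Lebesgue measure is its own image under [phi], so the change of variables for image measures
    applies. Translations and the reflection are the two instances. *)
Lemma integ_preserving f (phi : R -> measurableTypeR R) : measurable_fun setT phi ->
  (forall A, measurable A -> pushforward mu phi A = mu A) -> integ f ->
  integ (fun x => f (phi x)) /\ RI (fun x => f (phi x)) = RI f.
Proof.
move=> mphi pE f1; have mf := integ_meas f1.
have mfp : measurable_fun setT (fun x => f (phi x)) by exact: (measurableT_comp mf mphi).
have i1 : integ (fun x => f (phi x)).
  apply/integrableP; split; first exact/measurable_EFinP.
  move/integrableP : f1 => [_]; apply: le_lt_trans.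
  rewrite (_ : integral mu setT (fun x => `|(EFin \o f) x|)%E =
     integral (pushforward mu phi) setT (fun x => `|(EFin \o f) x|)%E).
    rewrite ge0_integral_pushforward//.
    by apply: measurableT_comp => //; exact/measurable_EFinP.
  by apply: eq_measure_integral => A mA _; exact/esym/pE.
split => //; rewrite /RI /Rintegral; congr fine.
rewrite [RHS](_ : _ = integral (pushforward mu phi) setT (EFin \o f)).
  by rewrite integral_pushforward//; exact/measurable_EFinP.
by apply: eq_measure_integral => A mA _; exact/esym/pE.
Qed.

Lemma integ_trans f a : integ f -> integ (fun x => f (x + a)) /\
  RI (fun x => f (x + a)) = RI f.
Proof.
pose phi : R -> measurableTypeR R := fun x => x + a.
have mphi : measurable_fun setT phi.
  by apply: measurable_funD => //; exact: measurable_cst.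
have pE A : measurable A -> pushforward mu phi A = mu A.
  (* Lebesgue measure is determined by its values on half-open intervals, so only those are
     compared. *)
  move=> mA; apply/esym/lebesgue_measure_unique => //= _ [[c d]] _ <-.
  rewrite /pushforward (_ : phi @^-1` _ = `]c - a, d - a]%classic); last first.
    by apply/seteqP; split => x /=; rewrite !in_itv/= /phi ltrBlDr lerBrDr.
  rewrite !lebesgue_measure_itv/= !lte_fin ltrD2r; case: ifP => // _.
  by rewrite -!EFinB; congr (_%:E); ring.
exact: integ_preserving mphi pE.
Qed.

Lemma integ_refl f : integ f -> integ (fun x => f (- x)) /\
  RI (fun x => f (- x)) = RI f.
Proof.
apply: (@integ_preserving _ (-%R)); first exact: oppr_measurable.
exact: lebesgue_measureN.
Qed.

Lemma integ_flip f a : integ f -> integ (fun x => f (a - x)) /\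
  RI (fun x => f (a - x)) = RI f.
Proof.
move=> /(@integ_trans _ a)[h1 <-]; have [h2 <-] := integ_refl h1.
by split; [apply: integ_eq h2|apply: eq_RI] => x; rewrite addrC.
Qed.

Lemma seg_ge0 a b x : 0 <= seg a b x.
Proof. by have /andP[] := seg01 a b x. Qed.

Lemma seg_idem a b x : seg a b x * seg a b x = seg a b x.
Proof. by rewrite /seg; case: (_ <= _ <= _)%R; rewrite ?mulr1 ?mulr0. Qed.

Lemma meas_seg1 a b : measurable_fun setT (seg a b).
Proof. by apply: meas_seg => //; exact: measurable_cst. Qed.

End RealIntegral.

(** * Parametrised integrals and exchange of the order of integration *)

Section Fubini.
Variable R : realType.
Local Notation mu := (@lebesgue_measure R).
Implicit Types (f g h : R -> R) (a b c x y : R) (n : nat).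

(** Positive and negative parts are integrated separately by Tonelli, and [fine] is applied to the
    difference. Hence measurability of [F] alone suffices. *)
Lemma meas_RI d (T : measurableType d) (F : T * R -> R) :
  measurable_fun setT F ->
  measurable_fun setT (fun x : T => RI (fun y => F (x, y))).
Proof.
move=> mF; apply: (measurableT_comp (fine_measurable _)) => //.
rewrite (_ : (fun x : T => _) = fun x : T =>
  (\int[mu]_y ((EFin \o F)^\+ (x, y)) - \int[mu]_y ((EFin \o F)^\- (x, y)))%E).
  apply: emeasurable_funB.
    apply: (measurable_fun_fubini_tonelli_F (m2 := mu)) => //.
    by apply: measurable_funepos; exact/measurable_EFinP.
  apply: (measurable_fun_fubini_tonelli_F (m2 := mu)) => //.
  by apply: measurable_funeneg; exact/measurable_EFinP.
apply/funext => x; rewrite [LHS]integralE.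
under eq_integral do rewrite (funepos_comp (EFin \o F)).
by under [X in (_ - X)%E = _]eq_integral do rewrite (funeneg_comp (EFin \o F)).
Qed.

Lemma integ_section (F : R * R -> R) g h x : measurable_fun setT F ->
  (forall x y, `|F (x, y)| <= g x * h y) -> integ h ->
  integ (fun y => F (x, y)).
Proof.
move=> mF Fgh ih; apply: (integ_le (g := fun y => g x * h y)).
- exact: measurableT_comp.
- exact: integZ.
- by move=> y; exact: Fgh.
Qed.

Lemma integ_RI (F : R * R -> R) g h : measurable_fun setT F ->
  (forall x y, `|F (x, y)| <= g x * h y) -> integ g -> integ h ->
  integ (fun x => RI (fun y => F (x, y))).
Proof.
move=> mF Fgh ig ih; apply: (integ_le (g := fun x => g x * RI h)).
- exact: meas_RI.
- by apply: integ_eq (integZ (RI h) ig) => x; rewrite mulrC.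
- move=> x; rewrite -RIZ//; apply: RI_abs_le => //.
  + exact: integ_section Fgh ih.
  + exact: integZ.
Qed.

Lemma EFin_RI f : integ f -> (\int[mu]_x (f x)%:E)%E = (RI f)%:E.
Proof. by move=> i; rewrite /RI /Rintegral fineK//; exact: integrable_fin_num. Qed.

(** The separated majorant [g x * h y] yields integrability on the product at once; the kernels
    below are all bounded in this form. *)
Lemma RI_swap (F : R * R -> R) g h : measurable_fun setT F ->
  (forall x y, `|F (x, y)| <= g x * h y) -> integ g -> integ h ->
  RI (fun x => RI (fun y => F (x, y))) = RI (fun y => RI (fun x => F (x, y))).
Proof.
move=> mF Fgh ig ih.
have mFE : measurable_fun setT (EFin \o F) by exact/measurable_EFinP.
have mF' : measurable_fun setT (fun z : R * R => F (z.2, z.1)).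
  apply: (measurableT_comp mF).
  by apply: measurable_fun_pair; [exact: measurable_snd|exact: measurable_fst].
have Fhg y x : `|(fun z : R * R => F (z.2, z.1)) (y, x)| <= h y * g x by rewrite mulrC; exact: Fgh.
have i1 x : integ (fun y => F (x, y)) by exact: integ_section Fgh ih.
have i2 y : integ (fun x => F (x, y)) by exact: (integ_section y mF' Fhg ig).
have j1 : integ (fun x => RI (fun y => F (x, y))) by exact: integ_RI Fgh ig ih.
have j2 : integ (fun y => RI (fun x => F (x, y))) by exact: (integ_RI mF' Fhg).
apply: EFin_inj; rewrite -(EFin_RI j1) -(EFin_RI j2).
under eq_integral do rewrite -EFin_RI//.
under [in RHS]eq_integral do rewrite -EFin_RI//.
apply: (Fubini (m1 := mu) (m2 := mu) (f := EFin \o F)).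
apply/(integrable12ltyP mu mu mFE).
rewrite [X in (X < _)%E](_ : _ =
  (\int[mu]_x (RI (fun y => `|F (x, y)|))%:E)%E); last first.
  by apply: eq_integral => x _; rewrite -EFin_RI//; exact: integ_norm.
have mnF : measurable_fun setT (fun z => `|F z|) by exact: measurableT_comp.
rewrite EFin_RI ?ltry//; apply: (integ_RI (g := g) (h := h)) mnF _ ig ih => x y.
by rewrite normr_id.
Qed.

End Fubini.

(** * Square integrable real functions and the Cauchy-Schwarz inequality *)

Section L2real.
Variable R : realType.
Local Notation mu := (@lebesgue_measure R).
Implicit Types (f g h : R -> R) (a b c x y : R) (n : nat).

Definition sqint f : Prop := measurable_fun setT f /\ integ (fun x => f x ^+ 2).

Lemma sqint_mul f g : sqint f -> sqint g -> integ (fun x => f x * g x).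
Proof.
move=> [mf f2] [mg g2]; apply: integ_le (integD f2 g2) _.
  exact: measurable_funM.
by move=> x; rewrite ler_norml; apply/andP; split; nra.
Qed.

Lemma sqintD f g : sqint f -> sqint g -> sqint (fun x => f x + g x).
Proof.
move=> sf sg; split; first by case: sf sg => [? _] [? _]; exact: measurable_funD.
apply: (integ_eq (f := fun x => f x ^+ 2 + (2 * (f x * g x) + g x ^+ 2))).
  by move=> x; ring.
apply: integD; first by case: sf.
by apply: integD; [apply: integZ; exact: sqint_mul|case: sg].
Qed.

Lemma sqintZ c f : sqint f -> sqint (fun x => c * f x).
Proof.
move=> [mf f2]; split; first by apply: measurable_funM => //; exact: measurable_cst.
by apply: (integ_eq (f := fun x => c ^+ 2 * (f x ^+ 2))) (integZ _ f2) => x; ring.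
Qed.

Lemma sqintB f g : sqint f -> sqint g -> sqint (fun x => f x - g x).
Proof.
move=> sf /(sqintZ (-1)) sg.
by have := sqintD sf sg; congr sqint; apply/funext => x; ring.
Qed.

Lemma sqint_bdd f g M : sqint f -> measurable_fun setT g ->
  (forall x, `|g x| <= M) -> sqint (fun x => f x * g x).
Proof.
move=> [mf f2] mg gM; split; first exact: measurable_funM.
apply: (integ_eq (f := fun x => f x ^+ 2 * g x ^+ 2)) => [x|]; first by ring.
apply: (integMb (M := M ^+ 2)) => // [|x].
  exact: measurable_funX.
by rewrite normrX lerXn2r// ?nnegrE// (le_trans _ (gM x)).
Qed.

Lemma sqint_seg a b : sqint (seg a b).
Proof.
split; first exact: meas_seg1.
apply: integ_eq (integ_seg a b) => x.
by rewrite /seg; case: (_ <= _ <= _)%R; rewrite ?expr1n ?expr0n.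
Qed.

Lemma cauchy_schwarz f g : sqint f -> sqint g ->
  RI (fun x => f x * g x) ^+ 2 <= RI (fun x => f x ^+ 2) * RI (fun x => g x ^+ 2).
Proof.
move=> sf sg; have ifg := sqint_mul sf sg.
case: sf => mf f2; case: sg => mg g2.
set A := RI (fun x => f x ^+ 2); set B := RI _; set D := RI (fun x => g x ^+ 2).
have A0 : 0 <= A by apply: RI_ge0 => x; exact: sqr_ge0.
have D0 : 0 <= D by apply: RI_ge0 => x; exact: sqr_ge0.
have H t : 0 <= A - 2 * t * B + t ^+ 2 * D.
  have : 0 <= RI (fun x => (f x - t * g x) ^+ 2).
    by apply: RI_ge0 => x; exact: sqr_ge0.
  rewrite (@eq_RI _ _ (fun x => f x ^+ 2 - 2 * t * (f x * g x) +
    t ^+ 2 * g x ^+ 2)); last by move=> x; ring.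
  rewrite RID ?RIB ?RIZ//; try exact: integZ.
  by apply: integB => //; exact: integZ.
have [D00|D1] := eqVneq D 0.
  have [->|B0] := eqVneq B 0; first by rewrite D00 mulr0 expr0n.
  (* With [D = 0] the quadratic is affine in [t], and at this [t] it would equal -1. *)
  have := H ((A + 1) / (2 * B)); rewrite D00 mulr0 addr0.
  have -> : 2 * ((A + 1) / (2 * B)) * B = A + 1 by field.
  lra.
have := H (B / D); have -> : A - 2 * (B / D) * B + (B / D) ^+ 2 * D =
  (A * D - B ^+ 2) / D by field.
by rewrite pmulr_lge0 ?subr_ge0// invr_gt0 lt_neqAle eq_sym D1.
Qed.

Lemma RI_seg_sqint a b f : a <= b -> sqint f ->
  integ (fun x => seg a b x * `|f x|) /\
  RI (fun x => seg a b x * `|f x|) ^+ 2 <= (b - a) * RI (fun x => f x ^+ 2).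
Proof.
move=> ab [mf f2].
have sf : sqint (fun x => `|f x|).
  split; first exact: measurableT_comp.
  by apply: integ_eq f2 => x; rewrite real_normK ?num_real.
split; first exact: sqint_mul (sqint_seg a b) sf.
apply: le_trans (cauchy_schwarz (sqint_seg a b) sf) _; apply: ler_pM => //.
- by apply: RI_ge0 => x; exact: sqr_ge0.
- by apply: RI_ge0 => x; exact: sqr_ge0.
- rewrite (@eq_RI _ _ (seg a b)) ?RI_seg1// => x.
  by rewrite /seg; case: (_ <= _ <= _)%R; rewrite ?expr1n ?expr0n.
- by rewrite (@eq_RI _ _ (fun x => f x ^+ 2))// => x; rewrite real_normK ?num_real.
Qed.

End L2real.

(** * The fundamental theorem of calculus for trigonometric integrals *)

Section Trig.
Variable R : realType.
Implicit Types (f g h : R -> R) (a b c x y : R) (n : nat).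

Lemma continuousM_arg f c : continuous f -> continuous (fun x => f (c * x)).
Proof. by move=> cf x; apply: continuous_comp; [exact: mulrl_continuous|exact: cf]. Qed.

Lemma measM_arg f c : continuous f -> measurable_fun setT (fun x => f (c * x)).
Proof. by move=> cf; apply: continuous_measurable_fun; exact: continuousM_arg. Qed.

Lemma meas_cosM c : measurable_fun setT (fun x => cos (c * x)).
Proof. by apply: measM_arg; exact: continuous_cos. Qed.

Lemma meas_sinM c : measurable_fun setT (fun x => sin (c * x)).
Proof. by apply: measM_arg; exact: continuous_sin. Qed.

Lemma meas_expM c : measurable_fun setT (fun x => expR (c * x)).
Proof. by apply: measM_arg; exact: continuous_expR. Qed.

Lemma continuous_derivable f : (forall x, derivable f x 1) -> continuous f.
Proof. by move=> df x; apply: differentiable_continuous; exact/derivable1_diffP. Qed.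

Lemma RI_FTC f (F : R -> R) a b : a <= b -> continuous f ->
  (forall x, is_derive x 1 F (f x)) ->
  RI (fun x => seg a b x * f x) = F b - F a.
Proof.
rewrite le_eqVlt => /predU1P[<-|ab] cf dF.
  by rewrite -RI_seg set_itv1 Rintegral_set1 subrr.
rewrite -RI_seg /Rintegral (@continuous_FTC2 _ f F)//.
- exact: continuous_subspaceT.
- have cF : continuous F by apply: continuous_derivable => x; case: (dF x).
  split; first by move=> x _; case: (dF x).
    exact/cvg_at_right_filter/cF.
  exact/cvg_at_left_filter/cF.
- by move=> x _; rewrite derive1E; case: (dF x).
Qed.

Lemma is_derive_sinM c x : is_derive x 1 (fun x => sin (c * x)) (c * cos (c * x)).
Proof.
apply: is_derive_eq; rewrite /GRing.scale/= ; ring.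
Qed.

Lemma is_derive_cosM c x : is_derive x 1 (fun x => cos (c * x)) (- (c * sin (c * x))).
Proof.
apply: is_derive_eq; rewrite /GRing.scale/= ; ring.
Qed.

Lemma RI_cos c a b : a <= b -> c != 0 ->
  RI (fun x => seg a b x * cos (c * x)) = (sin (c * b) - sin (c * a)) / c.
Proof.
move=> ab c0.
have cc := continuousM_arg (c := c) (@continuous_cos R).
have dd x : is_derive x 1 (fun x => c^-1 * sin (c * x)) (cos (c * x)).
  by have := is_derive_sinM c x => h; apply: is_derive_eq; rewrite /GRing.scale/=; field.
by rewrite (RI_FTC ab cc dd); field.
Qed.

Lemma integ_cosM a b c : integ (fun x => seg a b x * cos (c * x)).
Proof.
by apply: (integ_segB _ _ (M := 1)) => [|x]; [exact: meas_cosM|exact: cos_max].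
Qed.

End Trig.

(** * The value of the sum of 1 / (k + 1/2)^2, bounded from below *)

Section Basel.
Variable R : realType.
Implicit Types (f g h : R -> R) (a b c x y : R) (n : nat).

Lemma sin_le x : 0 <= x -> sin x <= x.
Proof.
move=> x0.
have cc : continuous (@cos R) by exact: continuous_cos.
have dd (t : R) : is_derive t 1 (@sin R) (cos t) by exact: is_derive_sin.
have := RI_FTC x0 cc dd; rewrite sin0 subr0 => <-.
rewrite -[leRHS]subr0 -RI_seg1//; apply: RI_le.
- by apply: (integ_segB _ _ (M := 1)) => // [|t]; [exact: continuous_measurable_fun|exact: cos_max].
- exact: integ_seg.
- by move=> t; have /andP[? ?] := seg01 0 x t; rewrite ler_piMr// cos_le1.
Qed.

Lemma sin_abs_le x : `|sin x| <= `|x|.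
Proof.
wlog x0 : x / 0 <= x => [H|].
  have [/H//|/ltW x0] := leP 0 x.
  by rewrite -normrN -sinN -[leRHS]normrN; apply: H; rewrite oppr_ge0.
rewrite [leRHS]ger0_norm//; have [x1|x1] := leP x 1.
  rewrite ger0_norm ?sin_le//; apply: sin_ge0_pi; rewrite x0/=.
  by apply: le_trans x1 _; apply: le_trans (pi_ge2 R); rewrite ler1n.
exact: le_trans (sin_max x) (ltW x1).
Qed.

(** The function [sin t - t * cos t] vanishes at 0 and has derivative [t * sin t], which is
    nonnegative up to pi. *)
Lemma xcos_le_sin x : 0 <= x <= pi -> x * cos x <= sin x.
Proof.
move=> /andP[x0 xpi].
have cc : continuous (fun t : R => t * sin t).
  by move=> t; apply: cvgM; [exact: cvg_id|exact: continuous_sin].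
have dd (t : R) : is_derive t 1 (fun t : R => sin t - t * cos t) (t * sin t).
  by apply: is_derive_eq; rewrite /GRing.scale/=; ring.
have := RI_FTC x0 cc dd; rewrite sin0 mul0r subr0 subr0 => h.
rewrite -subr_ge0 -h; apply: RI_ge0 => t; rewrite /seg.
case: (boolP (0 <= t <= x)) => [/andP[t0 tx]|_]; last by rewrite mul0r.
rewrite mul1r mulr_ge0// sin_ge0_pi// t0/=; exact: le_trans xpi.
Qed.

(** The frequencies for which [cos (theta k * x)] has zero derivative at 0 and vanishes at pi; there
    is no zero frequency among them. *)
Definition theta (k : nat) : R := k%:R + 2^-1.

Lemma theta_gt0 k : 0 < theta k.
Proof. by rewrite ltr_wpDl// invr_gt0. Qed.

Lemma theta_neq0 k : theta k != 0.
Proof. by rewrite gt_eqF ?theta_gt0. Qed.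

(** This is 1/s^2 + 1/c^2 = 1/(s c)^2 for the sine and cosine of [x / 2]. The cosine is written as a
    sine of the reflected angle, so that both summands are values of 1/sin^2 at nodes of a grid
    twice as fine. *)
Lemma sin2_double (x : R) : 0 < x < pi ->
  (sin (x / 2)) ^- 2 + (sin (pi / 2 - x / 2)) ^- 2 = 4 * (sin x) ^- 2.
Proof.
move=> xpi; have /andP[x0 x1] := xpi.
rewrite -opprB sinN sinBpihalf opprK.
have -> : sin x = 2 * (sin (x / 2) * cos (x / 2)).
  rewrite {1}(_ : x = (x / 2) *+ 2) ?sin_mulr2n; last by rewrite mulr2n; field.
  by rewrite mulr2n; ring.
have s0 : sin (x / 2) != 0.
  by rewrite gt_eqF// sin_gt0_pi//; apply/andP; split; lra.
have c0 : cos (x / 2) != 0.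
  by rewrite gt_eqF// cos_gt0_pihalf//; apply/andP; split; lra.
have := cos2Dsin2 (x / 2); move: (sin _) (cos _) s0 c0 => s c s0 c0 e.
transitivity ((c ^+ 2 + s ^+ 2) * (s ^- 2 * c ^- 2)).
  by field; rewrite s0 c0.
by rewrite e; field; rewrite s0 c0.
Qed.

(** The odd multiples of pi / (4 n) lying in ]0, pi/2[. *)
Definition node n k : R := theta k * pi / (2 * n%:R).

Lemma node_itv n k : (k < n)%N -> 0 < node n k < pi / 2.
Proof.
move=> kn; have n0 : 0 < n%:R :> R by rewrite ltr0n (leq_trans _ kn).
rewrite /node; apply/andP; split.
  by rewrite divr_gt0 ?mulr_gt0 ?theta_gt0 ?pi_gt0.
rewrite ltr_pdivrMr ?mulr_gt0// mulrC.
have -> : pi / 2 * (2 * n%:R) = pi * n%:R :> R by field.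
rewrite ltr_pM2l ?pi_gt0//; apply: lt_le_trans (_ : k.+1%:R <= _); last by rewrite ler_nat.
by rewrite -natr1 ltrD2l; lra.
Qed.

(* Summing the duplication identity for 1 / sin^2 over dyadic nodes. *)
Lemma sum_sin2 m : \sum_(k < 2 ^ m) (sin (node (2 ^ m) k)) ^- 2 =
  2 * ((2 ^ m)%:R) ^+ 2.
Proof.
elim: m => [|m IH].
  rewrite expn0 big_ord1 /node /theta.
  have := @sin2_double (pi / 2); rewrite sin_pihalf.
  have -> : pi / 2 - pi / 2 / 2 = pi / 2 / 2 :> R by field.
  have -> : (0%:R + 2^-1) * pi / (2 * 1%:R) = pi / 2 / 2 :> R by field.
  move=> /(_ _)/Wrap[].
    by have := pi_gt0 R => ?; apply/andP; split; lra.
  by rewrite !expr1n; lra.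
set n := (2 ^ m)%N in IH *.
have n0 : n%:R != 0 :> R by rewrite pnatr_eq0 expn_eq0.
have nn0 : n%:R + n%:R != 0 :> R by rewrite -mulr2n mulrn_eq0.
rewrite expnS -/n mul2n -addnn big_split_ord/=.
(* Reversing the upper half of the fine grid pairs each point [x / 2] with its mirror image
   [pi / 2 - x / 2], where [x] is a node of the coarse grid. *)
rewrite [X in _ + X](reindex_inj rev_ord_inj)/= -big_split/=.
under eq_bigr => k _.
  have -> : node (n + n) k = node n k / 2.
    by rewrite /node natrD; field; rewrite nn0 n0.
  have -> : node (n + n) (n + (n - k.+1)) = pi / 2 - node n k / 2.
    rewrite /node /theta !natrD natrB// -natr1; field; by rewrite nn0 n0.
  rewrite sin2_double; last first.
    by have /andP[h1 h2] := node_itv (ltn_ord k); apply/andP; split => //; have := pi_gt0 R; lra.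
  over.
by rewrite -mulr_sumr IH natrD; ring.
Qed.

(** At a node, 1/x^2 >= cot^2 x = 1/sin^2 x - 1. Summing over the n = 2^m nodes gives 4 n^2 / pi^2
    times the sum >= 2 n^2 - n, that is, the sum is at least pi^2/2 - pi^2/(4 n). *)
Lemma basel_lower (e : R) : 0 < e ->
  exists n, pi ^+ 2 / 2 - e <= \sum_(k < n) (theta k) ^- 2.
Proof.
move=> e0.
(* This is the condition pi^2/(4 n) <= e for n = 2^m. *)
have [m hm] : exists m : nat, pi ^+ 2 / (4 * e) <= (2 ^ m)%:R.
  exists (Num.bound (pi ^+ 2 / (4 * e))); apply: le_trans (ltW (archi_boundP _)) _.
    by rewrite divr_ge0 ?sqr_ge0// mulr_ge0// ltW.
  by rewrite ler_nat ltnW// ltn_expl.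
exists (2 ^ m)%N; set n := (2 ^ m)%N in hm *.
have n0 : 0 < n%:R :> R by rewrite ltr0n expn_gt0.
have p0 := pi_gt0 R.
have key (k : 'I_n) : (sin (node n k)) ^- 2 - 1 <=
    4 * n%:R ^+ 2 / pi ^+ 2 * (theta k) ^- 2.
  have /andP[x0 x1] := node_itv (ltn_ord k).
  have -> : 4 * n%:R ^+ 2 / pi ^+ 2 * (theta k) ^- 2 = (node n k) ^- 2.
    have [p1 n1] : pi != 0 :> R /\ n%:R != 0 :> R by rewrite !gt_eqF.
    have th0 := theta_neq0 k; rewrite /node.
    move: (theta k) (n%:R : R) (pi : R) th0 p1 n1 => t N P t0 P0 N0.
    by field; rewrite t0 P0 N0.
  move: (node n k) x0 x1 => x x0 x1.
  have s0 : 0 < sin x by apply: sin_gt0_pi; apply/andP; split=> //; lra.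
  have c0 : 0 < cos x by apply: cos_gt0_pihalf; apply/andP; split=> //; lra.
  have h : x * cos x <= sin x by apply: xcos_le_sin; apply/andP; split; lra.
  have -> : (sin x) ^- 2 - 1 = (cos x / sin x) ^+ 2.
    have := cos2Dsin2 x; move: s0; move: (sin _) (cos _) => s c s0 h1.
    have ec : c ^+ 2 = 1 - s ^+ 2 by rewrite -h1 addrK.
    by rewrite expr_div_n ec; field; rewrite gt_eqF.
  have hx : cos x / sin x <= x^-1 by rewrite ler_pdivrMr// ler_pdivlMl.
  have h0 : 0 <= cos x / sin x by rewrite divr_ge0 ?ltW.
  by rewrite -exprVn lerXn2r// nnegrE (le_trans h0).
have := ler_sum _ (fun k (_ : true) => key k); move=> /(_ (index_enum 'I_n)).
rewrite sumrB sum_sin2 -mulr_sumr -/n sumr_const card_ord => h.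
move: h; set S := \sum_(i < n) _; move: hm; set N : R := n%:R => hm h.
move: (n0 : 0 < N) h hm (pi_gt0 R); move: N S (pi : R) => N S P N0 h hm P0.
have h2 : (2 * N ^+ 2 - N) * (P ^+ 2 / (4 * N ^+ 2)) <= S.
  have -> : S = 4 * N ^+ 2 / P ^+ 2 * S * (P ^+ 2 / (4 * N ^+ 2)).
    by field; rewrite !gt_eqF.
  by rewrite ler_pM2r// divr_gt0 ?mulr_gt0 ?exprn_gt0.
apply: le_trans h2.
have -> : (2 * N ^+ 2 - N) * (P ^+ 2 / (4 * N ^+ 2)) = P ^+ 2 / 2 - P ^+ 2 / (4 * N).
  by field; rewrite gt_eqF.
rewrite lerD2l lerN2 ler_pdivrMr ?mulr_gt0//.
by move: hm; rewrite ler_pdivrMr ?mulr_gt0//; lra.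
Qed.

End Basel.

(** * Half-integer cosine and sine systems: Bessel's inequality and completeness *)

Section Fourier.
Variable R : realType.
Implicit Types (f g h W : R -> R) (a b c x y : R) (n : nat).

Lemma meas_sum n (f : nat -> R -> R) : (forall k, measurable_fun setT (f k)) ->
  measurable_fun setT (fun x => \sum_(k < n) f k x).
Proof.
move=> mf; elim: n => [|n IH].
  by under eq_fun do rewrite big_ord0; exact: measurable_cst.
by under eq_fun do rewrite big_ord_recr/=; exact: measurable_funD.
Qed.

Lemma sqint_sum n (f : nat -> R -> R) : (forall k, sqint (f k)) ->
  sqint (fun x => \sum_(k < n) f k x).
Proof.
move=> sf; elim: n => [|n IH].
  split; first by under eq_fun do rewrite big_ord0; exact: measurable_cst.
  by apply: integ_eq (@integ0 R) => x; rewrite big_ord0 expr0n.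
by under [X in sqint X]eq_fun do rewrite big_ord_recr/=; exact: sqintD.
Qed.

Lemma RI_mul_sum n (e : nat -> R -> R) (s : nat -> R) f : sqint f -> (forall k, sqint (e k)) ->
  RI (fun x => f x * \sum_(k < n) s k * e k x) = \sum_(k < n) s k * RI (fun x => f x * e k x).
Proof.
move=> sf se; have ife k := sqint_mul sf (se k).
rewrite (@eq_RI _ _ (fun x => \sum_(k < n) s k * (f x * e k x))); last first.
  by move=> x; rewrite mulr_sumr; apply: eq_bigr => k _; ring.
rewrite (@RI_sum R n (fun k x => s k * (f x * e k x))); last by move=> k; exact: integZ.
by apply: eq_bigr => k _; rewrite RIZ.
Qed.

Lemma RI_sq_sum n (e : nat -> R -> R) (s : nat -> R) (N : R) : (forall k, sqint (e k)) ->
  (forall j k, RI (fun x => e j x * e k x) = (j == k)%:R * N) ->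
  RI (fun x => (\sum_(k < n) s k * e k x) ^+ 2) = N * \sum_(k < n) s k ^+ 2.
Proof.
move=> se orth; have sS := @sqint_sum n (fun k x => s k * e k x) (fun k => sqintZ (s k) (se k)).
rewrite (@eq_RI _ _ (fun x => (\sum_(k < n) s k * e k x) * \sum_(k < n) s k * e k x))//.
rewrite RI_mul_sum// mulr_sumr; apply: eq_bigr => k _.
rewrite (@eq_RI _ _ (fun x => e k x * \sum_(j < n) s j * e j x)); last by move=> x; rewrite mulrC.
rewrite RI_mul_sum// (bigD1 k)//= big1 ?addr0.
  by rewrite orth eqxx mul1r; ring.
by move=> j jk; rewrite orth eq_sym (inj_eq val_inj) (negbTE jk) mul0r mulr0.
Qed.

Lemma bessel n (e : nat -> R -> R) f (N : R) : 0 < N -> sqint f ->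
  (forall k, sqint (e k)) ->
  (forall j k, RI (fun x => e j x * e k x) = (j == k)%:R * N) ->
  \sum_(k < n) RI (fun x => f x * e k x) ^+ 2 <= N * RI (fun x => f x ^+ 2).
Proof.
move=> N0 sf se orth; pose s k := RI (fun x => f x * e k x) / N.
have sS := @sqint_sum n (fun k x => s k * e k x) (fun k => sqintZ (s k) (se k)).
have R1 := RI_mul_sum n s sf se; have R2 := RI_sq_sum n s se orth.
have ifS := sqint_mul sf sS; have [_ S2] := sS; have [_ f2] := sf.
have : 0 <= RI (fun x => (f x - \sum_(k < n) s k * e k x) ^+ 2) by apply: RI_ge0 => x; exact: sqr_ge0.
rewrite (@eq_RI _ _ (fun x => f x ^+ 2 - 2 * (f x * \sum_(k < n) s k * e k x) +
  (\sum_(k < n) s k * e k x) ^+ 2)); last by move=> x; ring.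
rewrite RID ?RIB ?RIZ//; [|exact: integZ|by apply: integB => //; exact: integZ].
rewrite R1 R2 (_ : \sum_(k < n) s k * _ = N * \sum_(k < n) s k ^+ 2); last first.
  by rewrite mulr_sumr; apply: eq_bigr => k _; rewrite /s; field; rewrite gt_eqF.
rewrite (_ : \sum_(k < n) RI _ ^+ 2 = N * (N * \sum_(k < n) s k ^+ 2)); last first.
  by rewrite !mulr_sumr; apply: eq_bigr => k _; rewrite /s; field; rewrite gt_eqF.
by move=> h; rewrite ler_pM2l//; lra.
Qed.

(** The scale [c] covers both systems in use: [c = 1] gives the cosines on (0, pi) at frequency
    theta, [c = 1/2] the cosines and sines on (0, 2 pi) at frequency theta / 2. *)
Definition ecos c k x : R := seg 0 (pi / c) x * cos (c * theta R k * x).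
Definition esin c k x : R := seg 0 (pi / c) x * sin (c * theta R k * x).

Lemma sqint_ecos c k : sqint (ecos c k).
Proof.
apply: (sqint_bdd (M := 1)) => //; first exact: sqint_seg.
  exact: meas_cosM.
by move=> x; exact: cos_max.
Qed.

Lemma sqint_esin c k : sqint (esin c k).
Proof.
apply: (sqint_bdd (M := 1)) => //; first exact: sqint_seg.
  exact: meas_sinM.
by move=> x; exact: sin_max.
Qed.

Lemma sin_natpi n : sin (n%:R * pi) = 0 :> R.
Proof.
elim: n => [|n IH]; first by rewrite mul0r sin0.
by rewrite -natr1 mulrDl mul1r sinDpi IH oppr0.
Qed.

Lemma sin_diffpi j k : sin ((j%:R - k%:R) * pi) = 0 :> R.
Proof. by rewrite mulrBl sinB !sin_natpi mul0r mulr0 subrr. Qed.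

(* The two integrals of cos ((theta_j -+ theta_k) c x) over [0, pi / c]. *)
Lemma RI_cos_theta c j k : 0 < c ->
  RI (fun x => seg 0 (pi / c) x * cos (c * (theta R j - theta R k) * x)) =
    (j == k)%:R * (pi / c) /\
  RI (fun x => seg 0 (pi / c) x * cos (c * (theta R j + theta R k) * x)) = 0.
Proof.
move=> c0; have L0 : 0 <= pi / c by rewrite divr_ge0 ?pi_ge0// ltW.
have cn : c != 0 by rewrite gt_eqF.
split.
  have [->|jk] := eqVneq j k.
    rewrite mul1r subrr mulr0 -[RHS]subr0 -RI_seg1//; apply: eq_RI => x.
    by rewrite mul0r cos0 mulr1.
  rewrite mul0r RI_cos//; last first.
    by rewrite mulf_neq0// /theta subr_eq0 (inj_eq (addIr _)) eqr_nat.
  have -> : c * (theta R j - theta R k) * (pi / c) = (j%:R - k%:R) * pi.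
    by rewrite /theta; field.
  by rewrite sin_diffpi mulr0 sin0 subrr mul0r.
rewrite RI_cos//; last first.
  by rewrite mulf_neq0// gt_eqF// addr_gt0// theta_gt0.
have -> : c * (theta R j + theta R k) * (pi / c) = (j + k).+1%:R * pi.
  by rewrite /theta -[(j + k).+1%:R]natr1 natrD; field.
by rewrite sin_natpi mulr0 sin0 subrr mul0r.
Qed.

Lemma ecos_orth c : 0 < c -> forall j k,
  RI (fun x => ecos c j x * ecos c k x) = (j == k)%:R * (pi / (2 * c)).
Proof.
move=> c0 j k; have [h1 h2] := RI_cos_theta j k c0.
rewrite (@eq_RI _ _ (fun x => 2^-1 * (seg 0 (pi / c) x * cos (c * (theta R j - theta R k) * x)
   + seg 0 (pi / c) x * cos (c * (theta R j + theta R k) * x)))).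
  rewrite RIZ ?RID ?h1 ?h2; [|exact: integ_cosM|exact: integ_cosM|].
    by field; rewrite gt_eqF.
  by apply: integD; exact: integ_cosM.
move=> x; rewrite /ecos mulrACA seg_idem.
have -> : c * (theta R j - theta R k) * x = c * theta R j * x - c * theta R k * x by ring.
have -> : c * (theta R j + theta R k) * x = c * theta R j * x + c * theta R k * x by ring.
by rewrite cosB cosD; field.
Qed.

Lemma esin_orth c : 0 < c -> forall j k,
  RI (fun x => esin c j x * esin c k x) = (j == k)%:R * (pi / (2 * c)).
Proof.
move=> c0 j k; have [h1 h2] := RI_cos_theta j k c0.
rewrite (@eq_RI _ _ (fun x => 2^-1 * (seg 0 (pi / c) x * cos (c * (theta R j - theta R k) * x)
   - seg 0 (pi / c) x * cos (c * (theta R j + theta R k) * x)))).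
  rewrite RIZ ?RIB ?h1 ?h2; [|exact: integ_cosM|exact: integ_cosM|].
    by field; rewrite gt_eqF.
  by apply: integB; exact: integ_cosM.
move=> x; rewrite /esin mulrACA seg_idem.
have -> : c * (theta R j - theta R k) * x = c * theta R j * x - c * theta R k * x by ring.
have -> : c * (theta R j + theta R k) * x = c * theta R j * x + c * theta R k * x by ring.
by rewrite cosB cosD; field.
Qed.

Lemma bessel_cos c n f : 0 < c -> sqint f ->
  \sum_(k < n) RI (fun x => f x * ecos c k x) ^+ 2 <=
  pi / (2 * c) * RI (fun x => f x ^+ 2).
Proof.
move=> c0 sf; apply: bessel => //; last exact: ecos_orth.
  by rewrite divr_gt0 ?pi_gt0 ?mulr_gt0.
by move=> k; exact: sqint_ecos.
Qed.

Lemma bessel_sin c n f : 0 < c -> sqint f ->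
  \sum_(k < n) RI (fun x => f x * esin c k x) ^+ 2 <=
  pi / (2 * c) * RI (fun x => f x ^+ 2).
Proof.
move=> c0 sf; apply: bessel => //; last exact: esin_orth.
  by rewrite divr_gt0 ?pi_gt0 ?mulr_gt0.
by move=> k; exact: sqint_esin.
Qed.


Lemma RI_sin2 c k : 0 < c ->
  RI (fun x => seg 0 (pi / c) x * sin (c * theta R k * x) ^+ 2) = pi / (2 * c).
Proof.
move=> c0; have := esin_orth c0 k k; rewrite eqxx mul1r => <-.
by apply: eq_RI => x; rewrite /esin mulrACA seg_idem expr2.
Qed.

Definition defect n y : R :=
  y - 2 / pi * \sum_(k < n) (sin (theta R k * y) / theta R k) ^+ 2.

Lemma ecos1 k x : ecos 1 k x = seg 0 pi x * cos (theta R k * x).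
Proof. by rewrite /ecos divr1 mul1r. Qed.

Lemma RI_ecos1_seg k y : 0 <= y <= pi ->
  RI (fun x => seg 0 y x * ecos 1 k x) = sin (theta R k * y) / theta R k.
Proof.
move=> /andP[y0 ypi]; rewrite (@eq_RI _ _ (fun x => seg 0 y x * cos (theta R k * x))).
  by rewrite RI_cos ?theta_neq0// mulr0 sin0 subr0.
move=> x; rewrite ecos1 mulrA; congr (_ * _); rewrite /seg.
case: (boolP (0 <= x <= y)) => [/andP[x0 xy]|_]; last by rewrite mul0r.
by rewrite x0 (le_trans xy)// mul1r.
Qed.

(* [defect n y] is the squared distance from the indicator of [0, y] to the
   span of the first n cosines. *)
Lemma partial_sum_bound W n y : sqint W -> 0 <= y <= pi ->
  (RI (fun x => seg 0 y x * W x) -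
   2 / pi * \sum_(k < n) RI (fun x => W x * ecos 1 k x) * (sin (theta R k * y) / theta R k)) ^+ 2
  <= RI (fun x => W x ^+ 2) * defect n y.
Proof.
move=> sW yp; have /andP[y0 ypi] := yp; have p0 : 0 < pi :> R := pi_gt0 R.
pose s k := sin (theta R k * y) / theta R k.
pose S x := \sum_(k < n) s k * ecos 1 k x.
have sS : sqint S.
  by apply: (@sqint_sum n (fun k x => s k * ecos 1 k x)) => k; apply: sqintZ; exact: sqint_ecos.
have isW : integ (fun x => seg 0 y x * W x) by apply: sqint_mul => //; exact: sqint_seg.
have E1 : RI (fun x => W x * S x) = \sum_(k < n) RI (fun x => W x * ecos 1 k x) * s k.
  rewrite RI_mul_sum//; first by apply: eq_bigr => k _; rewrite mulrC.
  exact: sqint_ecos.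
have E2 : RI (fun x => seg 0 y x * S x) = \sum_(k < n) s k ^+ 2.
  rewrite RI_mul_sum; [|exact: sqint_seg|exact: sqint_ecos].
  by apply: eq_bigr => k _; rewrite RI_ecos1_seg.
have E3 : RI (fun x => S x ^+ 2) = pi / 2 * \sum_(k < n) s k ^+ 2.
  rewrite (RI_sq_sum _ _ _ (ecos_orth ltr01)) ?mulr1//; exact: sqint_ecos.
have sr : sqint (fun x => seg 0 y x - 2 / pi * S x).
  by apply: sqintB; [exact: sqint_seg|exact: sqintZ].
(* [W] is paired with the residual of the indicator of [[0, y]], so the left side becomes the error
   at [y] of the integrated cosine series of [W]. *)
have := cauchy_schwarz sW sr.
rewrite (@eq_RI _ (fun x => W x * (seg 0 y x - 2 / pi * S x))
  (fun x => seg 0 y x * W x - 2 / pi * (W x * S x))); last by move=> x; ring.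
have iWS : integ (fun x => W x * S x) by exact: sqint_mul.
rewrite RIB ?RIZ// ?E1; last exact: integZ.
rewrite (@eq_RI _ (fun x => (seg 0 y x - 2 / pi * S x) ^+ 2)
  (fun x => seg 0 y x - 2 * (2 / pi) * (seg 0 y x * S x) + (2 / pi) ^+ 2 * S x ^+ 2)); last first.
  move=> x; have := seg_idem 0 y x; move: (seg _ _ _) (S x) (2 / pi) => z w q hz.
  by rewrite sqrrB [z ^+ 2]expr2 hz; ring.
have isS : integ (fun x => seg 0 y x * S x) by apply: sqint_mul => //; exact: sqint_seg.
have iS2 : integ (fun x => S x ^+ 2) by case: sS.
have is0 := integ_seg 0 y.
rewrite RID ?RIB ?RIZ ?E2 ?E3 ?RI_seg1//; try exact: integZ; last by apply: integB => //; exact: integZ.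
suff -> : y - 0 - 2 * (2 / pi) * \sum_(k < n) s k ^+ 2 +
   (2 / pi) ^+ 2 * (pi / 2 * \sum_(k < n) s k ^+ 2) = defect n y by [].
have -> : defect n y = y - 2 / pi * \sum_(k < n) s k ^+ 2 by [].
have pn : pi != 0 :> R by rewrite gt_eqF.
by move: (\sum_(k < n) _) (pi : R) pn => T P P0; field; rewrite P0.
Qed.

Lemma defectE n y : seg 0 pi y * defect n y = seg 0 pi y * y - \sum_(k < n)
  (2 / pi * (theta R k) ^- 2) * (seg 0 pi y * sin (theta R k * y) ^+ 2).
Proof.
rewrite /defect mulrBr !mulr_sumr; congr (_ - _).
by apply: eq_bigr => k _; rewrite expr_div_n; ring.
Qed.

Lemma integ_sin2 k : integ (fun y => seg 0 pi y * sin (theta R k * y) ^+ 2).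
Proof.
apply: (integ_segB _ _ (M := 1)) => [|x]; first by apply: measurable_funX; exact: meas_sinM.
by rewrite normrX expr_le1// sin_max.
Qed.

Lemma integ_segid a b : integ (fun y => seg a b y * y).
Proof. by apply: integ_cont; apply: continuous_subspaceT => x; exact: cvg_id. Qed.

Lemma integ_defect n : integ (fun y => seg 0 pi y * defect n y).
Proof.
apply: (integ_eq (fun y => esym (defectE n y))); apply: integB; first exact: integ_segid.
apply: (@integ_sum R n (fun k y => (2 / pi * (theta R k) ^- 2) * (seg 0 pi y * sin (theta R k * y) ^+ 2))) => k.
exact/integZ/integ_sin2.
Qed.

(** Each [sin (theta k * y) ^+ 2] has mean 1/2 over (0, pi), so the integrated squared distance is
    exactly the remainder of the sum of 1 / theta^2. By [basel_lower] it becomes arbitrarily small: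
    this is where completeness comes from. *)
Lemma RI_defect n : RI (fun y => seg 0 pi y * defect n y) =
  pi ^+ 2 / 2 - \sum_(k < n) (theta R k) ^- 2.
Proof.
have p0 : 0 < pi :> R := pi_gt0 R.
have is2 k := integZ (2 / pi * (theta R k) ^- 2) (integ_sin2 k).
rewrite (eq_RI (defectE n)) RIB; [|exact: integ_segid|]; last first.
  exact: (@integ_sum R n (fun k y => (2 / pi * (theta R k) ^- 2) * (seg 0 pi y * sin (theta R k * y) ^+ 2))).
congr (_ - _).
  have dd (t : R) : is_derive t 1 (fun t : R => 2^-1 * t ^+ 2) t.
    by apply: is_derive_eq; rewrite /GRing.scale/=; field.
  rewrite (RI_FTC (ltW p0) _ dd); last by move=> x; exact: cvg_id.
  by rewrite expr0n/=; field.
rewrite (@RI_sum R n (fun k y => (2 / pi * (theta R k) ^- 2) * (seg 0 pi y * sin (theta R k * y) ^+ 2))); last first.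
  by [].
apply: eq_bigr => k _; rewrite RIZ; last exact: integ_sin2.
have := RI_sin2 k (ltr01 : 0 < 1 :> R); rewrite divr1 mulr1 => h.
rewrite (@eq_RI _ _ (fun x => seg 0 pi x * sin (1 * theta R k * x) ^+ 2)); last by move=> x; rewrite mul1r.
rewrite h; have pn : pi != 0 :> R by rewrite gt_eqF.
by move: (theta R k) (pi : R) (theta_neq0 R k) pn => t P t0 P0; field; rewrite t0 P0.
Qed.


(** Integration starts at -oo, the form in which Lebesgue's differentiation theorem is applied
    below. For [W] supported in [0, pi] it is the integral from 0. *)
Definition prim W x : R := Rintegral (@lebesgue_measure R) `]-oo, x]%classic W.

Lemma primE W x : prim W x = RI (fun t => (t <= x)%R%:R * W t).
Proof.
rewrite /prim RI_set//; apply: eq_RI => t; congr (_%:R * _).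
by rewrite mem_setE in_itv.
Qed.

Lemma prim_seg W x : (forall t, W t = seg 0 pi t * W t) -> 0 <= x <= pi ->
  prim W x = RI (fun t => seg 0 x t * W t).
Proof.
move=> hW /andP[x0 xpi]; rewrite primE; apply: eq_RI => t.
rewrite hW !mulrA; congr (_ * _); rewrite /seg -!natrM !mulnb; congr (_%:R).
case: (leP t x) => tx /=; last by rewrite andbF.
by rewrite andbT (le_trans tx xpi) andbT andbb.
Qed.

Lemma meas_prim W : measurable_fun setT W -> measurable_fun setT (prim W).
Proof.
move=> mW; rewrite (_ : prim W = fun x => RI (fun t => (t <= x)%R%:R * W t)); last first.
  by apply/funext => x; rewrite primE.
apply: (meas_RI (F := fun z : R * R => (z.2 <= z.1)%R%:R * W z.2)).
apply: measurable_funM; last by apply: measurableT_comp.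
apply: meas_b2r; apply: measurable_fun_ler => //; exact: measurable_fst.
Qed.

(** Weighted Young inequality: a small [d] leaves the constant in front of [f] close to 1, while the
    large constant falls on the part that tends to zero. *)
Lemma RI_sqr_split (f g : R -> R) (d : R) : 0 < d -> sqint f -> sqint g ->
  RI (fun x => (f x + g x) ^+ 2) <=
  (1 + d) * RI (fun x => f x ^+ 2) + (1 + d^-1) * RI (fun x => g x ^+ 2).
Proof.
move=> d0 sf sg; have [_ f2] := sf; have [_ g2] := sg; have [_ fg2] := sqintD sf sg.
rewrite -!RIZ// -RID; [|exact: integZ|exact: integZ].
apply: RI_le => // [|x]; first by apply: integD; exact: integZ.
rewrite -subr_ge0.
have -> : (1 + d) * f x ^+ 2 + (1 + d^-1) * g x ^+ 2 - (f x + g x) ^+ 2 =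
  d * (f x - d^-1 * g x) ^+ 2 by field; rewrite gt_eqF.
by rewrite mulr_ge0 ?sqr_ge0// ltW.
Qed.

(** A symmetric difference turns sines into cosines: sin(t(x+d)) - sin(t(x-d)) = 2 cos(t x) sin(t
    d). So [D] is a combination of the orthogonal cosines, and |sin(t d)/t| <= d bounds its
    coefficients. *)
Lemma sum_cos_bound n (A : R) (c : nat -> R) (d : R) :
  (forall n, \sum_(k < n) c k ^+ 2 <= A) -> 0 < d ->
  let D x := 2 / pi * \sum_(k < n) c k * ((sin (theta R k * (x + d)) - sin (theta R k * (x - d))) / theta R k) in
  sqint (fun x => seg 0 pi x * D x) /\
  RI (fun x => (seg 0 pi x * D x) ^+ 2) <= 2 / pi * (2 * d) ^+ 2 * A.
Proof.
move=> cA d0 D; have p0 : 0 < pi :> R := pi_gt0 R.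
pose b k := 2 / pi * c k * (2 * (sin (theta R k * d) / theta R k)).
have DE x : seg 0 pi x * D x = \sum_(k < n) b k * ecos 1 k x.
  rewrite /D !mulr_sumr; apply: eq_bigr => k _; rewrite ecos1 /b mulrDr mulrBr sinD sinB.
  have pn : pi != 0 :> R by rewrite gt_eqF.
  move: (seg 0 pi x) (sin (theta R k * x)) (cos (theta R k * x)) (sin (theta R k * d))
    (cos (theta R k * d)) => *.
  move: (theta R k) (theta_neq0 R k) (pi : R) pn => *.
  by field; apply/andP.
have se k := sqint_ecos 1 k.
have sS m : sqint (fun x => \sum_(k < m) b k * ecos 1 k x).
  by apply: (@sqint_sum m (fun k x => b k * ecos 1 k x)) => k; exact: sqintZ.
rewrite (_ : (fun x => seg 0 pi x * D x) = fun x => \sum_(k < n) b k * ecos 1 k x); last first.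
  exact/funext.
split=> //.
rewrite (eq_RI (g := fun x => (\sum_(k < n) b k * ecos 1 k x) ^+ 2)); last by move=> x; rewrite DE.
have iee j k : integ (fun x => ecos 1 j x * ecos 1 k x) by exact: sqint_mul.
rewrite (@eq_RI _ _ (fun x => \sum_(j < n) b j * (\sum_(k < n) b k * (ecos 1 j x * ecos 1 k x)))); last first.
  move=> x; rewrite expr2 mulr_suml; apply: eq_bigr => j _.
  by rewrite -mulrA [X in _ * X]mulr_sumr; congr (_ * _); apply: eq_bigr => k _; ring.
have I2' j : integ (fun x => \sum_(k < n) b k * (ecos 1 j x * ecos 1 k x)).
  by apply: (@integ_sum R n (fun k x => b k * (ecos 1 j x * ecos 1 k x))) => k; exact: integZ.
rewrite (@RI_sum R n (fun j x => b j * (\sum_(k < n) b k * (ecos 1 j x * ecos 1 k x)))); last first.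
  by move=> j; exact: integZ.
rewrite (eq_bigr (fun j : 'I_n => b j ^+ 2 * (pi / 2))); last first.
  move=> j _; rewrite RIZ// (@RI_sum R n (fun k x => b k * (ecos 1 j x * ecos 1 k x))); last first.
    by move=> k; exact: integZ.
  rewrite (bigD1 j)//= big1 ?addr0; last first.
    by move=> k kj; rewrite RIZ// ecos_orth// eq_sym (inj_eq val_inj) (negbTE kj) mul0r mulr0.
  by rewrite RIZ// ecos_orth// eqxx mul1r; field.
apply: (@le_trans _ _ (\sum_(k < n) (2 / pi * (2 * d) ^+ 2) * c k ^+ 2)); last first.
  by rewrite -mulr_sumr ler_wpM2l// mulr_ge0 ?divr_ge0 ?sqr_ge0// ltW.
apply: ler_sum => k _; rewrite /b.
have th0 := theta_gt0 R k.
have -> : (2 / pi * c k * (2 * (sin (theta R k * d) / theta R k))) ^+ 2 * (pi / 2) =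
  2 / pi * c k ^+ 2 * (2 * (sin (theta R k * d) / theta R k)) ^+ 2.
  have pn : pi != 0 :> R by rewrite gt_eqF.
  move: (sin (theta R k * d)) => *; move: (theta R k) (theta_neq0 R k) (pi : R) pn => *.
  by field; apply/andP.
rewrite [leRHS]mulrAC; apply: ler_wpM2l.
  by rewrite mulr_ge0 ?sqr_ge0 ?divr_ge0// ltW.
rewrite -real_normK ?num_real// -[leRHS]real_normK ?num_real// lerXn2r ?nnegrE//.
rewrite !normrM ler_wpM2l// normfV ler_pdivrMr ?normr_gt0 ?theta_neq0//.
by apply: le_trans (sin_abs_le _) _; rewrite normrM mulrC.
Qed.


(** The Steklov mean of [W] is a symmetric difference of its primitive, hence that of the integrated
    partial sum plus that of an error. [sum_cos_bound] controls the sum uniformly in [n]; the error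
    disappears as [n] grows because its norm is bounded through [RI_defect]. *)
Lemma steklov_bound W (A d : R) : sqint W -> (forall t, W t = seg 0 pi t * W t) ->
  (forall n, \sum_(k < n) RI (fun x => W x * ecos 1 k x) ^+ 2 <= A) ->
  0 < d -> 2 * d < pi ->
  RI (fun x => seg d (pi - d) x * ((prim W (x + d) - prim W (x - d)) / (2 * d)) ^+ 2)
    <= 2 / pi * A.
Proof.
move=> sW hW hA d0 dpi; have p0 : 0 < pi :> R := pi_gt0 R.
have [mW W2] := sW.
pose c k := RI (fun x => W x * ecos 1 k x).
pose S n y := 2 / pi * \sum_(k < n) c k * (sin (theta R k * y) / theta R k).
pose E n y := prim W y - S n y.
set B := RI (fun x => W x ^+ 2).
have B0 : 0 <= B by apply: RI_ge0 => x; exact: sqr_ge0.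
have EB n y : 0 <= y <= pi -> (E n y) ^+ 2 <= B * defect n y.
  by move=> yp; rewrite /E prim_seg//; exact: partial_sum_bound.
have mS n : measurable_fun setT (S n).
  apply: measurable_funM; first exact: measurable_cst.
  apply: (@meas_sum n (fun k y => c k * (sin (theta R k * y) / theta R k))) => k.
  apply: measurable_funM; first exact: measurable_cst.
  by apply: measurable_funM; [exact: meas_sinM|exact: measurable_cst].
have mE n : measurable_fun setT (E n).
  by apply: measurable_funB => //; exact: meas_prim.
have idef n : integ (fun y => seg 0 pi y * (B * defect n y)).
  by apply: integ_eq (integZ B (integ_defect n)) => y; ring.
have sE n : sqint (fun y => seg 0 pi y * E n y).
  split; first by apply: measurable_funM => //; exact: meas_seg1.
  apply: integ_le (idef n) _.
    by apply: measurable_funX; apply: measurable_funM => //; exact: meas_seg1.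
  move=> y; rewrite ger0_norm ?sqr_ge0// /seg.
  by case: (boolP (0 <= y <= pi)) => yp; rewrite ?mul0r ?expr0n// !mul1r EB.
have IE n : RI (fun y => (seg 0 pi y * E n y) ^+ 2) <=
    B * (pi ^+ 2 / 2 - \sum_(k < n) (theta R k) ^- 2).
  rewrite -RI_defect -RIZ; last exact: integ_defect.
  apply: RI_le; first by case: (sE n).
    by apply: integ_eq (idef n) => y; ring.
  move=> y; rewrite mulrCA /seg.
  by case: (boolP (0 <= y <= pi)) => yp; rewrite ?mul0r ?expr0n// !mul1r EB.
pose D n x := S n (x + d) - S n (x - d).
have DE n x : D n x = 2 / pi * \sum_(k < n) c k *
  ((sin (theta R k * (x + d)) - sin (theta R k * (x - d))) / theta R k).
  rewrite /D /S -mulrBr -sumrB; congr (_ * _); apply: eq_bigr => k _.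
  by rewrite -mulrBr mulrBl.
have sD n : sqint (fun x => seg d (pi - d) x * D n x) /\
    RI (fun x => (seg d (pi - d) x * D n x) ^+ 2) <= 2 / pi * (2 * d) ^+ 2 * A.
  have [h1 h2] := sum_cos_bound (c := c) n hA d0.
  have e x : seg d (pi - d) x * D n x = (seg 0 pi x * D n x) * seg d (pi - d) x.
    rewrite mulrAC; congr (_ * _); rewrite /seg -natrM mulnb; congr (_%:R).
    case: (boolP (d <= x <= pi - d)%R) => [/andP[a1 a2]|]; last by rewrite andbF.
    by rewrite andbT; congr nat_of_bool; apply/esym/andP; split; lra.
  have h1' : sqint (fun x => seg 0 pi x * D n x).
    by move: h1; congr sqint; apply/funext => x; rewrite DE.
  have s1 : sqint (fun x => seg d (pi - d) x * D n x).
    rewrite (_ : (fun x => _) = fun x => (seg 0 pi x * D n x) * seg d (pi - d) x); last exact/funext.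
    by apply: (sqint_bdd (M := 1)) => //; [exact: meas_seg1|exact: seg_abs].
  split=> //; apply: le_trans h2; apply: RI_le; [by case: s1| by case: h1|move=> x].
  rewrite -DE e exprMn ler_piMr ?sqr_ge0//.
  by have /andP[g0 g1] := seg01 d (pi - d) x; rewrite expr_le1.
pose G n x := E n (x + d) - E n (x - d).
have sG n : sqint (fun x => seg d (pi - d) x * G n x) /\
    RI (fun x => (seg d (pi - d) x * G n x) ^+ 2) <=
     4 * (B * (pi ^+ 2 / 2 - \sum_(k < n) (theta R k) ^- 2)).
  (* Cutting the error off outside [0, pi] lets both shifts be integrated over the whole line; for
     [x] in [[d, pi - d]] the cut is invisible. *)
  pose U y := seg 0 pi y * E n y.
  have [iU1 RU1] := integ_trans d (sE n).2.
  have [iU2 RU2] := integ_trans (- d) (sE n).2.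
  have mU : measurable_fun setT U by case: (sE n).
  have sU1 : sqint (fun x => U (x + d)).
    split=> //; apply: (measurableT_comp mU).
    by apply: measurable_funD => //; exact: measurable_cst.
  have sU2 : sqint (fun x => U (x - d)).
    split=> //; apply: (measurableT_comp mU).
    by apply: measurable_funD => //; exact: measurable_cst.
  have e x : seg d (pi - d) x * G n x = (U (x + d) - U (x - d)) * seg d (pi - d) x.
    rewrite mulrC /G /U; have [/andP[a1 a2]|h] := boolP (d <= x <= pi - d); last by rewrite (seg_out h) !mulr0.
    rewrite [seg 0 _ (x + d)]seg_in ?[seg 0 _ (x - d)]seg_in ?mul1r//; apply/andP; split; lra.
  have sUU := sqintB sU1 sU2.
  have s1 : sqint (fun x => seg d (pi - d) x * G n x).
    rewrite (_ : (fun x => _) = fun x => (U (x + d) - U (x - d)) * seg d (pi - d) x); last exact/funext.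
    by apply: (sqint_bdd (M := 1)) => //; [exact: meas_seg1|exact: seg_abs].
  split=> //; apply: (@le_trans _ _ (RI (fun x => (U (x + d) - U (x - d)) ^+ 2))).
    apply: RI_le; [by case: s1|by case: sUU|move=> x].
    rewrite e exprMn ler_piMr ?sqr_ge0//.
    by have /andP[g0 g1] := seg01 d (pi - d) x; rewrite expr_le1.
  have := RI_sqr_split (ltr01 : 0 < 1 :> R) sU1 (sqintZ (-1) sU2).
  rewrite (@eq_RI _ (fun x => (U (x + d) + -1 * U (x - d)) ^+ 2) (fun x => (U (x + d) - U (x - d)) ^+ 2)); last by move=> x; ring.
  rewrite (@eq_RI _ (fun x => (-1 * U (x - d)) ^+ 2) (fun x => (U (x - d)) ^+ 2)); last by move=> x; ring.
  rewrite RU1 RU2 => h; apply: le_trans h _; have := IE n; rewrite invr1; lra.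
have main n (t : R) : 0 < t ->
  RI (fun x => seg d (pi - d) x * (prim W (x + d) - prim W (x - d)) ^+ 2) <=
  (1 + t) * (2 / pi * (2 * d) ^+ 2 * A) + (1 + t^-1) * (4 * (B * (pi ^+ 2 / 2 - \sum_(k < n) (theta R k) ^- 2))).
  move=> t0; have [sD1 sD2] := sD n; have [sG1 sG2] := sG n.
  have := RI_sqr_split t0 sD1 sG1.
  rewrite (@eq_RI _ (fun x => (_ + _) ^+ 2) (fun x => seg d (pi - d) x * (prim W (x + d) - prim W (x - d)) ^+ 2)); last first.
    move=> x; rewrite -mulrDr exprMn expr2 seg_idem; congr (_ * _ ^+ 2).
    by rewrite /D /G /E; ring.
  move=> h; apply: le_trans h _; apply: lerD.
    by apply: ler_wpM2l => //; rewrite addr_ge0// ltW.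
  by apply: ler_wpM2l => //; rewrite addr_ge0// invr_ge0 ltW.
set I := RI _ in main *.
(* For fixed [t] the index [n] is sent to infinity through [basel_lower]; only afterwards does [t]
   tend to 0. *)
have sub (t : R) : 0 < t -> I <= (1 + t) * (2 / pi * (2 * d) ^+ 2 * A).
  move=> t0; apply/ler_addgt0Pr => e e0.
  have t1 : 0 < t^-1 by rewrite invr_gt0.
  (* The summand 1 keeps the divisor positive when [B = 0]. *)
  pose K := (1 + t^-1) * (4 * B) + 1.
  have K0 : 0 < K by rewrite /K ltr_wpDl// mulr_ge0 ?addr_ge0 ?mulr_ge0// ltW.
  have [n hn] := basel_lower (divr_gt0 e0 K0).
  apply: le_trans (main n t t0) _; rewrite lerD2l.
  have hn' : pi ^+ 2 / 2 - \sum_(k < n) (theta R k) ^- 2 <= e / K by lra.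
  have -> : (1 + t^-1) * (4 * (B * (pi ^+ 2 / 2 - \sum_(k < n) (theta R k) ^- 2))) =
    (1 + t^-1) * (4 * B) * (pi ^+ 2 / 2 - \sum_(k < n) (theta R k) ^- 2) by ring.
  apply: (@le_trans _ _ ((1 + t^-1) * (4 * B) * (e / K))).
    by apply: ler_wpM2l => //; rewrite mulr_ge0 ?addr_ge0 ?mulr_ge0// ltW.
  rewrite mulrCA; apply: ler_piMr; first exact: ltW.
  by rewrite ler_pdivrMr// mul1r /K; lra.
have A0 : 0 <= A by have := hA 0%N; rewrite big_ord0.
have fin : I <= 2 / pi * (2 * d) ^+ 2 * A.
  apply/ler_addgt0Pr => e e0; set X := _ * A in sub *.
  have X0 : 0 <= X by rewrite !mulr_ge0 ?sqr_ge0 ?invr_ge0// ltW.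
  have X1 : 0 < X + 1 by lra.
  apply: le_trans (sub _ (divr_gt0 e0 X1)) _.
  rewrite mulrDl mul1r lerD2l mulrAC ler_pdivrMr// ler_pM2l//; lra.
rewrite (@eq_RI _ _ (fun x => (2 * d) ^- 2 * (seg d (pi - d) x * (prim W (x + d) - prim W (x - d)) ^+ 2))); last first.
  by move=> x; rewrite expr_div_n; ring.
rewrite RIZ; last first.
  have [sD1 _] := sD 0%N; have [sG1 _] := sG 0%N.
  apply: integ_eq (sqintD sD1 sG1).2 => x.
  by rewrite -mulrDr exprMn expr2 seg_idem; congr (_ * _ ^+ 2); rewrite /D /G /E; ring.
rewrite mulrC ler_pdivrMr ?exprn_gt0 ?mulr_gt0//.
by apply: le_trans fin _; rewrite mulrAC.
Qed.


(** The half of Parseval's identity that expresses completeness. The Steklov means satisfy the bound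
    for every width and converge to [W] almost everywhere, so Fatou's lemma transfers it to [W]. *)
Lemma parseval_bound W (A : R) : sqint W -> (forall t, W t = seg 0 pi t * W t) ->
  (forall n, \sum_(k < n) RI (fun x => W x * ecos 1 k x) ^+ 2 <= A) ->
  RI (fun x => W x ^+ 2) <= 2 / pi * A.
Proof.
move=> sW hW hA; have p0 : 0 < pi :> R := pi_gt0 R.
have [mW W2] := sW.
have iW : integ W by apply: (integ_eq (fun t => esym (hW t))); apply: sqint_mul => //; exact: sqint_seg.
(* The width is 1 / (2 (m + 1)), so that [2 * d m <= 1 < pi] already for [m = 0]. *)
pose d m : R := 2^-1 * harmonic m.
have d0 m : 0 < d m by rewrite mulr_gt0 ?invr_gt0// ltr0n.
have dh m : 2 * d m < pi.
  apply: le_lt_trans (_ : 1 < pi); last by apply: lt_le_trans (pi_ge2 R); rewrite ltr1n.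
  by rewrite /d mulrA divff ?pnatr_eq0// mul1r /= invf_le1 ?ltr0n// ler1n.
pose f m x := seg (d m) (pi - d m) x * ((prim W (x + d m) - prim W (x - d m)) / (2 * d m)) ^+ 2.
have f0 m x : 0 <= f m x.
  by rewrite mulr_ge0 ?sqr_ge0//; have /andP[] := seg01 (d m) (pi - d m) x.
have mp := meas_prim mW.
have mf m : measurable_fun setT (f m).
  apply: measurable_funM; first exact: meas_seg1.
  apply: measurable_funX; apply: measurable_funM; last exact: measurable_cst.
  apply: measurable_funB; apply: (measurableT_comp mp).
    by apply: measurable_funD => //; exact: measurable_cst.
  by apply: measurable_funD => //; exact: measurable_cst.
have intf m : (\int[@lebesgue_measure R]_x (f m x)%:E)%E = (RI (f m))%:E.
  apply: EFin_RI; rewrite /f.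
  have [iW1 _] := RI_seg_sqint (ltW p0) sW.
  apply: (integ_segB _ _ (M := (2 * RI (fun t => `|W t|) / (2 * d m)) ^+ 2)).
    apply: measurable_funX; apply: measurable_funM; last exact: measurable_cst.
    apply: measurable_funB; apply: (measurableT_comp mp).
      by apply: measurable_funD => //; exact: measurable_cst.
    by apply: measurable_funD => //; exact: measurable_cst.
  have pb y : `|prim W y| <= RI (fun t => `|W t|).
    rewrite primE; apply: RI_abs_le; last 2 first.
    - exact: integ_norm.
    - by move=> t; rewrite normrM ler_piMl// normr_nat lern1 leq_b1.
    apply: (integ_eq (f := fun t => W t * (t <= y)%R%:R)) => [t|]; first by rewrite mulrC.
    apply: (integMb (M := 1)) => // [|t]; last by rewrite normr_nat lern1 leq_b1.
    by apply: meas_b2r; apply: measurable_fun_ler => //; exact: measurable_cst.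
  move=> x; have dm0 : 0 < 2 * d m by rewrite mulr_gt0.
  have bnd : `|(prim W (x + d m) - prim W (x - d m)) / (2 * d m)| <=
      2 * RI (fun t => `|W t|) / (2 * d m).
    rewrite normrM normfV (ger0_norm (ltW dm0)) ler_pM2r ?invr_gt0//.
    by apply: le_trans (ler_normB _ _) _; rewrite mulrDl mul1r lerD.
  by rewrite normrX lerXn2r// nnegrE (le_trans _ bnd).
rewrite -lee_fin -EFin_RI//.
pose g x := limn_einf (fun m => (f m x)%:E).
(* The lower limit [g] of the squared means separates the proof: its integral is bounded by Fatou,
   and it dominates [W ^+ 2] almost everywhere. *)
apply: (@le_trans _ _ (\int[@lebesgue_measure R]_x g x)%E); last first.
  apply: le_trans (fatou _ _ _ _) _ => //.
  - by move=> m; apply/measurable_EFinP; exact: mf.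
  - by move=> m x _; rewrite lee_fin.
  rewrite limn_einf_lim; apply: lime_le.
    exact: is_cvg_einfs.
  apply: nearW => m; apply: ereal_inf_le; exists (\int[@lebesgue_measure R]_x (f m x)%:E)%E.
    by exists m => /=.
  by rewrite intf lee_fin; exact: steklov_bound.
apply: ae_ge0_le_integral => //.
- by move=> x _; rewrite lee_fin sqr_ge0.
- by apply/measurable_EFinP; exact: measurable_funX.
- move=> x _; rewrite /g limn_einf_lim; apply: lime_ge; first exact: is_cvg_einfs.
  apply: nearW => m; apply: le_ereal_inf_tmp => _ [k _ <-].
  by rewrite lee_fin.
- rewrite (_ : g = fun x => (- limn_esup (fun m => (- f m x)%:E))%E).
    apply: measurableT_comp; first exact: oppe_measurable.
    apply: measurable_fun_limn_esup => m.
    by apply/measurable_EFinP; apply: measurable_funN; exact: mf.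
  apply/funext => x; rewrite -limn_einfN; congr limn_einf.
  by apply/funext => m /=; rewrite opprK.
have loc : locally_integrable setT W by apply: open_integrable_locally => //; exact: openT.
have iW' y : (@lebesgue_measure R).-integrable `]-oo, y]%classic (EFin \o W).
  by apply: integrableS iW.
have ae1 := FTC1Ny iW' loc.
(* At 0 and pi the cut-off [[d m, pi - d m]] never contains the point; both are discarded as a null
   set. *)
have ae2 : {ae (@lebesgue_measure R), forall x, x != 0 /\ x != pi}.
  exists [set 0; pi]; split.
  - by apply: measurableU; exact: measurable_set1.
  - by apply: countable_lebesgue_measure0; apply: finite_set_countable; exact: finite_set2.
  - move=> x /= /not_andP[] /negP; rewrite negbK => /eqP ->; [by left|by right].
apply: filterS2 ae1 ae2; first exact: (ae_filter_ringOfSetsType (@lebesgue_measure R)).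
move=> x [dP ePW] [x0 xpi] _.
have [/andP[xge xle]|xout] := boolP (0 <= x <= pi); last first.
  rewrite hW (seg_out xout) mul0r expr0n /= /g limn_einf_lim.
  apply: lime_ge; first exact: is_cvg_einfs.
  by apply: nearW => m; apply: le_ereal_inf_tmp => _ [k _ <-]; rewrite lee_fin.
suff cf : f m x @[m --> \oo] --> W x ^+ 2.
  have cE : (f m x)%:E @[m --> \oo] --> (W x ^+ 2)%:E.
    by apply: cvg_EFin => //; exact: nearW.
  by rewrite /g (cvg_limn_einf_sup cE).1.
have cd : d m @[m --> \oo] --> (0 : R).
  by rewrite -[0](mulr0 2^-1); apply: cvgM; [exact: cvg_cst|exact: cvg_harmonic].
(* Stated for any null sequence without zeros, so that it serves for [d m] and for [- d m]: the
   symmetric quotient is the mean of the two one-sided ones. *)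
have cd0 (u : nat -> R) : u m @[m --> \oo] --> (0 : R) -> (forall m, u m != 0) ->
    (u m)^-1 * (prim W (u m + x) - prim W x) @[m --> \oo] --> W x.
  move=> cu un0.
  have cu' : u m @[m --> \oo] --> (0 : R)^'.
    move=> B /= hB.
    have H : \forall m \near \oo, (u m != 0 -> B (u m)) := cu _ hB.
    change (\forall m \near \oo, B (u m)).
    by apply: filterS H => m h; exact: h (un0 m).
  pose qt (t : R) := t^-1 * (prim W (t + x) - prim W x).
  have cq : qt t @[t --> 0^'] --> W x.
    have e : (fun t : R => t^-1 *: ((prim W \o shift x) (t *: 1) - prim W x)) = qt.
      by apply/funext => t; rewrite /qt /GRing.scale/= mulr1.
    by rewrite -ePW derive1E -e; exact: dP.
  exact: (cvg_comp _ _ cu' cq).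
have near_in : \forall m \near \oo, (2^-1 * ((d m)^-1 * (prim W (d m + x) - prim W x)
    + (- d m)^-1 * (prim W (- d m + x) - prim W x))) ^+ 2 = f m x.
  have x0' : 0 < x by rewrite lt_neqAle eq_sym x0.
  have xpi' : 0 < pi - x by rewrite subr_gt0 lt_neqAle xpi.
  have n1 : \forall m \near \oo, d m <= x.
    by apply: (cvgr_le _ cd).
  have n2 : \forall m \near \oo, d m <= pi - x.
    by apply: (cvgr_le _ cd).
  near=> m.
  have h1 : d m <= x by near: m.
  have h2 : d m <= pi - x by near: m.
  apply/esym; rewrite /f seg_in ?mul1r; last by apply/andP; split=> //; lra.
  congr (_ ^+ 2); rewrite [x + d m]addrC [x - d m]addrC.
  move: (prim W (d m + x)) (prim W (- d m + x)) (prim W x) => v1 v2 v3.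
  have := d0 m; move: (d m) => e e0.
  by field; rewrite gt_eqF.
apply: cvg_trans; first exact: (near_eq_cvg near_in).
have c1 : (d m)^-1 * (prim W (d m + x) - prim W x) +
    (- d m)^-1 * (prim W (- d m + x) - prim W x) @[m --> \oo] --> W x + W x.
  apply: cvgD; apply: cd0 => //.
  - by move=> m; rewrite gt_eqF.
  - by rewrite -oppr0; exact: cvgN.
  - by move=> m; rewrite oppr_eq0 gt_eqF.
have c2 : 2^-1 * ((d m)^-1 * (prim W (d m + x) - prim W x) +
    (- d m)^-1 * (prim W (- d m + x) - prim W x)) @[m --> \oo] --> W x.
  rewrite (_ : W x = 2^-1 * (W x + W x)); last by field.
  by apply: cvgM => //; exact: cvg_cst.
exact: (cvgM c2 c2).
Unshelve. all: by end_near. Qed.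

End Fourier.

Local Open Scope complex_scope.

(** * Complex-valued measurable functions and their componentwise integrals *)

Section Complex.
Variable R : realType.
Local Notation C := R[i].
Implicit Types (z w : C) (f g : R -> C).

Lemma reC_add z w : reC (z + w) = reC z + reC w. Proof. by case: z; case: w. Qed.
Lemma imC_add z w : imC (z + w) = imC z + imC w. Proof. by case: z; case: w. Qed.
Lemma reC_opp z : reC (- z) = - reC z. Proof. by case: z. Qed.
Lemma imC_opp z : imC (- z) = - imC z. Proof. by case: z. Qed.
Lemma reC_mul z w : reC (z * w) = reC z * reC w - imC z * imC w.
Proof. by case: z; case: w. Qed.
Lemma imC_mul z w : imC (z * w) = reC z * imC w + imC z * reC w.
Proof. by case: z; case: w. Qed.
Lemma reC_real (x : R) : reC x%:C = x. Proof. by []. Qed.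
Lemma imC_real (x : R) : imC x%:C = 0. Proof. by []. Qed.
Lemma reC0 : reC (0 : C) = 0. Proof. by []. Qed.
Lemma imC0 : imC (0 : C) = 0. Proof. by []. Qed.
Lemma reC_Zr (x : R) z : reC (x%:C * z) = x * reC z.
Proof. by rewrite reC_mul mul0r subr0. Qed.
Lemma imC_Zr (x : R) z : imC (x%:C * z) = x * imC z.
Proof. by rewrite imC_mul mul0r addr0. Qed.
Definition cE := (reC_add, imC_add, reC_opp, imC_opp, reC_Zr, imC_Zr, reC_mul, imC_mul,
  reC_real, imC_real, reC0, imC0).

Lemma complex_ext z w : reC z = reC w -> imC z = imC w -> z = w.
Proof. by case: z => a b; case: w => c d /= -> ->. Qed.

(* The l^1 norm of a complex number: submultiplicative, and trivially compatible
   with the componentwise integral. *)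
Definition n1 z : R := `|reC z| + `|imC z|.

Lemma n1_ge0 z : 0 <= n1 z. Proof. exact: addr_ge0. Qed.
Lemma n1_0 : n1 0 = 0. Proof. by rewrite /n1 !cE normr0 addr0. Qed.
Lemma n1D z w : n1 (z + w) <= n1 z + n1 w.
Proof. by rewrite /n1 !cE addrACA lerD// ler_normD. Qed.
Lemma n1N z : n1 (- z) = n1 z. Proof. by rewrite /n1 !cE !normrN. Qed.
Lemma n1B z w : n1 (z - w) <= n1 z + n1 w.
Proof. by rewrite -[n1 w]n1N n1D. Qed.
Lemma n1M z w : n1 (z * w) <= n1 z * n1 w.
Proof.
rewrite /n1 !reC_mul !imC_mul; apply: le_trans (lerD (ler_normB _ _) (ler_normD _ _)) _.
by rewrite !normrM; apply: ler_of_eq; ring.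
Qed.
Lemma n1_real (x : R) : n1 x%:C = `|x|.
Proof. by rewrite /n1 !cE normr0 addr0. Qed.
Lemma n1Zr (x : R) z : n1 (x%:C * z) = `|x| * n1 z.
Proof. by rewrite /n1 !cE !normrM mulrDr. Qed.
Lemma n1M_le z w (a b : R) : n1 z <= a -> n1 w <= b -> n1 (z * w) <= a * b.
Proof.
by move=> h1 h2; apply: le_trans (n1M _ _) _; apply: ler_pM => //; exact: n1_ge0.
Qed.
Lemma re_n1 z : `|reC z| <= n1 z. Proof. by rewrite lerDl. Qed.
Lemma im_n1 z : `|imC z| <= n1 z. Proof. by rewrite lerDr. Qed.

Section Meas.
Context d (T : measurableType d).
Implicit Types F G : T -> C.

Definition cmeas F : Prop :=
  measurable_fun setT (fun x : T => reC (F x)) /\ measurable_fun setT (fun x : T => imC (F x)).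

Lemma cmeas_real (k : T -> R) : measurable_fun setT k -> cmeas (fun x : T => (k x)%:C).
Proof. by move=> mk; split => //; exact: measurable_cst. Qed.

Lemma cmeas_cst z : cmeas (fun=> z).
Proof. by split; exact: measurable_cst. Qed.

Lemma cmeasD F G : cmeas F -> cmeas G -> cmeas (fun x : T => F x + G x).
Proof.
move=> [a1 b1] [a2 b2]; split.
  by under eq_fun do rewrite cE; exact: measurable_funD.
by under eq_fun do rewrite cE; exact: measurable_funD.
Qed.

Lemma cmeasM F G : cmeas F -> cmeas G -> cmeas (fun x : T => F x * G x).
Proof.
move=> [a1 b1] [a2 b2]; split.
  under eq_fun do rewrite reC_mul; apply: measurable_funB; exact: measurable_funM.
by under eq_fun do rewrite imC_mul; apply: measurable_funD; exact: measurable_funM.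
Qed.

Lemma cmeasN F : cmeas F -> cmeas (fun x : T => - F x).
Proof.
move=> [a1 b1]; split.
  by under eq_fun do rewrite cE; exact: measurable_funN.
by under eq_fun do rewrite cE; exact: measurable_funN.
Qed.

Lemma cmeasB F G : cmeas F -> cmeas G -> cmeas (fun x : T => F x - G x).
Proof. by move=> mF mG; apply: cmeasD => //; exact: cmeasN. Qed.

Lemma meas_n1 F : cmeas F -> measurable_fun setT (fun x : T => n1 (F x)).
Proof. by move=> [a b]; apply: measurable_funD; exact: measurableT_comp. Qed.

Lemma cmeas_cvg (F_ : nat -> T -> C) F : (forall n, cmeas (F_ n)) ->
  (forall x : T, (fun n => reC (F_ n x)) @ \oo --> reC (F x)) ->
  (forall x : T, (fun n => imC (F_ n x)) @ \oo --> imC (F x)) -> cmeas F.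
Proof.
move=> mF h1 h2; split.
  by apply: (measurable_fun_cvg (h := fun n x => reC (F_ n x))) => // n; case: (mF n).
by apply: (measurable_fun_cvg (h := fun n x => imC (F_ n x))) => // n; case: (mF n).
Qed.

End Meas.

Lemma cmeas_comp d1 d2 (T1 : measurableType d1) (T2 : measurableType d2)
    (F : T2 -> C) (k : T1 -> T2) :
  cmeas F -> measurable_fun setT k -> cmeas (fun x : T1 => F (k x)).
Proof.
move=> [a b] mk; split.
  exact: (measurableT_comp a mk).
exact: (measurableT_comp b mk).
Qed.

Definition cinteg f : Prop := integ (fun x => reC (f x)) /\ integ (fun x => imC (f x)).
Definition cI f : C := Complex (RI (fun x => reC (f x))) (RI (fun x => imC (f x))).

Lemma eq_cI f g : f =1 g -> cI f = cI g.
Proof. by move=> /funext ->. Qed.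

Lemma cinteg_eq f g : f =1 g -> cinteg f -> cinteg g.
Proof. by move=> /funext ->. Qed.

Lemma cinteg_meas f : cinteg f -> cmeas f.
Proof. by move=> [/integ_meas ? /integ_meas ?]. Qed.

Lemma cinteg_n1 f : cinteg f -> integ (fun x => n1 (f x)).
Proof. by move=> [h1 h2]; apply: integD; exact: integ_norm. Qed.

Lemma cinteg_le f (g : R -> R) : cmeas f -> integ g -> (forall x, n1 (f x) <= g x) ->
  cinteg f.
Proof.
move=> [m1 m2] ig fg; split; apply: (integ_le _ ig) => // x;
  by rewrite (le_trans _ (fg x))// ?re_n1 ?im_n1.
Qed.

Lemma cinteg_real (g : R -> R) : integ g -> cinteg (fun x => (g x)%:C).
Proof. by move=> ig; split => //; exact: integ0. Qed.

Lemma cI_real (g : R -> R) : cI (fun x => (g x)%:C) = (RI g)%:C.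
Proof. by apply: complex_ext => //=; rewrite ?RI0. Qed.

Lemma cintegD f g : cinteg f -> cinteg g -> cinteg (fun x => f x + g x).
Proof.
move=> [a b] [c e]; split.
  by under [X in integ X]eq_fun do rewrite cE; exact: integD.
by under [X in integ X]eq_fun do rewrite cE; exact: integD.
Qed.

Lemma cintegN f : cinteg f -> cinteg (fun x => - f x).
Proof.
move=> [a b]; split.
  by under [X in integ X]eq_fun do rewrite cE; exact: integN.
by under [X in integ X]eq_fun do rewrite cE; exact: integN.
Qed.

Lemma cintegB f g : cinteg f -> cinteg g -> cinteg (fun x => f x - g x).
Proof. by move=> i1 /cintegN; exact: cintegD. Qed.

Lemma cintegMb f g M : cinteg f -> cmeas g -> (forall x, n1 (g x) <= M) ->
  cinteg (fun x => f x * g x).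
Proof.
move=> i1 mg gM; apply: (cinteg_le (g := fun x => M * n1 (f x))).
- by apply: cmeasM => //; exact: cinteg_meas.
- by apply: integZ; exact: cinteg_n1.
- by move=> x; rewrite mulrC; exact: n1M_le.
Qed.

Lemma cintegZ z f : cinteg f -> cinteg (fun x => z * f x).
Proof.
move=> i1; apply: (cinteg_eq (f := fun x => f x * z)) => [x|]; first by rewrite mulrC.
by apply: (cintegMb (M := n1 z)) => //; exact: cmeas_cst.
Qed.

Lemma cinteg_seg (a b : R) f : cinteg f -> cinteg (fun x => (seg a b x)%:C * f x).
Proof.
move=> [h1 h2]; split.
  by under [X in integ X]eq_fun do rewrite cE; exact: integ_segM.
by under [X in integ X]eq_fun do rewrite cE; exact: integ_segM.
Qed.

Lemma cinteg_segB (a b : R) f M : cmeas f -> (forall x, n1 (f x) <= M) ->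
  cinteg (fun x => (seg a b x)%:C * f x).
Proof.
move=> mf fM; apply: (cintegMb (M := M)) => //; apply: cinteg_real; exact: integ_seg.
Qed.

Lemma cI0 : cI (fun=> 0) = 0.
Proof. by apply: complex_ext => /=; rewrite !RI0. Qed.

Lemma cID f g : cinteg f -> cinteg g -> cI (fun x => f x + g x) = cI f + cI g.
Proof.
move=> [a b] [c e]; apply: complex_ext; rewrite !cE /= -RID//; apply: eq_RI => x; by rewrite cE.
Qed.

Lemma cIN f : cinteg f -> cI (fun x => - f x) = - cI f.
Proof.
move=> [a b]; apply: complex_ext; rewrite !cE /= -RIN//; apply: eq_RI => x; by rewrite cE.
Qed.

Lemma cIB f g : cinteg f -> cinteg g -> cI (fun x => f x - g x) = cI f - cI g.
Proof. by move=> i1 i2; rewrite cID// ?cIN//; exact: cintegN. Qed.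

Lemma cIZ z f : cinteg f -> cI (fun x => z * f x) = z * cI f.
Proof.
move=> [a b]; apply: complex_ext.
  rewrite reC_mul /= -!RIZ// -RIB; [|exact: integZ|exact: integZ].
  by apply: eq_RI => x; rewrite reC_mul.
rewrite imC_mul /= -!RIZ// -RID; [|exact: integZ|exact: integZ].
by apply: eq_RI => x; rewrite imC_mul.
Qed.

Lemma cIZr z f : cinteg f -> cI (fun x => f x * z) = cI f * z.
Proof. by move=> i1; rewrite mulrC -cIZ//; apply: eq_cI => x; rewrite mulrC. Qed.

Lemma n1_cI f : cinteg f -> n1 (cI f) <= RI (fun x => n1 (f x)).
Proof.
move=> [a b]; rewrite /n1 RID; [|exact: integ_norm|exact: integ_norm].
by apply: lerD; apply: RI_abs.
Qed.

Lemma n1_cI_le f (g : R -> R) : cinteg f -> integ g -> (forall x, n1 (f x) <= g x) ->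
  n1 (cI f) <= RI g.
Proof.
move=> i1 ig fg; apply: le_trans (n1_cI i1) _; apply: RI_le => //; exact: cinteg_n1.
Qed.

Lemma cmeas_cI d (T : measurableType d) (F : T * R -> C) : cmeas F ->
  cmeas (fun x : T => cI (fun y => F (x, y))).
Proof.
move=> [a b]; split => /=.
  exact: (meas_RI (F := fun z : T * R => reC (F z))).
exact: (meas_RI (F := fun z : T * R => imC (F z))).
Qed.

Lemma cI_swap (F : R * R -> C) (g h : R -> R) : cmeas F ->
  (forall x y, n1 (F (x, y)) <= g x * h y) -> integ g -> integ h ->
  cI (fun x => cI (fun y => F (x, y))) = cI (fun y => cI (fun x => F (x, y))).
Proof.
move=> [a b] Fgh ig ih; apply: complex_ext => /=.
  apply: (RI_swap (F := fun z : R * R => reC (F z)) (g := g) (h := h)) => // x y.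
  exact: le_trans (re_n1 _) (Fgh x y).
apply: (RI_swap (F := fun z : R * R => imC (F z)) (g := g) (h := h)) => // x y.
exact: le_trans (im_n1 _) (Fgh x y).
Qed.

Lemma cinteg_section (F : R * R -> C) (g h : R -> R) x : cmeas F ->
  (forall x y, n1 (F (x, y)) <= g x * h y) -> integ h ->
  cinteg (fun y => F (x, y)).
Proof.
move=> mF Fgh ih; apply: (cinteg_le (g := fun y => g x * h y)) => //; last exact: integZ.
by apply: cmeas_comp => //.
Qed.

Lemma cinteg_cI (F : R * R -> C) (g h : R -> R) : cmeas F ->
  (forall x y, n1 (F (x, y)) <= g x * h y) -> integ g -> integ h ->
  cinteg (fun x => cI (fun y => F (x, y))).
Proof.
move=> mF Fgh ig ih; apply: (cinteg_le (g := fun x => RI h * g x)).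
- exact: cmeas_cI.
- exact: integZ.
- move=> x; rewrite mulrC -RIZ//; apply: n1_cI_le => //.
  + exact: cinteg_section Fgh ih.
  + exact: integZ.
Qed.

Lemma cI_trans f (a : R) : cinteg f -> cinteg (fun x => f (x + a)) /\
  cI (fun x => f (x + a)) = cI f.
Proof.
move=> [/(@integ_trans _ _ a)[h1 e1] /(@integ_trans _ _ a)[h2 e2]]; split; first by split.
by rewrite /cI e1 e2.
Qed.

Lemma cI_refl f : cinteg f -> cinteg (fun x => f (- x)) /\
  cI (fun x => f (- x)) = cI f.
Proof.
move=> [/integ_refl[h1 e1] /integ_refl[h2 e2]]; split; first by split.
by rewrite /cI e1 e2.
Qed.

Lemma cI_flip f (a : R) : cinteg f -> cinteg (fun x => f (a - x)) /\
  cI (fun x => f (a - x)) = cI f.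
Proof.
move=> [/(@integ_flip _ _ a)[h1 e1] /(@integ_flip _ _ a)[h2 e2]]; split; first by split.
by rewrite /cI e1 e2.
Qed.

Lemma cintE (a b : R) f : cint a b f = cI (fun x => (seg a b x)%:C * f x).
Proof.
by rewrite /cint /cI; congr Complex; rewrite RI_seg; apply: eq_RI => x; rewrite cE.
Qed.

Lemma RI_split (a b c : R) (f : R -> R) : a <= b <= c -> integ (fun x => seg a c x * f x) ->
  RI (fun x => seg a c x * f x) = RI (fun x => seg a b x * f x) + RI (fun x => seg b c x * f x).
Proof.
move=> /andP[ab bc] /integ_segP i1; rewrite -!RI_seg.
have := @Rintegral_itvB R f (BLeft a) (BRight c) b i1.
rewrite !bnd_simp => /(_ ab bc); rewrite Rintegral_itv_obnd_cbnd => [<-|]; first by rewrite addrC subrK.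
apply: integrableS i1 => // x /=; rewrite !in_itv/= => /andP[h1 ->]; rewrite andbT.
by apply: le_trans (ltW h1).
Qed.

Lemma cI_split (a b c : R) f : a <= b <= c -> cinteg (fun x => (seg a c x)%:C * f x) ->
  cI (fun x => (seg a c x)%:C * f x) =
  cI (fun x => (seg a b x)%:C * f x) + cI (fun x => (seg b c x)%:C * f x).
Proof.
move=> abc [].
under [X in integ X]eq_fun do rewrite cE; move=> i1.
under [X in integ X]eq_fun do rewrite cE; move=> i2.
rewrite -!cintE /cint; apply: complex_ext; rewrite cE /= !RI_seg; exact: RI_split.
Qed.

End Complex.

(** * Measurability of expressions in several variables *)

Section MeasTools.
Context d d1 d2 (T : measurableType d) (T1 : measurableType d1) (T2 : measurableType d2).

Lemma meas_pi1 (f : T -> T1 * T2) : measurable_fun setT f ->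
  measurable_fun setT (fun z : T => (f z).1).
Proof. by move=> mf; exact: (measurableT_comp measurable_fst mf). Qed.

Lemma meas_pi2 (f : T -> T1 * T2) : measurable_fun setT f ->
  measurable_fun setT (fun z : T => (f z).2).
Proof. by move=> mf; exact: (measurableT_comp measurable_snd mf). Qed.

End MeasTools.

Ltac meas_solve := repeat first
  [ assumption
  | exact: measurable_id | exact: measurable_cst
  | exact: measurable_fst | exact: measurable_snd
  | apply: meas_seg | apply: meas_pi1 | apply: meas_pi2
  | apply: measurable_fun_pair
  | apply: measurable_funD | apply: measurable_funB | apply: measurable_funM
  | apply: measurable_funN ].

(** * Absolutely continuous functions, the product rule and the Wronskian *)

Section AbsCont.
Variable R : realType.
Local Notation C := R[i].
Implicit Types (f g F G : R -> C) (x y t s : R).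

(** [F] is absolutely continuous on [0, pi] with density [f]. For a square integrable potential the
    second derivative of a solution exists only in this sense. *)
Definition acont F f : Prop := cinteg (fun t => (seg 0 pi t)%:C * f t) /\
  forall x, 0 <= x <= pi -> F x = F 0 + cI (fun t => (seg 0 x t)%:C * f t).

Lemma seg_sub a b c d t : a <= c -> d <= b -> seg c d t * seg a b t = seg c d t :> R.
Proof.
move=> ac db; have [/andP[h1 h2]|h] := boolP (c <= t <= d); last by rewrite (seg_out h) mul0r.
by rewrite [seg a b t]seg_in ?mulr1// (le_trans ac h1) (le_trans h2 db).
Qed.

Lemma seg_pi x t : 0 <= x <= pi -> seg 0 x t * seg 0 pi t = seg 0 x t :> R.
Proof. by move=> /andP[x0 xpi]; rewrite seg_sub. Qed.

Lemma segC_pi x t (z : C) : 0 <= x <= pi ->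
  (seg 0 x t)%:C * ((seg 0 pi t)%:C * z) = (seg 0 x t)%:C * z.
Proof. by move=> xp; rewrite mulrA -rmorphM/= seg_pi. Qed.

Lemma cinteg_seg0 f x : 0 <= x <= pi -> cinteg (fun t => (seg 0 pi t)%:C * f t) ->
  cinteg (fun t => (seg 0 x t)%:C * f t).
Proof.
by move=> xp /(cinteg_seg 0 x); apply: cinteg_eq => t; rewrite segC_pi.
Qed.

Lemma acont_cmeas F f : acont F f -> cmeas (fun x => (seg 0 pi x)%:C * F x).
Proof.
move=> [i1 h].
rewrite (_ : (fun x => _) = fun x => (seg 0 pi x)%:C *
   (F 0 + cI (fun t => (seg 0 x t)%:C * ((seg 0 pi t)%:C * f t)))).
  apply: cmeasM.
    by apply: cmeas_real; meas_solve.
  apply: cmeasD; first exact: cmeas_cst.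
  apply: (cmeas_cI (F := fun z : R * R => (seg 0 z.1 z.2)%:C * ((seg 0 pi z.2)%:C * f z.2))).
  apply: cmeasM.
    by apply: cmeas_real; meas_solve.
  by apply: (cmeas_comp (F := fun t => (seg 0 pi t)%:C * f t)) => //; exact: cinteg_meas.
apply/funext => x; have [xp|xp] := boolP (0 <= x <= pi); last by rewrite (seg_out xp) !mul0r.
rewrite h//; congr (_ * (_ + _)); apply: eq_cI => t.
by rewrite segC_pi.
Qed.

Lemma acont_bounded F f : acont F f -> exists M, forall x, 0 <= x <= pi -> n1 (F x) <= M.
Proof.
move=> [i1 h]; exists (n1 (F 0) + RI (fun t => n1 ((seg 0 pi t)%:C * f t))) => x xp.
rewrite h//; apply: le_trans (n1D _ _) _; rewrite lerD2l.
apply: n1_cI_le; [exact: cinteg_seg0|exact: cinteg_n1|move=> t].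
rewrite -(segC_pi t (f t) xp) n1Zr -[leRHS]mul1r ler_wpM2r ?n1_ge0//; exact: seg_abs.
Qed.

Lemma acont_mul_integ F f g : acont F f -> cinteg (fun t => (seg 0 pi t)%:C * g t) ->
  cinteg (fun t => (seg 0 pi t)%:C * (F t * g t)).
Proof.
move=> aF ig; have [M hM] := acont_bounded aF.
have M0 : 0 <= M by apply: le_trans (n1_ge0 _) (hM 0 _); rewrite lexx pi_ge0.
apply: (cinteg_eq (f := fun t => ((seg 0 pi t)%:C * g t) * ((seg 0 pi t)%:C * F t))).
  by move=> t; rewrite mulrACA -rmorphM/= seg_sub// [g t * _]mulrC.
apply: (cintegMb (M := M)) => //; first exact: acont_cmeas aF.
move=> t; have [tp|tp] := boolP (0 <= t <= pi); last by rewrite (seg_out tp) mul0r n1_0.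
by rewrite (seg_in tp) mul1r hM.
Qed.

Lemma expand_sum (p q u v X Y : C) : u * v = X + Y ->
  (p + u) * (q + v) = p * q + (q * u + X + (p * v + Y)).
Proof. by move=> e; rewrite mulrDl !mulrDr e; ring. Qed.

(** The product of the two primitives is an integral over the square [0, x]^2. The diagonal cuts the
    square into two triangles, and by Fubini each is one of the two terms of the product rule. *)
Lemma acont_mul F f G g : acont F f -> acont G g ->
  acont (fun x => F x * G x) (fun x => f x * G x + F x * g x).
Proof.
move=> aF aG; have [iF hF] := aF; have [iG hG] := aG.
have ifG : cinteg (fun t => (seg 0 pi t)%:C * (f t * G t)).
  by apply: cinteg_eq (acont_mul_integ aG iF) => t; rewrite [f t * _]mulrC.
have iFg := acont_mul_integ aF iG.
split; first by apply: cinteg_eq (cintegD ifG iFg) => t; rewrite mulrDr.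
move=> x xp; have /andP[x0 xpi] := xp.
set fp := fun t => (seg 0 pi t)%:C * f t in iF *.
set gp := fun t => (seg 0 pi t)%:C * g t in iG *.
(* Inserting the integral representation of [H] in the integral of [l * H] leaves a boundary term
   and an integral over one triangle. It is used for both orders of the factors. *)
have E (H k kp : R -> C) (l : R -> C) : (kp = fun t => (seg 0 pi t)%:C * k t) ->
    cinteg kp -> cinteg (fun t => (seg 0 pi t)%:C * l t) ->
    (forall x, 0 <= x <= pi -> H x = H 0 + cI (fun t => (seg 0 x t)%:C * k t)) ->
    cinteg (fun t => (seg 0 pi t)%:C * (l t * H t)) ->
    cI (fun t => (seg 0 x t)%:C * (l t * H t)) =
    H 0 * cI (fun t => (seg 0 x t)%:C * l t) +
    cI (fun t => cI (fun s => (seg 0 x t)%:C * ((seg 0 t s)%:C * (((seg 0 pi t)%:C * l t) * kp s)))).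
  move=> kpE ikp il hH ilH; rewrite -cIZ; last exact: cinteg_seg0.
  have mF : cmeas (fun z : R * R => (seg 0 x z.1)%:C * ((seg 0 z.1 z.2)%:C * (((seg 0 pi z.1)%:C * l z.1) * kp z.2))).
    apply: cmeasM.
      by apply: cmeas_real; meas_solve.
    apply: cmeasM.
      by apply: cmeas_real; meas_solve.
    apply: cmeasM.
      by apply: (cmeas_comp (F := fun t => (seg 0 pi t)%:C * l t)) => //; exact: cinteg_meas.
    by apply: (cmeas_comp (F := kp)) => //; exact: cinteg_meas.
  rewrite -cID; last 2 first.
  - by apply: cintegZ; exact: cinteg_seg0.
  - apply: (cinteg_cI (g := fun t => n1 ((seg 0 pi t)%:C * l t)) (h := fun s => n1 (kp s)) mF) => [t s /=||]; try exact: cinteg_n1.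
    rewrite n1Zr n1Zr mulrA; apply: le_trans (n1M _ _).
    by rewrite ler_piMl ?n1_ge0// mulr_ile1// seg_abs.
  apply: eq_cI => t; have [tx|tx] := boolP (0 <= t <= x); last first.
    rewrite (seg_out tx) !mul0r mulr0 add0r; rewrite -[LHS]cI0; apply: eq_cI => s.
    by rewrite mul0r.
  have tp : 0 <= t <= pi by have /andP[-> h] := tx; exact: le_trans h xpi.
  rewrite (seg_in tx) (seg_in tp) !mul1r hH// mulrDr [l t * H 0]mulrC; congr (_ + _).
  rewrite -cIZ; last exact: cinteg_seg0 tp (cinteg_eq (fun s => f_equal (fun h => h s) kpE) ikp).
  by apply: eq_cI => s; rewrite rmorph1 mul1r kpE [RHS]mulrCA segC_pi.
have e1 := E G g gp f erefl iG iF hG ifG.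
have iGf : cinteg (fun t => (seg 0 pi t)%:C * (g t * F t)).
  by apply: cinteg_eq iFg => t; rewrite [F t * _]mulrC.
have e2 := E F f fp g erefl iF iG hF iGf.
under [in RHS]eq_cI do rewrite mulrDr.
rewrite cID; [|exact: cinteg_seg0 xp ifG|exact: cinteg_seg0 xp iFg].
rewrite e1 (@eq_cI _ (fun t => (seg 0 x t)%:C * (F t * g t))
  (fun t => (seg 0 x t)%:C * (g t * F t))); last by move=> t; rewrite [F t * _]mulrC.
rewrite e2 (hF x xp) (hG x xp).
set a := cI (fun t => (seg 0 x t)%:C * f t); set b := cI (fun t => (seg 0 x t)%:C * g t).
have mfp := cinteg_meas iF; have mgp := cinteg_meas iG.
have mK (k l : R -> C) : cmeas k -> cmeas l -> cmeas (fun z : R * R =>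
    (seg 0 x z.1)%:C * ((seg 0 z.1 z.2)%:C * (k z.1 * l z.2))).
  move=> mk ml; apply: cmeasM.
    by apply: cmeas_real; meas_solve.
  apply: cmeasM.
    by apply: cmeas_real; meas_solve.
  by apply: cmeasM; [exact: (cmeas_comp (F := k))|exact: (cmeas_comp (F := l))].
have bK (k l : R -> C) t s :
    n1 ((seg 0 x t)%:C * ((seg 0 t s)%:C * (k t * l s))) <= n1 (k t) * n1 (l s).
  rewrite n1Zr n1Zr mulrA; apply: le_trans (n1M _ _).
  by rewrite ler_piMl ?n1_ge0// mulr_ile1// seg_abs.
have sw := cI_swap (mK _ _ mgp mfp) (bK gp fp) (cinteg_n1 iG) (cinteg_n1 iF).
rewrite [X in _ = _ + (_ + (_ + X))]sw /=.
(* For fixed [t] the segment [[0, x]] is split at [t]; the two pieces are the two triangles. *)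
have ab : a * b = cI (fun t => cI (fun s => (seg 0 x t)%:C * ((seg 0 t s)%:C * (fp t * gp s)))) +
    cI (fun y => cI (fun x0 => (seg 0 x x0)%:C * ((seg 0 x0 y)%:C * (gp x0 * fp y)))).
  have nfp := cinteg_n1 iF; have ngp := cinteg_n1 iG.
  have mK' : cmeas (fun z : R * R => (seg 0 x z.2)%:C * ((seg 0 z.2 z.1)%:C * (gp z.2 * fp z.1))).
    apply: (cmeas_comp (F := fun z : R * R => (seg 0 x z.1)%:C * ((seg 0 z.1 z.2)%:C * (gp z.1 * fp z.2))) (k := fun z : R * R => (z.2, z.1))).
      exact: mK.
    by meas_solve.
  have bK' t s : n1 ((seg 0 x s)%:C * ((seg 0 s t)%:C * (gp s * fp t))) <= n1 (fp t) * n1 (gp s).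
    by rewrite [leRHS]mulrC; exact: bK.
  rewrite -cID; last 2 first.
  - exact: (cinteg_cI (mK _ _ mfp mgp) (bK fp gp)).
  - exact: (cinteg_cI mK' bK').
  have igx : cinteg (fun s => (seg 0 x s)%:C * gp s) by exact: cinteg_seg.
  rewrite -cIZr; last exact: cinteg_seg0.
  apply: eq_cI => t.
  have ebx : b = cI (fun s => (seg 0 x s)%:C * gp s).
    by apply: eq_cI => s; rewrite segC_pi.
  have [tx|tx] := boolP (0 <= t <= x); last first.
    rewrite (seg_out tx) !mul0r (_ : cI _ = 0); last first.
      by rewrite -[RHS]cI0; apply: eq_cI => s; rewrite mul0r.
    rewrite add0r -[LHS]cI0; apply: eq_cI => s.
    have e0 : seg 0 x s * seg 0 s t = 0.
      have [/andP[s0 sx]|h] := boolP (0 <= s <= x); last by rewrite (seg_out h) mul0r.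
      have h : ~~ (0 <= t <= s).
        by apply/negP => /andP[t0 ts]; move/negP: tx; apply; rewrite t0 (le_trans ts).
      by rewrite (seg_out h) mulr0.
    by rewrite mulrA -rmorphM/= e0 rmorph0 mul0r.
  have /andP[t0 txx] := tx.
  have tp : 0 <= t <= pi by rewrite t0 (le_trans txx).
  rewrite (seg_in tx) rmorph1 mul1r -[f t]mul1r -(rmorph1 (real_complex R)) -{1}(seg_in tp) -/(fp t).
  rewrite ebx (cI_split tx igx) mulrDr -!cIZ; [|exact: cinteg_seg|exact: cinteg_seg].
  congr (_ + _); apply: eq_cI => s; first by rewrite rmorph1 mul1r mulrCA.
  have e0 : seg 0 x s * seg 0 s t = seg t x s.
    rewrite /seg -natrM mulnb t0 /=; congr (_%:R); congr nat_of_bool.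
    case: (leP t s) => ts /=; last by rewrite andbF.
    by rewrite (le_trans t0 ts) andbT.
  by rewrite [RHS]mulrA -rmorphM/= e0 [gp s * _]mulrC [RHS]mulrCA.
exact: expand_sum ab.
Qed.

Lemma acont_eq F f G g : (forall x, 0 <= x <= pi -> F x = G x) ->
  (forall x, 0 <= x <= pi -> f x = g x) -> acont F f -> acont G g.
Proof.
move=> FG fg [i1 h].
have e x t : 0 <= x <= pi -> (seg 0 x t)%:C * f t = (seg 0 x t)%:C * g t.
  move=> /andP[x0 xpi].
  have [/andP[t0 tx]|h1] := boolP (0 <= t <= x); last by rewrite (seg_out h1) !mul0r.
  by rewrite fg// t0 (le_trans tx).
split; first by apply: cinteg_eq i1 => t; apply: e; rewrite pi_ge0 lexx.
move=> x xp; rewrite -(FG x xp) -FG ?lexx ?pi_ge0// (h x xp).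
by congr (_ + _); apply: eq_cI => t; exact: e.
Qed.

Lemma acontD F f G g : acont F f -> acont G g -> acont (fun x => F x + G x) (fun x => f x + g x).
Proof.
move=> [i1 h1] [i2 h2]; split; first by apply: cinteg_eq (cintegD i1 i2) => t; rewrite mulrDr.
move=> x xp; rewrite h1// h2// addrACA -cID; [|exact: cinteg_seg0|exact: cinteg_seg0].
by congr (_ + _); apply: eq_cI => t; rewrite mulrDr.
Qed.

Lemma acontZ (c : C) F f : acont F f -> acont (fun x => c * F x) (fun x => c * f x).
Proof.
move=> [i1 h1]; split; first by apply: cinteg_eq (cintegZ c i1) => t; rewrite mulrCA.
move=> x xp; rewrite h1// mulrDr -cIZ; last exact: cinteg_seg0.
by congr (_ + _); apply: eq_cI => t; rewrite mulrCA.
Qed.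

Lemma acontB F f G g : acont F f -> acont G g -> acont (fun x => F x - G x) (fun x => f x - g x).
Proof.
move=> aF /(acontZ (-1)) aG; apply: acont_eq (acontD aF aG) => x _; ring.
Qed.

Lemma cI_seg00 f : cI (fun t => (seg 0 0 t)%:C * f t) = 0.
Proof. by rewrite -cintE /cint set_itv1 !Rintegral_set1. Qed.

Lemma acont_prim f : cinteg (fun t => (seg 0 pi t)%:C * f t) ->
  acont (fun x => cI (fun t => (seg 0 x t)%:C * f t)) f.
Proof. by move=> i1; split=> // x xp; rewrite cI_seg00 add0r. Qed.

Lemma acont_real (F f : R -> R) : continuous f -> (forall x, is_derive x 1 F (f x)) ->
  acont (fun x => (F x)%:C) (fun x => (f x)%:C).
Proof.
move=> cf dF; split.
  apply: (cinteg_eq (f := fun x => (seg 0 pi x * f x)%:C)) => [x|]; first by rewrite rmorphM.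
  by apply: cinteg_real; apply: integ_cont; exact: continuous_subspaceT.
move=> x /andP[x0 _]; rewrite (eq_cI (g := fun t => (seg 0 x t * f t)%:C)); last first.
  by move=> t; rewrite rmorphM.
by rewrite cI_real (RI_FTC x0 cf dF) -rmorphD/= addrC subrK.
Qed.

Lemma acont_cos (c : R) : acont (fun x => (cos (c * x))%:C) (fun x => (- (c * sin (c * x)))%:C).
Proof.
apply: acont_real; last by move=> x; exact: is_derive_cosM.
move=> x; apply: cvgN; apply: cvgM; first exact: cvg_cst.
exact: continuousM_arg (@continuous_sin R) _.
Qed.

Lemma acont_sin (c : R) : acont (fun x => (sin (c * x))%:C) (fun x => (c * cos (c * x))%:C).
Proof.
apply: acont_real; last by move=> x; exact: is_derive_sinM.
move=> x; apply: cvgM; first exact: cvg_cst.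
exact: continuousM_arg (@continuous_cos R) _.
Qed.

Lemma acont_const F f : acont F f -> (forall x, 0 <= x <= pi -> f x = 0) ->
  forall x, 0 <= x <= pi -> F x = F 0.
Proof.
move=> aF f0 x xp.
have [_ h] := acont_eq (fun _ _ => erefl) f0 aF.
rewrite (h x xp) (eq_cI (g := fun=> 0)) ?cI0 ?addr0// => t; by rewrite mulr0.
Qed.

Lemma acont_continuous F f : acont F f ->
  {within `[0, pi]%classic, continuous (fun t => reC (F t))} /\
  {within `[0, pi]%classic, continuous (fun t => imC (F t))}.
Proof.
move=> [[i1 i2] h].
have key (k : C -> R) : (forall x, 0 <= x <= pi -> k (F x) = k (F 0) +
      Rintegral (@lebesgue_measure R) `[0, x]%classic (fun t => k (f t))) ->
    integ (fun t => seg 0 pi t * k (f t)) ->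
    {within `[0, pi]%classic, continuous (fun t => k (F t))}.
  move=> hk /integ_segP ik.
  have c1 := parameterized_integral_continuous (pi_ge0 R) ik.
  apply: (@subspace_eq_continuous _ _ _ (fun x => k (F 0) +
     Rintegral (@lebesgue_measure R) `[0, x]%classic (fun t => k (f t)))).
    by move=> x; rewrite mem_setE in_itv/= => xp; exact/esym/hk.
  move=> x; apply: cvgD; [exact: cvg_cst|exact: c1].
split.
  refine (key (@reC R) _ _) => [x xp|].
    rewrite h// reC_add RI_seg; congr (_ + _); apply: eq_RI => t; exact: reC_Zr.
  by apply: integ_eq i1 => t; rewrite cE.
refine (key (@imC R) _ _) => [x xp|].
  rewrite h// imC_add RI_seg; congr (_ + _); apply: eq_RI => t; exact: imC_Zr.
by apply: integ_eq i2 => t; rewrite cE.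
Qed.

(** Unlike [is_solution], this records integrability of the densities, which the product rule
    requires; the continuity demanded by [is_solution] follows from it. *)
Definition solves (q : R -> C) (rho : C) (y yd : R -> C) : Prop :=
  acont y yd /\ acont yd (fun t => (q t - rho ^+ 2) * y t).

Lemma solves_is_solution q rho (y yd : R -> C) : solves q rho y yd -> is_solution q rho y yd.
Proof.
move=> [a1 a2]; have [c1 c2] := acont_continuous a1; have [c3 c4] := acont_continuous a2.
do 4 (split; first by []).
move=> x xp; case: a1 => _ h1; case: a2 => _ h2.
by rewrite !cintE; split; [exact: h1|exact: h2].
Qed.

(** Lagrange's identity: the products of first derivatives and the [rho ^+ 2] terms cancel. With
    equal potentials it makes the Wronskian constant, with different ones it produces the integral
    to be estimated. *)
Lemma wronskian (q1 q2 : R -> C) rho (y1 yd1 y2 yd2 : R -> C) : solves q1 rho y1 yd1 -> solves q2 rho y2 yd2 ->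
  acont (fun x => yd1 x * y2 x - y1 x * yd2 x) (fun x => (q1 x - q2 x) * (y1 x * y2 x)).
Proof.
move=> [a1 b1] [a2 b2]; have := acontB (acont_mul b1 a2) (acont_mul a1 b2).
by apply: acont_eq => x _; ring.
Qed.

Lemma solves_comb q rho (y1 yd1 y2 yd2 : R -> C) (a b : C) :
  solves q rho y1 yd1 -> solves q rho y2 yd2 ->
  solves q rho (fun x => a * y1 x + b * y2 x) (fun x => a * yd1 x + b * yd2 x).
Proof.
move=> [a1 b1] [a2 b2]; split; first exact: acontD (acontZ a a1) (acontZ b a2).
by apply: acont_eq (acontD (acontZ a b1) (acontZ b b2)) => x _ //; ring.
Qed.

End AbsCont.

(** * Exponential weights *)

Section Weight.
Variable R : realType.
Implicit Types (x y t s u c : R).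

Lemma RI_expM c a b : c != 0 -> a <= b ->
  RI (fun t => seg a b t * expR (c * t)) = (expR (c * b) - expR (c * a)) / c.
Proof.
move=> c0 ab.
have cc := continuousM_arg (c := c) (@continuous_expR R).
have dd t : is_derive t 1 (fun t : R => c^-1 * expR (c * t)) (expR (c * t)).
  have h : is_derive t 1 (fun t : R => expR (c * t)) (c * expR (c * t)).
    by apply: is_derive_eq; rewrite /GRing.scale/=; ring.
  by apply: is_derive_eq; rewrite /GRing.scale/=; field.
by rewrite (RI_FTC ab cc dd) mulrC [c^-1 * expR (c * a)]mulrC -mulrBl.
Qed.

Lemma RI_exp c x : 0 < c -> 0 <= x ->
  RI (fun t => seg 0 x t * expR (c * t)) <= expR (c * x) / c.
Proof.
move=> c0 x0; rewrite RI_expM ?gt_eqF// mulr0 expR0 ler_wpM2r ?invr_ge0 ?(ltW c0)//.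
by rewrite gerBl.
Qed.

(** By Cauchy-Schwarz the integral is at most the norm of [f] times (e^(2 lam x) / (2 lam))^(1/2),
    so a large [lam] gains any factor. The factor pi will pay for the length of the inner range of
    integration in the kernel equation. *)
Lemma weight_half (f : R -> R) (lam x : R) : sqint f -> (forall t, 0 <= f t) ->
  0 < lam -> 4 * pi ^+ 2 * RI (fun t => f t ^+ 2) <= 2 * lam -> 0 <= x ->
  integ (fun t => seg 0 x t * (f t * expR (lam * t))) /\
  pi * RI (fun t => seg 0 x t * (f t * expR (lam * t))) <= 2^-1 * expR (lam * x).
Proof.
move=> sf f0 l0 hl x0; pose g t := seg 0 x t * expR (lam * t).
have g2 t : g t ^+ 2 = seg 0 x t * expR (2 * lam * t).
  by rewrite /g exprMn expr2 seg_idem -expRM_natl; congr (_ * expR _); ring.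
have sg : sqint g.
  split; first by apply: measurable_funM; [exact: meas_seg1|exact: meas_expM].
  rewrite (_ : (fun t => _) = fun t => seg 0 x t * expR (2 * lam * t)); last exact/funext.
  by apply/integ_cont/continuous_subspaceT/continuousM_arg; exact: continuous_expR.
have e t : seg 0 x t * (f t * expR (lam * t)) = f t * g t by rewrite /g mulrCA.
split; first by rewrite (_ : (fun t => _) = fun t => f t * g t); [exact: sqint_mul|exact/funext].
rewrite (eq_RI e).
have P0 := pi_gt0 R.
have fg0 : 0 <= RI (fun t => f t * g t).
  by apply: RI_ge0 => t; rewrite mulr_ge0// /g mulr_ge0 ?expR_ge0 ?seg_ge0.
rewrite -(@ler_pXn2r _ 2)// ?nnegrE ?mulr_ge0 ?expR_ge0 ?invr_ge0 ?(ltW P0)//.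
rewrite !exprMn; apply: (@le_trans _ _ (pi ^+ 2 * (RI (fun t => f t ^+ 2) * RI (fun t => g t ^+ 2)))).
  by rewrite ler_wpM2l ?sqr_ge0// cauchy_schwarz.
rewrite (eq_RI g2) -expRM_natl.
have h1 := RI_exp (mulr_gt0 (ltr0n _ 2) l0) x0.
have F0 : 0 <= RI (fun t => f t ^+ 2) by apply: RI_ge0 => t; exact: sqr_ge0.
have E0 := expR_gt0 (2 * lam * x).
apply: (@le_trans _ _ (pi ^+ 2 * (RI (fun t => f t ^+ 2) * (expR (2 * lam * x) / (2 * lam))))).
  by rewrite ler_wpM2l ?sqr_ge0// ler_wpM2l.
rewrite (_ : 2%:R * (lam * x) = 2 * lam * x); last by rewrite mulrA.
move: (expR _) E0 => E E0; rewrite !mulrA ler_pdivrMr ?mulr_gt0//.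
rewrite (_ : 2^-1 ^+ 2 * E * (2 * lam) = (2 * lam) / 4 * E); last by field.
rewrite ler_pM2r// ler_pdivlMr//; lra.
Qed.

End Weight.

(** * Geometrically convergent sequences *)

Section Limits.
Variable R : realType.

Lemma n1_le0 (z : R[i]) : n1 z <= 0 -> z = 0.
Proof.
move=> h; have : n1 z = 0 by apply/eqP; rewrite eq_le h n1_ge0.
move=> /eqP; rewrite paddr_eq0// !normr_eq0 => /andP[/eqP a /eqP b].
by rewrite (complex_ext (w := 0) a b).
Qed.

Lemma le0_geometric (X c : R) : (forall n, X <= c / 2 ^+ n) -> X <= 0.
Proof.
move=> h; rewrite leNgt; apply/negP => X0.
have c0 : 0 < c by have := h 0%N; rewrite expr0 divr1; exact: lt_le_trans.
have := h (Num.bound (c / X)); apply/negP; rewrite -ltNge.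
rewrite ltr_pdivrMr ?exprn_gt0// mulrC -ltr_pdivrMr//.
apply: lt_le_trans (archi_boundP (ltW (divr_gt0 c0 X0))) _.
by rewrite -natrX ler_nat ltnW// ltn_expl.
Qed.

Lemma geometric_limit (a : nat -> R) (c : R) : (forall n, `|a n.+1 - a n| <= c / 2 ^+ n) ->
  a @ \oo --> limn a /\ forall n, `|limn a - a n| <= 2 * c / 2 ^+ n.
Proof.
move=> h; have c0 : 0 <= c by have := le_trans (normr_ge0 _) (h 0%N); rewrite expr0 divr1.
have key n m : `|a (n + m)%N - a n| <= 2 * c / 2 ^+ n - 2 * c / 2 ^+ (n + m).
  elim: m => [|m IH]; first by rewrite addn0 !subrr normr0.
  rewrite addnS -(subrK (a (n + m)%N) (a _)) -addrA.
  apply: le_trans (ler_normD _ _) _; apply: le_trans (lerD (h _) IH) _.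
  rewrite exprS invfM; apply: ler_of_eq; field.
  by rewrite !expf_neq0.
have key' n m : (n <= m)%N -> `|a m - a n| <= 2 * c / 2 ^+ n.
  move=> nm; rewrite -(subnKC nm); apply: le_trans (key _ _) _.
  by rewrite lerBlDr lerDl divr_ge0 ?mulr_ge0 ?exprn_ge0.
have ca : cvgn a.
  have ct : cvgn (series (telescope a)).
    apply: normed_cvg; apply: (series_le_cvg (v_ := geometric c 2^-1)).
    - by move=> n; rewrite /= normr_ge0.
    - by move=> n; rewrite /= mulr_ge0// exprn_ge0// invr_ge0.
    - by move=> n; rewrite /= exprVn; exact: h.
    - by apply: is_cvg_geometric_series; rewrite ger0_norm ?invr_ge0// invf_lt1// ltr1n.
  rewrite telescopeK in ct.
  rewrite (_ : a = (fun n => (a n - a 0%N) + a 0%N)); last by apply/funext => n; rewrite subrK.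
  by apply: is_cvgD => //; exact: is_cvg_cst.
split=> // n.
have cl : (fun m => `|a m - a n|) @ \oo --> `|limn a - a n|.
  by apply: cvg_norm; apply: cvgB => //; exact: cvg_cst.
apply: (cvgr_to_le cl); exists n => // m /= nm; exact: key'.
Qed.

End Limits.

(** * The kernel equation and its solution by iteration *)

Section Kernel.
Variable R : realType.
Local Notation C := R[i].
Variables (q : R -> C) (lam : R).
Implicit Types (x y t s u : R) (k : R * R -> C).

Definition L2pot (q : R -> C) : Prop := [/\ cmeas q, integ (fun t => n1 (q t) ^+ 2) &
  forall t, q t = (seg 0 pi t)%:C * q t].

Definition triangle x u : R := seg 0 pi x * seg (- (x / 2)) (x / 2) u.

(** The domain of influence |s - u| <= (x - t)/2: the integral of cos(2 rho u) over it is cos(2 rho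
    s) sin(rho (x - t)) / rho, which is how the Green function of the free equation acts on a
    kernel. *)
Definition cone x t u s : R := seg (u - (x - t) / 2) (u + (x - t) / 2) s.

(** The Volterra operator with kernel q(t) sin(rho (x - t)) / rho, transported from solutions to
    their kernels. It no longer contains [rho], so one kernel serves every frequency. *)
Definition Top k (z : R * R) : C := (seg 0 pi z.1)%:C *
  cI (fun t => (seg 0 z.1 t)%:C * (q t * cI (fun s => (cone z.1 t z.2 s)%:C * k (t, s)))).

(** The ball of radius [M] in the weighted supremum norm, for kernels supported where 0 <= x <= pi
    and |u| <= x/2. *)
Definition good (M : R) k : Prop := cmeas k /\
  forall x u, n1 (k (x, u)) <= M * expR (lam * x) * triangle x u.

Hypothesis hq : L2pot q.
Hypothesis lam0 : 0 < lam.
Hypothesis hlam : 4 * pi ^+ 2 * RI (fun t => n1 (q t) ^+ 2) <= 2 * lam.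

Let mq : cmeas q. Proof. by case: hq. Qed.

Lemma sqint_n1 : sqint (fun t => n1 (q t)).
Proof. by case: hq => m i _; split => //; exact: meas_n1. Qed.

Lemma integ_n1q : integ (fun t => n1 (q t)).
Proof.
case: hq => _ _ qs.
apply: integ_eq (sqint_mul (sqint_seg 0 pi) sqint_n1) => t.
by rewrite -{1}(ger0_norm (seg_ge0 0 pi t)) -n1Zr -qs.
Qed.

Lemma cinteg_q : cinteg q.
Proof. by apply: cinteg_le integ_n1q _. Qed.

Lemma triangle01 x u : 0 <= triangle x u <= 1.
Proof.
have /andP[a b] := seg01 0 pi x; have /andP[c e] := seg01 (- (x / 2)) (x / 2) u.
by rewrite /triangle mulr_ge0//= mulr_ile1.
Qed.

Lemma integ_triangle x : integ (triangle x).
Proof. by apply: integZ; exact: integ_seg. Qed.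

Lemma RI_triangle x : RI (triangle x) = seg 0 pi x * x.
Proof.
rewrite RIZ; last exact: integ_seg.
have [/andP[x0 _]|h] := boolP (0 <= x <= pi); last by rewrite (seg_out h) !mul0r.
rewrite RI_seg1; last lra.
by congr (_ * _); field.
Qed.

Lemma cmeas_inner k : cmeas k -> cmeas (fun z : (R * R) * R =>
  cI (fun s => (cone z.1.1 z.2 z.1.2 s)%:C * k (z.2, s))).
Proof.
move=> mk.
apply: (cmeas_cI (F := fun z : ((R * R) * R) * R =>
  (cone z.1.1.1 z.1.2 z.1.1.2 z.2)%:C * k (z.1.2, z.2))).
apply: cmeasM; first by apply: cmeas_real; rewrite /cone; meas_solve.
apply: (cmeas_comp (F := k) (k := fun z : ((R * R) * R) * R => (z.1.2, z.2))) => //.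
meas_solve.
Qed.

Lemma cmeas_Top k : cmeas k -> cmeas (Top k).
Proof.
move=> mk; apply: cmeasM; first by apply: cmeas_real; meas_solve.
apply: (cmeas_cI (F := fun z : (R * R) * R => (seg 0 z.1.1 z.2)%:C * (q z.2 *
  cI (fun s => (cone z.1.1 z.2 z.1.2 s)%:C * k (z.2, s))))).
apply: cmeasM; first by apply: cmeas_real; meas_solve.
apply: cmeasM; last exact: cmeas_inner.
by apply: (cmeas_comp (F := q)) => //; meas_solve.
Qed.

Lemma cone_abs x t u s : `|cone x t u s| <= 1. Proof. exact: seg_abs. Qed.

Implicit Types M : R.

Lemma good_section M k t : good M k -> cinteg (fun s => k (t, s)).
Proof.
move=> [mk hk]; apply: (cinteg_le (g := fun s => M * expR (lam * t) * triangle t s)) => //.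
- by apply: (cmeas_comp (F := k)) => //; meas_solve.
- by apply: integZ; exact: integ_triangle.
Qed.

Lemma good_cone M k x t u : good M k -> cinteg (fun s => (cone x t u s)%:C * k (t, s)).
Proof. by move=> /good_section h; exact: cinteg_seg. Qed.

Lemma good_inner M k x t u : 0 <= M -> good M k ->
  n1 (cI (fun s => (cone x t u s)%:C * k (t, s))) <= M * (pi * expR (lam * t)).
Proof.
move=> M0 gk; have [mk hk] := gk.
apply: (@le_trans _ _ (RI (fun s => M * expR (lam * t) * triangle t s))).
  apply: n1_cI_le; [exact: good_cone gk|by apply: integZ; exact: integ_triangle|move=> s].
  by rewrite n1Zr; apply: le_trans (hk _ _); rewrite ler_piMl ?n1_ge0// cone_abs.
rewrite RIZ ?RI_triangle; last exact: integ_triangle.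
rewrite -mulrA ler_wpM2l// mulrC ler_wpM2r ?expR_ge0//.
have [/andP[t0 tp]|h] := boolP (0 <= t <= pi); last by rewrite (seg_out h) mul0r pi_ge0.
by rewrite seg_in ?mul1r// t0.
Qed.

Lemma good_Top_integ M k x u : 0 <= M -> good M k -> 0 <= x <= pi ->
  cinteg (fun t => (seg 0 x t)%:C * (q t * cI (fun s => (cone x t u s)%:C * k (t, s)))).
Proof.
move=> M0 gk /andP[x0 xp]; have [mk hk] := gk.
have [i1 _] := weight_half sqint_n1 (fun t => n1_ge0 (q t)) lam0 hlam x0.
apply: (cinteg_le (g := fun t => M * pi * (seg 0 x t * (n1 (q t) * expR (lam * t))))).
- apply: cmeasM; first by apply: cmeas_real; meas_solve.
  apply: cmeasM => //.
  apply: (cmeas_comp (F := fun z : (R * R) * R =>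
    cI (fun s => (cone z.1.1 z.2 z.1.2 s)%:C * k (z.2, s))) (k := fun t => ((x, u), t))).
    exact: cmeas_inner.
  meas_solve.
- exact: integZ.
- move=> t; rewrite n1Zr ger0_norm; last by have /andP[] := seg01 0 x t.
  rewrite [leRHS]mulrCA ler_wpM2l ?seg_ge0//.
  apply: le_trans (n1M _ _) _; rewrite mulrCA ler_wpM2l ?n1_ge0//.
  by rewrite -mulrA; exact: good_inner gk.
Qed.

(** Propagation of the support: |u| <= |s| + (x - t)/2 <= t/2 + (x - t)/2 = x/2. *)
Lemma cone_out x t u s : 0 <= t <= x -> seg (- (x / 2)) (x / 2) u = 0 ->
  cone x t u s * triangle t s = 0.
Proof.
move=> /andP[t0 tx] hu; rewrite /cone /triangle.
have [/andP[h1 h2]|h] := boolP (u - (x - t) / 2 <= s <= u + (x - t) / 2); last by rewrite (seg_out h) mul0r.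
have [/andP[h3 h4]|h] := boolP (- (t / 2) <= s <= t / 2); last by rewrite (seg_out h) !mulr0.
exfalso; move: hu; rewrite seg_in; first by move/eqP; rewrite oner_eq0.
by apply/andP; split; lra.
Qed.

Lemma cone_good M k x t u s : 0 <= M -> good M k -> 0 <= t <= x ->
  n1 ((cone x t u s)%:C * k (t, s)) <=
  seg (- (x / 2)) (x / 2) u * (M * expR (lam * t) * triangle t s).
Proof.
move=> M0 [mk hk] tx; rewrite n1Zr ger0_norm ?seg_ge0//.
have E0 : 0 <= M * expR (lam * t) by rewrite mulr_ge0 ?expR_ge0.
apply: (@le_trans _ _ (M * expR (lam * t) * (cone x t u s * triangle t s))).
  by rewrite mulrCA ler_wpM2l ?seg_ge0.
rewrite [leRHS]mulrCA ler_wpM2l//.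
have [hu|hu] := boolP (- (x / 2) <= u <= x / 2); last by rewrite cone_out ?(seg_out hu)// mul0r.
rewrite (seg_in hu) mul1r ler_piMl//; first by have /andP[] := triangle01 t s.
by have /andP[] := seg01 (u - (x - t) / 2) (u + (x - t) / 2) s.
Qed.

(** The inner integral runs over a range of length t <= pi and costs a factor pi; [weight_half]
    absorbs it and leaves 1/2. The weight therefore makes [Top] a contraction however large [q]
    is. *)
Lemma good_Top M k : 0 <= M -> good M k -> good (M / 2) (Top k).
Proof.
move=> M0 gk; have [mk hk] := gk; split; first exact: cmeas_Top.
move=> x u; rewrite /Top /= n1Zr ger0_norm; last by have /andP[] := seg01 0 pi x.
rewrite /triangle mulrCA; have [xp|h] := boolP (0 <= x <= pi); last by rewrite (seg_out h) !mul0r.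
rewrite (seg_in xp) !mul1r; have /andP[x0 xpi] := xp.
have [i1 w1] := weight_half sqint_n1 (fun t => n1_ge0 (q t)) lam0 hlam x0.
have [hu|hu] := boolP (- (x / 2) <= u <= x / 2).
  rewrite (seg_in hu) mulr1.
  apply: (@le_trans _ _ (RI (fun t => M * pi * (seg 0 x t * (n1 (q t) * expR (lam * t)))))).
    apply: n1_cI_le; [exact: good_Top_integ gk xp|exact: integZ|move=> t].
    rewrite n1Zr ger0_norm; last by have /andP[] := seg01 0 x t.
    rewrite [leRHS]mulrCA ler_wpM2l ?seg_ge0//.
    apply: le_trans (n1M _ _) _; rewrite mulrCA ler_wpM2l ?n1_ge0//.
    by rewrite -mulrA; exact: good_inner gk.
  by rewrite RIZ// -!mulrA ler_wpM2l.
rewrite (seg_out hu) mulr0 (_ : cI _ = 0) ?n1_0// -[RHS]cI0; apply: eq_cI => t.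
have [tx|h] := boolP (0 <= t <= x); last by rewrite (seg_out h) mul0r.
rewrite (_ : cI _ = 0) ?mulr0// -[RHS]cI0; apply: eq_cI => s.
by apply: n1_le0; apply: le_trans (cone_good u s M0 gk tx) _; rewrite (seg_out hu) mul0r.
Qed.

Lemma TopB M k k' z : 0 <= M -> good M k -> good M k' ->
  Top k z - Top k' z = Top (fun z => k z - k' z) z.
Proof.
case: z => x u M0 gk gk'; rewrite /Top /= -mulrBr.
have [xp|h] := boolP (0 <= x <= pi); last by rewrite (seg_out h) !mul0r.
congr (_ * _); rewrite -cIB; [|exact: good_Top_integ gk xp|exact: good_Top_integ gk' xp].
apply: eq_cI => t; rewrite -!mulrBr -cIB; [|exact: good_cone gk|exact: good_cone gk'].
by congr (_ * (_ * _)); apply: eq_cI => s; rewrite mulrBr.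
Qed.

Variables alpha beta : C.

(** The kernel of the terms of the Volterra equation that do not involve the unknown kernel: beta
    sin(rho x)/rho is the cosine integral over |u| <= x/2, and cos(rho t) sin(rho (x - t))/rho is
    the one over [t - x/2, x/2]. *)
Definition ksource (z : R * R) : C := (seg 0 pi z.1)%:C *
  (beta * (seg (- (z.1 / 2)) (z.1 / 2) z.2)%:C +
   alpha * cI (fun t => (seg 0 z.1 t * seg (t - z.1 / 2) (z.1 / 2) z.2)%:C * q t)).

Definition kbound : R := n1 beta + n1 alpha * RI (fun t => n1 (q t)).

Lemma kbound_ge0 : 0 <= kbound.
Proof.
by rewrite addr_ge0 ?mulr_ge0 ?n1_ge0//; apply: RI_ge0 => t; exact: n1_ge0.
Qed.

Lemma cmeas_ksource : cmeas ksource.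
Proof.
apply: cmeasM; first by apply: cmeas_real; meas_solve.
apply: cmeasD; first by apply: cmeasM; [exact: cmeas_cst|apply: cmeas_real; meas_solve].
apply: cmeasM; first exact: cmeas_cst.
apply: (cmeas_cI (F := fun z : (R * R) * R =>
  (seg 0 z.1.1 z.2 * seg (z.2 - z.1.1 / 2) (z.1.1 / 2) z.1.2)%:C * q z.2)).
apply: cmeasM; first by apply: cmeas_real; meas_solve.
by apply: (cmeas_comp (F := q)) => //; meas_solve.
Qed.

Lemma seg2_abs a b c d x y : `|seg a b x * seg c d y : R| <= 1.
Proof. by rewrite normrM mulr_ile1// seg_abs. Qed.

Lemma cinteg_ksource x u :
  cinteg (fun t => (seg 0 x t * seg (t - x / 2) (x / 2) u)%:C * q t).
Proof.
apply: (cinteg_le (g := fun t => n1 (q t))) => [||t]; last 1 first.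
- by rewrite n1Zr ler_piMl ?n1_ge0// seg2_abs.
- by apply: cmeasM => //; apply: cmeas_real; meas_solve.
- exact: integ_n1q.
Qed.

Lemma good_ksource : good kbound ksource.
Proof.
split; first exact: cmeas_ksource.
move=> x u; rewrite /ksource /triangle /= n1Zr ger0_norm ?seg_ge0// mulrCA.
have [xp|h] := boolP (0 <= x <= pi); last by rewrite (seg_out h) !mul0r.
rewrite (seg_in xp) !mul1r; have /andP[x0 _] := xp.
have e1 : 1 <= expR (lam * x) by rewrite -expR0 ler_expR mulr_ge0// ltW.
have [hu|hu] := boolP (- (x / 2) <= u <= x / 2).
  rewrite (seg_in hu) !mulr1.
  apply: (@le_trans _ _ kbound); last by rewrite ler_peMr ?kbound_ge0.
  apply: le_trans (n1D _ _) _; rewrite lerD2l; apply: n1M_le => //.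
  apply: n1_cI_le; [exact: cinteg_ksource|exact: integ_n1q|move=> t].
  by rewrite n1Zr ler_piMl ?n1_ge0// seg2_abs.
rewrite (seg_out hu) !mulr0 add0r (_ : cI _ = 0) ?mulr0 ?n1_0//.
rewrite -[RHS]cI0; apply: eq_cI => t.
have e0 : seg 0 x t * seg (t - x / 2) (x / 2) u = 0.
  have [/andP[t0 tx]|h] := boolP (0 <= t <= x); last by rewrite (seg_out h) mul0r.
  have h : ~~ (t - x / 2 <= u <= x / 2).
    by apply: contra hu => /andP[h1 h2]; apply/andP; split=> //; lra.
  by rewrite (seg_out h) mulr0.
by rewrite e0 rmorph0 mul0r.
Qed.

Fixpoint kiter n : R * R -> C := if n is m.+1
  then fun z => ksource z + Top (kiter m) z else fun=> 0.

Lemma goodD M M' k k' : good M k -> good M' k' -> good (M + M') (fun z => k z + k' z).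
Proof.
move=> [m h] [m' h']; split; first exact: cmeasD.
by move=> x u; rewrite !mulrDl; apply: le_trans (n1D _ _) _; exact: lerD.
Qed.

(** The radius [2 * kbound] is the fixed point of [M |-> kbound + M / 2], so each iteration
    preserves it. *)
Lemma good_kiter n : good (2 * kbound) (kiter n).
Proof.
elim: n => [|n IH].
  split=> [|x u]; first exact: cmeas_cst.
  rewrite n1_0 !mulr_ge0 ?kbound_ge0 ?expR_ge0//; exact: seg_ge0.
have -> : 2 * kbound = kbound + 2 * kbound / 2 by field.
apply: goodD; first exact: good_ksource.
by apply: good_Top => //; rewrite mulr_ge0 ?kbound_ge0.
Qed.

(** Since the iteration starts at 0, the first difference is the source itself; the later ones are
    its images under the linear [Top], halved each time. *)
Lemma good_diff n : good (kbound / 2 ^+ n) (fun z => kiter n.+1 z - kiter n z).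
Proof.
elim: n => [|n IH].
  have [m h] := good_ksource; have e z : kiter 1 z - kiter 0 z = ksource z.
    rewrite /= subr0 /Top (_ : cI _ = 0) ?mulr0 ?addr0// -[RHS]cI0; apply: eq_cI => t.
    by rewrite (_ : cI _ = 0) ?mulr0// -[RHS]cI0; apply: eq_cI => s; rewrite mulr0.
  rewrite (_ : (fun z => _) = ksource); last exact/funext.
  by rewrite expr0 divr1.
have e z : kiter n.+2 z - kiter n.+1 z = Top (fun z => kiter n.+1 z - kiter n z) z.
  have k0 : 0 <= 2 * kbound by rewrite mulr_ge0 ?kbound_ge0.
  rewrite -(TopB z k0 (good_kiter n.+1) (good_kiter n)).
  rewrite [kiter n.+2 z]/= [X in _ - X = _]/= opprD addrACA subrr add0r.
  by [].
rewrite (_ : (fun z => kiter n.+2 z - kiter n.+1 z) = Top (fun z => kiter n.+1 z - kiter n z)); last exact/funext.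
rewrite exprS invfM mulrCA mulrC.
by apply: good_Top => //; rewrite divr_ge0 ?kbound_ge0// exprn_ge0.
Qed.

(** A pointwise limit of real and imaginary parts; the geometric bounds on the differences make it
    inherit measurability, support and weight. *)
Definition transmutation (z : R * R) : C :=
  Complex (limn (fun n => reC (kiter n z))) (limn (fun n => imC (kiter n z))).

Lemma transmutation_cvg z :
  ((fun n => reC (kiter n z)) @ \oo --> reC (transmutation z)) /\
  ((fun n => imC (kiter n z)) @ \oo --> imC (transmutation z)) /\
  forall n, n1 (transmutation z - kiter n z) <=
    4 * (kbound * expR (lam * z.1) * triangle z.1 z.2) / 2 ^+ n.
Proof.
case: z => x u /=; set c := kbound * _ * _.
have hd n : n1 (kiter n.+1 (x, u) - kiter n (x, u)) <= c / 2 ^+ n.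
  have [_ h] := good_diff n; apply: le_trans (h x u) _.
  by apply: ler_of_eq; rewrite /c; ring.
have [|r1 r2] := @geometric_limit R (fun n => reC (kiter n (x, u))) c.
  by move=> n; apply: le_trans (hd n); rewrite -reC_opp -reC_add; exact: re_n1.
have [|i1 i2] := @geometric_limit R (fun n => imC (kiter n (x, u))) c.
  by move=> n; apply: le_trans (hd n); rewrite -imC_opp -imC_add; exact: im_n1.
split=> //; split=> // n; rewrite /n1 !cE.
by apply: le_trans (lerD (r2 n) (i2 n)) _; rewrite -mulrDl; apply: ler_wpM2r; [rewrite invr_ge0 exprn_ge0|lra].
Qed.

Lemma cmeas_transmutation : cmeas transmutation.
Proof.
apply: (cmeas_cvg (F_ := kiter)) => [n|z|z]; first by case: (good_kiter n).
  by case: (transmutation_cvg z).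
by case: (transmutation_cvg z) => _ [].
Qed.

Lemma good_transmutationB n : good (4 * kbound / 2 ^+ n) (fun z => transmutation z - kiter n z).
Proof.
split; first by apply: cmeasB; [exact: cmeas_transmutation|case: (good_kiter n)].
move=> x u; have [_ [_ h]] := transmutation_cvg (x, u); apply: le_trans (h n) _.
by apply: ler_of_eq => /=; ring.
Qed.

Lemma good_transmutation : good (4 * kbound) transmutation.
Proof.
have := good_transmutationB 0; rewrite expr0 divr1.
by congr good; apply/funext => z; rewrite /= subr0.
Qed.

(** The defect of the equation is a difference of two errors, that of iterate [n.+1] and the
    [Top]-image of that of iterate [n]. Each is at most [c / 2 ^+ n.+1], so the defect is at most
    [c / 2 ^+ n] for every [n]. *)
Lemma transmutation_fixed z : transmutation z = ksource z + Top transmutation z.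
Proof.
apply/eqP; rewrite -subr_eq0; apply/eqP/n1_le0.
have b0 := kbound_ge0.
have k40 : 0 <= 4 * kbound by rewrite mulr_ge0.
pose c := 4 * kbound * expR (lam * z.1) * triangle z.1 z.2.
apply: (@le0_geometric _ _ c) => n.
have -> : transmutation z - (ksource z + Top transmutation z) =
    (transmutation z - kiter n.+1 z) - Top (fun z => transmutation z - kiter n z) z.
  have g2 : good (4 * kbound) (kiter n).
    have [m h] := good_kiter n; split=> // x u; apply: le_trans (h x u) _.
    rewrite -!mulrA ler_wpM2r ?ler_nat// !mulr_ge0 ?expR_ge0//; exact: seg_ge0.
  rewrite -(TopB z k40 good_transmutation g2).
  have gen (p u v w r : C) : r = u + v -> p - (u + w) = p - r - (w - v).
    by move=> ->; ring.
  exact: gen.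
apply: le_trans (n1B _ _) _.
rewrite {}/c; case: z => x u; rewrite [(x, u).1]/= [(x, u).2]/=.
have [_ h1] := good_transmutationB n.+1; have kn0 : 0 <= 4 * kbound / 2 ^+ n by rewrite divr_ge0 ?exprn_ge0.
have [_ h2] := good_Top kn0 (good_transmutationB n).
apply: le_trans (lerD (h1 x u) (h2 x u)) _.
apply: ler_of_eq; rewrite exprS; field.
by rewrite expf_neq0.
Qed.

End Kernel.

(** * From the kernel to a solution of the differential equation *)

Section Solution.
Variable R : realType.
Local Notation C := R[i].
Variables (q : R -> C) (lam : R) (alpha beta : C).
Implicit Types (x y t s u rho : R).
Hypothesis hq : L2pot q.
Hypothesis lam0 : 0 < lam.
Hypothesis hlam : 4 * pi ^+ 2 * RI (fun t => n1 (q t) ^+ 2) <= 2 * lam.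

Local Notation K := (transmutation q alpha beta).
Local Notation N := (RI (fun t => n1 (q t))).
Local Notation kb := (kbound q alpha beta).

Lemma cmeas_cosC c : cmeas (fun u => (cos (c * u))%:C : C).
Proof. by apply: cmeas_real; exact: meas_cosM. Qed.

Lemma n1_cosC (x : R) : n1 ((cos x)%:C : C) <= 1.
Proof. by rewrite n1_real cos_max. Qed.

Lemma transmutation_bound x u : n1 (K (x, u)) <= 4 * kb * expR (lam * pi) * triangle x u.
Proof.
have [_ h] := good_transmutation hq lam0 hlam alpha beta; apply: le_trans (h x u) _.
rewrite /triangle; have [xp|xp] := boolP (0 <= x <= pi); last by rewrite (seg_out xp) mul0r !mulr0.
apply: ler_wpM2r; first by rewrite mulr_ge0 ?seg_ge0.
apply: ler_wpM2l; first by rewrite mulr_ge0// kbound_ge0.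
by rewrite ler_expR ler_pM2l//; case/andP: xp.
Qed.

Lemma cone_sym x t u s : cone x t u s = cone x t s u.
Proof.
rewrite /cone /seg; congr (_%:R); congr nat_of_bool.
by apply/andP/andP => -[h1 h2]; split; lra.
Qed.

Lemma RI_cone rho x t s : 0 < rho -> t <= x ->
  RI (fun u => cone x t u s * cos (2 * rho * u)) =
  cos (2 * rho * s) * (sin (rho * (x - t)) / rho).
Proof.
move=> r0 tx; rewrite (@eq_RI _ _ (fun u => seg (s - (x - t) / 2) (s + (x - t) / 2) u *
  cos (2 * rho * u))); last by move=> u; rewrite cone_sym.
rewrite RI_cos; [|lra|by rewrite gt_eqF ?mulr_gt0].
have -> : 2 * rho * (s + (x - t) / 2) = 2 * rho * s + rho * (x - t) by field.
have -> : 2 * rho * (s - (x - t) / 2) = 2 * rho * s - rho * (x - t) by field.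
rewrite sinD sinB; move: (sin _) (cos _) (sin _) (cos _) => a b c d.
by field; rewrite gt_eqF.
Qed.

Lemma RI_source rho x t : 0 < rho -> t <= x ->
  RI (fun u => seg (t - x / 2) (x / 2) u * cos (2 * rho * u)) =
  cos (rho * t) * (sin (rho * (x - t)) / rho).
Proof.
move=> r0 tx; rewrite RI_cos; [|lra|by rewrite gt_eqF ?mulr_gt0].
have -> : 2 * rho * (x / 2) = rho * t + rho * (x - t) by field.
have -> : 2 * rho * (t - x / 2) = rho * t - rho * (x - t) by field.
rewrite sinD sinB; move: (sin _) (cos _) (sin _) (cos _) => a b c d.
by field; rewrite gt_eqF.
Qed.

Section Frequency.
Variable rho : R.
Hypothesis rho0 : 0 < rho.

Let e u : C := (cos (2 * rho * u))%:C.

(** The cosine remains outside the integral: as a transform in [u] it would be a pair of point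
    masses at [x / 2] and [- (x / 2)], not a bounded kernel. *)
Definition sol x : C := alpha * (cos (rho * x))%:C + cI (fun u => K (x, u) * e u).

Lemma cinteg_good (M : R) k x : good lam M k -> cinteg (fun u => k (x, u) * e u).
Proof.
move=> gk; apply: (cintegMb (M := 1)); first exact: good_section gk.
- exact: cmeas_cosC.
- by move=> u; exact: n1_cosC.
Qed.

Lemma source_term x : 0 <= x <= pi ->
  cI (fun u => ksource q alpha beta (x, u) * e u) = beta * (sin (rho * x) / rho)%:C +
  alpha * cI (fun t => (seg 0 x t)%:C * (q t * (cos (rho * t) * (sin (rho * (x - t)) / rho))%:C)).
Proof.
move=> xp; have /andP[x0 _] := xp; have [mq _ _] := hq.
have me : cmeas e by exact: cmeas_cosC.
pose F (z : R * R) : C := (seg 0 x z.2 * seg (z.2 - x / 2) (x / 2) z.1)%:C * (q z.2 * e z.1).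
have mF : cmeas F.
  apply: cmeasM; first by apply: cmeas_real; meas_solve.
  apply: cmeasM; first by apply: (cmeas_comp (F := q)) => //; meas_solve.
  by apply: (cmeas_comp (F := e)) => //; meas_solve.
have bF u t : n1 (F (u, t)) <= seg (- (x / 2)) (x / 2) u * n1 (q t).
  rewrite /F /= n1Zr; apply: ler_pM => //; first exact: n1_ge0.
    rewrite ger0_norm ?mulr_ge0 ?seg_ge0//.
    have [/andP[t0 tx]|h] := boolP (0 <= t <= x); last by rewrite (seg_out h) mul0r seg_ge0.
    have [/andP[u0 u1]|h] := boolP (t - x / 2 <= u <= x / 2); last by rewrite (seg_out h) mulr0 seg_ge0.
    rewrite [leRHS]seg_in; last by apply/andP; split=> //; lra.
    by rewrite mulr_ile1 ?seg_ge0//; [have /andP[] := seg01 0 x t|have /andP[] := seg01 (t - x / 2) (x / 2) u].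
  by rewrite -[leRHS]mulr1; apply: n1M_le => //; exact: n1_cosC.
have iq := integ_n1q hq.
rewrite (eq_cI (g := fun u => beta * (seg (- (x / 2)) (x / 2) u * cos (2 * rho * u))%:C +
    alpha * cI (fun t => F (u, t)))); last first.
  move=> u; rewrite /ksource /= (seg_in xp) mul1r mulrDl; congr (_ + _).
    by rewrite -mulrA -rmorphM.
  rewrite -mulrA -cIZr; last exact: cinteg_ksource.
  by congr (_ * _); apply: eq_cI => t; rewrite /F /= mulrA.
have i1 := integ_cosM (- (x / 2)) (x / 2) (2 * rho).
have i2 := cinteg_cI mF bF (integ_seg _ _) iq.
rewrite cID ?cIZ//; [|exact: cinteg_real|by apply: cintegZ; exact: cinteg_real|exact: cintegZ].
rewrite cI_real RI_cos; [|lra|by rewrite gt_eqF ?mulr_gt0].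
congr (_ * _%:C + _ * _).
  have -> : 2 * rho * (x / 2) = rho * x by field.
  have -> : 2 * rho * - (x / 2) = - (rho * x) by field.
  by rewrite sinN; field; rewrite gt_eqF.
rewrite (cI_swap mF bF (integ_seg _ _) iq); apply: eq_cI => t.
have [tx|h] := boolP (0 <= t <= x); last first.
  by rewrite (seg_out h) mul0r -[RHS]cI0; apply: eq_cI => u; rewrite /F /= (seg_out h) !mul0r.
rewrite -RI_source//; last by case/andP: tx.
rewrite -cI_real mulrA -cIZ; last by apply: cinteg_real; exact: integ_cosM.
by apply: eq_cI => u; rewrite /F /e /= !rmorphM /=; ring.
Qed.

(** Two exchanges of integration: of [u] with [t], and for fixed [t] of [u] with [s]. The innermost
    integral over [u] is then [RI_cone]. *)
Lemma top_term x : 0 <= x <= pi ->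
  cI (fun u => Top q K (x, u) * e u) =
  cI (fun t => (seg 0 x t)%:C * (q t * (cI (fun s => K (t, s) * e s) * (sin (rho * (x - t)) / rho)%:C))).
Proof.
move=> xp; have /andP[x0 xpi] := xp; have [mq _ _] := hq.
have me : cmeas e by exact: cmeas_cosC.
have gK := good_transmutation hq lam0 hlam alpha beta; have [mK hK] := gK.
set M := 4 * kb in gK hK.
have M0 : 0 <= M by rewrite mulr_ge0// kbound_ge0.
pose I (z : R * R) : C := cI (fun s => (cone x z.2 z.1 s)%:C * K (z.2, s)).
have mI : cmeas I.
  apply: (cmeas_comp (F := fun z : (R * R) * R => cI (fun s => (cone z.1.1 z.2 z.1.2 s)%:C * K (z.2, s)))
     (k := fun z : R * R => ((x, z.1), z.2))); first exact: cmeas_inner.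
  meas_solve.
have bI u t : 0 <= t <= x -> n1 (I (u, t)) <= seg (- (x / 2)) (x / 2) u * (M * (pi * expR (lam * pi))).
  move=> tx; have /andP[t0 txx] := tx; rewrite /I /=.
  apply: (@le_trans _ _ (RI (fun s => seg (- (x / 2)) (x / 2) u * (M * expR (lam * t) * triangle t s)))).
    apply: n1_cI_le; first exact: good_cone gK.
      by apply: integZ; apply: integZ; exact: integ_triangle.
    by move=> s; exact: (cone_good u s M0 gK tx).
  rewrite RIZ; last by apply: integZ; exact: integ_triangle.
  rewrite ler_wpM2l ?seg_ge0// RIZ ?RI_triangle; last exact: integ_triangle.
  rewrite -mulrA ler_wpM2l// mulrC seg_in ?mul1r; last by rewrite t0 (le_trans txx).
  by apply: ler_pM; rewrite ?expR_ge0 ?(le_trans txx)// ler_expR ler_pM2l// (le_trans txx).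
pose F (z : R * R) : C := (seg 0 x z.2)%:C * (q z.2 * (I z * e z.1)).
have mF : cmeas F.
  apply: cmeasM; first by apply: cmeas_real; meas_solve.
  apply: cmeasM; first by apply: (cmeas_comp (F := q)) => //; meas_solve.
  by apply: cmeasM => //; apply: (cmeas_comp (F := e)) => //; meas_solve.
have bF u t : n1 (F (u, t)) <= seg (- (x / 2)) (x / 2) u * (M * (pi * expR (lam * pi)) * n1 (q t)).
  have [tx|h] := boolP (0 <= t <= x); last first.
    rewrite /F /= (seg_out h) mul0r n1_0 mulr_ge0 ?seg_ge0// mulr_ge0 ?n1_ge0// mulr_ge0//.
    by rewrite mulr_ge0 ?pi_ge0 ?expR_ge0.
  rewrite /F /= (seg_in tx) mul1r; apply: le_trans (n1M _ _) _.
  rewrite [leRHS]mulrA [leRHS]mulrC ler_wpM2l ?n1_ge0//.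
  by rewrite -[leRHS]mulr1; apply: n1M_le; [exact: bI|exact: n1_cosC].
have iq : integ (fun t => M * (pi * expR (lam * pi)) * n1 (q t)) by apply: integZ; exact: integ_n1q hq.
rewrite (eq_cI (g := fun u => cI (fun t => F (u, t)))); last first.
  move=> u; rewrite /Top /= (seg_in xp) mul1r -cIZr; last exact: good_Top_integ hq lam0 hlam _ _ _ _ M0 gK xp.
  by apply: eq_cI => t; rewrite /F /I /= -!mulrA.
rewrite (cI_swap mF bF (integ_seg _ _) iq); apply: eq_cI => t.
have [tx|h] := boolP (0 <= t <= x); last first.
  by rewrite (seg_out h) mul0r -[RHS]cI0; apply: eq_cI => u; rewrite /F /= (seg_out h) !mul0r.
have /andP[t0 txx] := tx.
rewrite (seg_in tx) mul1r.
rewrite (eq_cI (g := fun u => q t * (I (u, t) * e u))); last first.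
  by move=> u; rewrite /F /= (seg_in tx) mul1r.
have iIe : cinteg (fun u => I (u, t) * e u).
  apply: (cinteg_le (g := fun u => M * (pi * expR (lam * pi)) * seg (- (x / 2)) (x / 2) u)).
  - by apply: cmeasM => //; apply: (cmeas_comp (F := I)) => //; meas_solve.
  - by apply: integZ; exact: integ_seg.
  - by move=> u; rewrite [leRHS]mulrC -[leRHS]mulr1; apply: n1M_le; [exact: bI|exact: n1_cosC].
rewrite cIZ//; congr (_ * _).
(* The second exchange, at fixed [t]; the support of [cone] times [triangle] supplies a separated
   majorant. *)
pose G (z : R * R) : C := (cone x t z.1 z.2)%:C * (K (t, z.2) * e z.1).
have mG : cmeas G.
  apply: cmeasM; first by apply: cmeas_real; rewrite /cone; meas_solve.
  apply: cmeasM; last by apply: (cmeas_comp (F := e)) => //; meas_solve.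
  by apply: (cmeas_comp (F := K) (k := fun z : R * R => (t, z.2))) => //; meas_solve.
have bG u s : n1 (G (u, s)) <= seg (- (x / 2)) (x / 2) u * (M * expR (lam * t) * triangle t s).
  rewrite /G /= mulrA -[leRHS]mulr1; apply: n1M_le; last exact: n1_cosC.
  exact: (cone_good u s M0 gK tx).
have itr : integ (fun s => M * expR (lam * t) * triangle t s) by apply: integZ; exact: integ_triangle.
rewrite (eq_cI (g := fun u => cI (fun s => G (u, s)))); last first.
  move=> u; rewrite /I /= -cIZr; last exact: good_cone gK.
  by apply: eq_cI => s; rewrite /G /= mulrA.
rewrite (cI_swap mG bG (integ_seg _ _) itr) -cIZr; last exact: cinteg_good gK.
apply: eq_cI => s.
rewrite -mulrA /e -rmorphM/= -RI_cone// -cI_real -cIZ; last first.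
  apply: cinteg_real; apply: integ_eq (integ_cosM (s - (x - t) / 2) (s + (x - t) / 2) (2 * rho)) => u.
  by rewrite cone_sym.
by apply: eq_cI => u; rewrite /G /= mulrCA rmorphM.
Qed.

Lemma sol_bound x : n1 (sol x) <= n1 alpha + 4 * kb * expR (lam * pi) * pi.
Proof.
apply: le_trans (n1D _ _) _; apply: lerD.
  by rewrite -[leRHS]mulr1; apply: n1M_le => //; exact: n1_cosC.
have gK := good_transmutation hq lam0 hlam alpha beta.
have b0 : 0 <= 4 * kb * expR (lam * pi) by rewrite !mulr_ge0 ?kbound_ge0 ?expR_ge0.
apply: (@le_trans _ _ (RI (fun u => 4 * kb * expR (lam * pi) * triangle x u))).
  apply: n1_cI_le; first exact: cinteg_good gK.
    by apply: integZ; exact: integ_triangle.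
  by move=> u; rewrite -[leRHS]mulr1; apply: n1M_le; [exact: transmutation_bound|exact: n1_cosC].
rewrite RIZ ?RI_triangle; last exact: integ_triangle.
rewrite ler_wpM2l//; have [xp|h] := boolP (0 <= x <= pi); last by rewrite (seg_out h) mul0r pi_ge0.
by rewrite (seg_in xp) mul1r; case/andP: xp.
Qed.

Lemma cmeas_sol : cmeas sol.
Proof.
apply: cmeasD; first by apply: cmeasM; [exact: cmeas_cst|exact: cmeas_cosC].
apply: (cmeas_cI (F := fun z : R * R => K z * e z.2)) => //.
apply: cmeasM; first by case: (good_transmutation hq lam0 hlam alpha beta).
by apply: (cmeas_comp (F := e)); [exact: cmeas_cosC|meas_solve].
Qed.

Lemma cinteg_qsol : cinteg (fun t => q t * sol t).
Proof.
apply: (cintegMb (M := n1 alpha + 4 * kb * expR (lam * pi) * pi)).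
- exact: cinteg_q hq.
- exact: cmeas_sol.
- exact: sol_bound.
Qed.

(** The fixed point equation of the kernel, integrated against cos(2 rho u). The potential
    multiplies the whole [sol] because the source contributes its cosine and [Top] its integral. *)
Lemma volterra x : 0 <= x <= pi ->
  sol x = alpha * (cos (rho * x))%:C + beta * (sin (rho * x) / rho)%:C +
    cI (fun t => (seg 0 x t)%:C * (q t * (sol t * (sin (rho * (x - t)) / rho)%:C))).
Proof.
move=> xp; rewrite /sol -addrA; congr (_ + _).
have gK := good_transmutation hq lam0 hlam alpha beta.
have b0 : 0 <= 4 * kb by rewrite mulr_ge0 ?kbound_ge0.
have gs := good_ksource hq lam0 alpha beta.
have gT := good_Top hq lam0 hlam b0 gK.
rewrite (eq_cI (g := fun u => ksource q alpha beta (x, u) * e u + Top q K (x, u) * e u)); last first.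
  by move=> u; rewrite -mulrDl -(transmutation_fixed hq lam0 hlam).
rewrite cID; [|exact: cinteg_good gs|exact: cinteg_good gT].
rewrite source_term// top_term// -addrA; congr (_ + _).
have ck (z : R) : `|sin (rho * z) / rho| <= rho^-1.
  by rewrite normrM normfV (ger0_norm (ltW rho0)) ler_piMl ?invr_ge0 ?(ltW rho0)// sin_max.
have iq' (k : R -> C) (B : R) : cmeas k -> (forall t, n1 (k t) <= B) ->
    cinteg (fun t => (seg 0 x t)%:C * (q t * k t)).
  by move=> mk kB; apply: cinteg_seg; apply: cintegMb kB => //; exact: cinteg_q hq.
have msin : measurable_fun setT (fun t => sin (rho * (x - t)) / rho).
  apply: measurable_funM; last exact: measurable_cst.
  by apply: (measurableT_comp (meas_sinM rho)); meas_solve.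
have i1 : cinteg (fun t => (seg 0 x t)%:C * (q t * (cos (rho * t) * (sin (rho * (x - t)) / rho))%:C)).
  apply: (iq' _ rho^-1).
    by apply: cmeas_real; apply: measurable_funM => //; exact: meas_cosM.
  move=> t; rewrite n1_real normrM -[leRHS]mul1r; apply: ler_pM => //; exact: cos_max.
have i2 : cinteg (fun t => (seg 0 x t)%:C * (q t * (cI (fun s => K (t, s) * e s) * (sin (rho * (x - t)) / rho)%:C))).
  have mc : cmeas (fun t => cI (fun s => K (t, s) * e s)).
    apply: (cmeas_cI (F := fun z : R * R => K z * e z.2)) => //.
    apply: cmeasM; first by case: (good_transmutation hq lam0 hlam alpha beta).
    by apply: (cmeas_comp (F := e)); [exact: cmeas_cosC|meas_solve].
  apply: (iq' _ ((n1 alpha + 4 * kb * expR (lam * pi) * pi + n1 alpha) * rho^-1)).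
    by apply: cmeasM => //; exact: cmeas_real.
  move=> t; apply: n1M_le; last by rewrite n1_real.
  have -> : cI (fun s => K (t, s) * e s) = sol t - alpha * (cos (rho * t))%:C.
    by rewrite /sol addrC addKr.
  apply: le_trans (n1B _ _) _; apply: lerD; first exact: sol_bound.
  by rewrite -[leRHS]mulr1; apply: n1M_le => //; exact: n1_cosC.
rewrite -cIZ// -cID//; last exact: cintegZ.
apply: eq_cI => t; rewrite !rmorphM /=; ring.
Qed.

Let f t : C := q t * sol t.
Let A x : C := cI (fun t => (seg 0 x t)%:C * ((cos (rho * t))%:C * f t)).
Let B x : C := cI (fun t => (seg 0 x t)%:C * ((sin (rho * t))%:C * f t)).

Lemma cinteg_cosf : cinteg (fun t => (cos (rho * t))%:C * f t).
Proof.
apply: (cinteg_eq (f := fun t => f t * (cos (rho * t))%:C)) => [t|]; first by rewrite mulrC.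
by apply: (cintegMb (M := 1)) => [|//|t]; [exact: cinteg_qsol|exact: cmeas_cosC|exact: n1_cosC].
Qed.

Lemma cinteg_sinf : cinteg (fun t => (sin (rho * t))%:C * f t).
Proof.
apply: (cinteg_eq (f := fun t => f t * (sin (rho * t))%:C)) => [t|]; first by rewrite mulrC.
apply: (cintegMb (M := 1)) => [|//|t]; first exact: cinteg_qsol.
  by apply: cmeas_real; exact: meas_sinM.
by rewrite n1_real sin_max.
Qed.

Definition dsol x : C := beta * (cos (rho * x))%:C - alpha * (rho * sin (rho * x))%:C +
  ((cos (rho * x))%:C * A x + (sin (rho * x))%:C * B x).

(** Expanding sin(rho (x - t)) frees the integrands from [x], so [A] and [B] are genuine primitives
    and the product rule can differentiate the formula. *)
Lemma sol_variation x : 0 <= x <= pi ->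
  sol x = alpha * (cos (rho * x))%:C + (rho^-1)%:C * (beta * (sin (rho * x))%:C +
    ((sin (rho * x))%:C * A x - (cos (rho * x))%:C * B x)).
Proof.
move=> xp; rewrite volterra//.
have iA := cinteg_seg 0 x cinteg_cosf; have iB := cinteg_seg 0 x cinteg_sinf.
rewrite -addrA mulrDr; congr (_ + (_ + _)).
  by rewrite rmorphM /=; ring.
rewrite /A /B -!cIZ// -cIB; [|exact: cintegZ|exact: cintegZ].
rewrite -cIZ; last by apply: cintegB; exact: cintegZ.
apply: eq_cI => t; rewrite mulrBr sinB /f !(rmorphM, rmorphB) /=; ring.
Qed.

(** In the first derivative the densities of [A] and [B] cancel; in the second they combine, by
    cos^2 + sin^2 = 1, to [q * sol]. *)
Lemma solution_solves : solves q rho%:C sol dsol.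
Proof.
have aA : acont A (fun t => (cos (rho * t))%:C * f t).
  by apply: acont_prim; apply: cinteg_seg; exact: cinteg_cosf.
have aB : acont B (fun t => (sin (rho * t))%:C * f t).
  by apply: acont_prim; apply: cinteg_seg; exact: cinteg_sinf.
have ac := acont_cos rho; have as_ := acont_sin rho.
have e1 t : ((cos (rho * t))%:C * (cos (rho * t))%:C + (sin (rho * t))%:C * (sin (rho * t))%:C : C) = 1.
  by rewrite -!rmorphM -rmorphD/= -!expr2 cos2Dsin2.
have rV : (rho^-1)%:C * rho%:C = 1 :> C by rewrite -rmorphM/= mulVf ?gt_eqF.
split.
  have h1 := acontD (acontZ alpha ac) (acontZ (rho^-1)%:C (acontD (acontZ beta as_) (acontB (acont_mul as_ aA) (acont_mul ac aB)))).
  apply: acont_eq h1 => x xp; first by rewrite sol_variation.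
  rewrite /dsol !(rmorphM, rmorphN)/=.
  move: (cos (rho * x))%:C (sin (rho * x))%:C (A x) (B x) (f x) (rho^-1)%:C (rho%:C) rV => c s a b g r' r rV.
  transitivity (beta * (r' * r * c) - alpha * (r * s) + r' * r * (c * a + s * b)); first by ring.
  by rewrite rV !mul1r.
have h2 := acontD (acontB (acontZ beta ac) (acontZ alpha (acontZ rho%:C as_))) (acontD (acont_mul ac aA) (acont_mul as_ aB)).
apply: acont_eq h2 => x xp; first by rewrite /dsol rmorphM.
rewrite mulrBl -/(f x) sol_variation// !(rmorphM, rmorphN)/=.
move: (e1 x); move: (cos (rho * x))%:C (sin (rho * x))%:C (A x) (B x) (f x) (rho^-1)%:C (rho%:C) rV => c s a b g r' r rV cs1.
transitivity (g * (c * c + s * s) - (r * r * alpha * c + r * (beta * s + (s * a - c * b)))); first by ring.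
rewrite cs1 mulr1; congr (_ - _).
transitivity (r * r * alpha * c + r * (r' * r) * (beta * s + (s * a - c * b))); first by rewrite rV mulr1.
ring.
Qed.

Lemma sol0 : sol 0 = alpha /\ dsol 0 = beta.
Proof.
have p : 0 <= (0 : R) <= pi by rewrite lexx pi_ge0.
rewrite sol_variation// /dsol /A /B !cI_seg00 !mulr0 cos0 sin0 !mulr0.
by rewrite [alpha * _]mulr1 [beta * _]mulr1 !subr0 !addr0 mulr0 addr0.
Qed.

Lemma n1_prim (g : R -> C) (c : R) x : cinteg g -> (forall t, n1 (g t) <= n1 (q t) * c) ->
  n1 (cI (fun t => (seg 0 x t)%:C * g t)) <= N * c.
Proof.
move=> ig gc; apply: (@le_trans _ _ (RI (fun t => c * n1 (q t)))); last first.
  by rewrite RIZ 1?mulrC//; exact: integ_n1q hq.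
apply: n1_cI_le; first exact: cinteg_seg.
  by apply: integZ; exact: integ_n1q hq.
move=> t; rewrite n1Zr [leRHS]mulrC; apply: le_trans (gc t).
by rewrite ler_piMl ?n1_ge0// seg_abs.
Qed.

Definition sol_const : R := n1 beta + 2 * (N * (n1 alpha + 4 * kb * expR (lam * pi) * pi)).

Lemma prim_bounds x : n1 (A x) <= N * (n1 alpha + 4 * kb * expR (lam * pi) * pi) /\
  n1 (B x) <= N * (n1 alpha + 4 * kb * expR (lam * pi) * pi).
Proof.
have h t : n1 (f t) <= n1 (q t) * (n1 alpha + 4 * kb * expR (lam * pi) * pi).
  by apply: n1M_le => //; exact: sol_bound.
split; apply: n1_prim; [exact: cinteg_cosf| |exact: cinteg_sinf|].
  by move=> t; rewrite -[leRHS]mul1r; apply: n1M_le; [exact: n1_cosC|].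
by move=> t; rewrite -[leRHS]mul1r; apply: n1M_le => //; rewrite n1_real sin_max.
Qed.

(** Read off from the variation of constants formula once [A] and [B] are bounded. What matters is
    that [sol_const] is independent of [rho] and of [x]. *)
Lemma sol_asymptotics x : 0 <= x <= pi ->
  n1 (dsol x + alpha * (rho * sin (rho * x))%:C) <= sol_const /\
  n1 (sol x - alpha * (cos (rho * x))%:C) <= rho^-1 * sol_const.
Proof.
move=> xp; have [hA hB] := prim_bounds x.
have hc : n1 ((cos (rho * x))%:C : C) <= 1 by exact: n1_cosC.
have hs : n1 ((sin (rho * x))%:C : C) <= 1 by rewrite n1_real sin_max.
split.
  rewrite /dsol addrAC subrK; apply: le_trans (n1D _ _) _; apply: lerD.
    by rewrite -[leRHS]mulr1; apply: n1M_le.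
  apply: le_trans (n1D _ _) _; rewrite mulr2n mulrDl mul1r.
  by apply: lerD; rewrite -[leRHS]mul1r; apply: n1M_le.
rewrite sol_variation// addrC addKr n1Zr ger0_norm ?invr_ge0 ?(ltW rho0)//.
rewrite ler_wpM2l ?invr_ge0 ?(ltW rho0)//.
apply: le_trans (n1D _ _) _; apply: lerD.
  by rewrite -[leRHS]mulr1; apply: n1M_le.
apply: le_trans (n1B _ _) _; rewrite mulr2n mulrDl mul1r.
by apply: lerD; rewrite -[leRHS]mul1r; apply: n1M_le.
Qed.

End Frequency.
End Solution.

(** * The kernel of a product of two solutions *)

Section ProductKernel.
Variable R : realType.
Local Notation C := R[i].
Implicit Types (x y t s u v a rho : R) (k : R -> C).

Lemma cos_cos x y : cos x * cos y = 2^-1 * (cos (x + y) + cos (x - y)) :> R.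
Proof. by rewrite cosD cosB; field. Qed.

Lemma cinteg_cos k c : cinteg k -> cinteg (fun u => k u * (cos (c * u))%:C).
Proof.
move=> ik; apply: (cintegMb (M := 1)) => // [|u].
  by apply: cmeas_real; exact: meas_cosM.
by rewrite n1_real cos_max.
Qed.

(** By the addition formula a factor cos(c a) averages the two shifts of the kernel by [a] and
    [- a]. *)
Lemma shift_cos k c a : cinteg k ->
  (cos (c * a))%:C * cI (fun u => k u * (cos (c * u))%:C) =
  cI (fun u => (2^-1)%:C * (k (u - a) + k (u + a)) * (cos (c * u))%:C).
Proof.
move=> ik; have [i1 _] := cI_trans (- a) ik; have [i2 _] := cI_trans a ik.
have ic := cinteg_cos c.
have j1 : cinteg (fun u => k u * (cos (c * (u + a)))%:C).
  apply: (cintegMb (M := 1)) => // [|u]; last by rewrite n1_real cos_max.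
  by apply: cmeas_real; apply: (measurableT_comp (meas_cosM c)); meas_solve.
have j2 : cinteg (fun u => k u * (cos (c * (u - a)))%:C).
  apply: (cintegMb (M := 1)) => // [|u]; last by rewrite n1_real cos_max.
  by apply: cmeas_real; apply: (measurableT_comp (meas_cosM c)); meas_solve.
rewrite -cIZ; last exact: ic.
rewrite (eq_cI (g := fun u => (2^-1)%:C * (k u * (cos (c * (u + a)))%:C + k u * (cos (c * (u - a)))%:C))); last first.
  move=> u; rewrite -mulrDr -rmorphD [RHS]mulrCA -rmorphM mulrCA -rmorphM/= cos_cos.
  congr (_ * (_ * (_ + _))%:C); first by congr cos; ring.
  by rewrite -cosN; congr cos; ring.
rewrite [RHS](eq_cI (g := fun u => (2^-1)%:C * (k (u - a) * (cos (c * u))%:C + k (u + a) * (cos (c * u))%:C))); last first.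
  by move=> u; rewrite -mulrDl mulrA.
rewrite !cIZ ?cID//; try by apply: cintegD => //; exact: ic.
- congr (_ * (_ + _)).
    have [_ <-] := cI_trans (- a) j1; apply: eq_cI => u /=.
    by rewrite subrK.
  have [_ <-] := cI_trans a j2; apply: eq_cI => u /=.
  by rewrite addrK.
- exact: ic.
- exact: ic.
Qed.

(** Applying [shift_cos] under the integral with each [v] as shift gives a convolution symmetrised
    in [v]; Fubini brings cos(c u) outside. *)
Lemma conv_cos k1 k2 c a (M1 M2 : R) : cmeas k1 -> cmeas k2 -> 0 <= M1 -> 0 <= M2 ->
  (forall u, n1 (k1 u) <= M1 * seg (- a) a u) -> (forall u, n1 (k2 u) <= M2 * seg (- a) a u) ->
  cI (fun u => k1 u * (cos (c * u))%:C) * cI (fun u => k2 u * (cos (c * u))%:C) =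
  cI (fun u => (2^-1)%:C * cI (fun v => k1 v * (k2 (u - v) + k2 (u + v))) * (cos (c * u))%:C).
Proof.
move=> m1 m2 M10 M20 b1 b2.
have ib (M : R) : integ (fun u => M * seg (- a) a u) by apply: integZ; exact: integ_seg.
have i1 : cinteg k1 by apply: cinteg_le b1.
have i2 : cinteg k2 by apply: cinteg_le b2.
rewrite -cIZr; last exact: cinteg_cos.
rewrite (eq_cI (g := fun v => cI (fun u => k1 v * ((2^-1)%:C * (k2 (u - v) + k2 (u + v)) * (cos (c * u))%:C)))); last first.
  move=> v; rewrite -mulrA shift_cos// -cIZ//.
  have [j1 _] := cI_trans (- v) i2; have [j2 _] := cI_trans v i2.
  by apply: cinteg_cos; apply: cintegZ; exact: cintegD.
pose F (z : R * R) : C := k1 z.1 * ((2^-1)%:C * (k2 (z.2 - z.1) + k2 (z.2 + z.1)) * (cos (c * z.2))%:C).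
have mF : cmeas F.
  apply: cmeasM; first by apply: (cmeas_comp (F := k1)) => //; meas_solve.
  apply: cmeasM; last by apply: cmeas_real; apply: (measurableT_comp (meas_cosM c)); meas_solve.
  apply: cmeasM; first exact: cmeas_cst.
  by apply: cmeasD; apply: (cmeas_comp (F := k2)) => //; meas_solve.
have bF v u : n1 (F (v, u)) <= M1 * seg (- a) a v * (M2 * seg (- (2 * a)) (2 * a) u).
  have [hv|hv] := boolP (- a <= v <= a); last first.
    have h0 : n1 (k1 v) <= 0 by apply: le_trans (b1 v) _; rewrite (seg_out hv) mulr0.
    by rewrite /F /= (n1_le0 h0) mul0r n1_0 (seg_out hv) mulr0 mul0r.
  rewrite /F /=; apply: n1M_le => //.
  rewrite -[leRHS]mulr1; apply: n1M_le; last by rewrite n1_real cos_max.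
  have hs w : w = u - v \/ w = u + v -> n1 (k2 w) <= M2 * seg (- (2 * a)) (2 * a) u.
    move=> hw; apply: le_trans (b2 w) _; apply: ler_wpM2l => //.
    have [hw2|h] := boolP (- a <= w <= a); last by rewrite (seg_out h) seg_ge0.
    rewrite (seg_in hw2) seg_in//; case/andP: hw2 => h1 h2; case/andP: hv => h3 h4.
    by case: hw => hw; rewrite hw in h1 h2; apply/andP; split; lra.
  rewrite n1Zr ger0_norm ?invr_ge0//; apply: le_trans (_ : 2^-1 * (n1 (k2 (u - v)) + n1 (k2 (u + v))) <= _).
    by rewrite ler_wpM2l ?invr_ge0// n1D.
  by have := hs (u - v) (or_introl erefl); have := hs (u + v) (or_intror erefl); lra.
have ib2 : integ (fun u => M2 * seg (- (2 * a)) (2 * a) u) by apply: integZ; exact: integ_seg.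
rewrite (cI_swap mF bF (ib M1) ib2); apply: eq_cI => u.
have ik : cinteg (fun v => k1 v * (k2 (u - v) + k2 (u + v))).
  apply: (cintegMb (M := M2 + M2)) => // [|v].
    by apply: cmeasD; apply: (cmeas_comp (F := k2)) => //; meas_solve.
  have hs w : n1 (k2 w) <= M2.
    by apply: le_trans (b2 w) _; rewrite ler_piMr//; have /andP[] := seg01 (- a) a w.
  by apply: le_trans (n1D _ _) _; exact: lerD.
rewrite -cIZ// -cIZr; last exact: cintegZ.
by apply: eq_cI => v; rewrite /F /= !mulrA; congr (_ * _ * _); rewrite mulrC.
Qed.

Variables (K1 K2 : R * R -> C) (M1 M2 : R).
Hypotheses (mK1 : cmeas K1) (mK2 : cmeas K2) (M10 : 0 <= M1) (M20 : 0 <= M2).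
Hypothesis bK1 : forall x u, n1 (K1 (x, u)) <= M1 * triangle x u.
Hypothesis bK2 : forall x u, n1 (K2 (x, u)) <= M2 * triangle x u.

(** Since cos(rho x) = cos(2 rho (x/2)), each mixed term shifts a kernel by x/2 both ways, and the
    last term convolves the kernels. The support grows from |u| <= x/2 to |u| <= x. *)
Definition prodker (z : R * R) : C := (2^-1)%:C *
  (K1 (z.1, z.2 - z.1 / 2) + K1 (z.1, z.2 + z.1 / 2) +
   (K2 (z.1, z.2 - z.1 / 2) + K2 (z.1, z.2 + z.1 / 2)) +
   cI (fun v => K1 (z.1, v) * (K2 (z.1, z.2 - v) + K2 (z.1, z.2 + v)))).

Definition prodker_const : R := M1 + M2 + pi * (M1 * M2).

Lemma cmeas_section K x : cmeas K -> cmeas (fun u => K (x, u) : C).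
Proof. by move=> mK; apply: (cmeas_comp (F := K) (k := fun u => (x, u))) => //; meas_solve. Qed.

Lemma cmeas_prodker : cmeas prodker.
Proof.
apply: cmeasM; first exact: cmeas_cst.
apply: cmeasD.
  by apply: cmeasD; apply: cmeasD; apply: (cmeas_comp (F := K1)) || apply: (cmeas_comp (F := K2)); rewrite //; meas_solve.
apply: (cmeas_cI (F := fun z : (R * R) * R => K1 (z.1.1, z.2) * (K2 (z.1.1, z.1.2 - z.2) + K2 (z.1.1, z.1.2 + z.2)))).
apply: cmeasM; first by apply: (cmeas_comp (F := K1) (k := fun z : (R * R) * R => (z.1.1, z.2))) => //; meas_solve.
apply: cmeasD.
  by apply: (cmeas_comp (F := K2) (k := fun z : (R * R) * R => (z.1.1, z.1.2 - z.2))) => //; meas_solve.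
by apply: (cmeas_comp (F := K2) (k := fun z : (R * R) * R => (z.1.1, z.1.2 + z.2))) => //; meas_solve.
Qed.

Lemma bound_section K M x : 0 <= M -> (forall x u, n1 (K (x, u) : C) <= M * triangle x u) ->
  forall u, n1 (K (x, u)) <= M * seg (- (x / 2)) (x / 2) u.
Proof.
move=> M0 bK u; apply: le_trans (bK x u) _; apply: ler_wpM2l => //.
by rewrite /triangle ler_piMl ?seg_ge0//; have /andP[] := seg01 0 pi x.
Qed.

Lemma cinteg_sec K M x : cmeas K -> (forall x u, n1 (K (x, u) : C) <= M * triangle x u) ->
  cinteg (fun u => K (x, u)).
Proof.
move=> mK bK; apply: (cinteg_le (g := fun u => M * triangle x u)) => //.
  exact: cmeas_section.
by apply: integZ; exact: integ_triangle.
Qed.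

Lemma cinteg_conv x u : cinteg (fun v => K1 (x, v) * (K2 (x, u - v) + K2 (x, u + v))).
Proof.
apply: (cintegMb (M := M2 + M2)); first exact: cinteg_sec bK1.
  by apply: cmeasD; apply: (cmeas_comp (F := fun u => K2 (x, u))); (try exact: cmeas_section); meas_solve.
move=> v; apply: le_trans (n1D _ _) _; apply: lerD.
  by apply: le_trans (bK2 _ _) _; rewrite ler_piMr//; have /andP[] := triangle01 x (u - v).
by apply: le_trans (bK2 _ _) _; rewrite ler_piMr//; have /andP[] := triangle01 x (u + v).
Qed.

Lemma prodker_bound x u :
  n1 (prodker (x, u)) <= prodker_const * (seg 0 pi x * seg (- x) x u).
Proof.
set S := seg 0 pi x * seg (- x) x u.
have S0 : 0 <= S by rewrite mulr_ge0 ?seg_ge0.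
have key w (M : R) K : 0 <= M -> (forall x u, n1 (K (x, u) : C) <= M * triangle x u) ->
    w = u - x / 2 \/ w = u + x / 2 -> n1 (K (x, w)) <= M * S.
  move=> M0 bK hw; apply: le_trans (bK x w) _; apply: ler_wpM2l => //.
  rewrite /triangle /S ler_wpM2l ?seg_ge0//.
  have [/andP[h1 h2]|h] := boolP (- (x / 2) <= w <= x / 2); last by rewrite (seg_out h) seg_ge0.
  rewrite [leRHS]seg_in ?seg_in ?h1//.
  by case: hw => hw; rewrite hw in h1 h2; apply/andP; split; lra.
have kc : n1 (cI (fun v => K1 (x, v) * (K2 (x, u - v) + K2 (x, u + v)))) <= 2 * (pi * (M1 * M2)) * S.
  apply: (@le_trans _ _ (RI (fun v => 2 * (M1 * M2) * S * triangle x v))).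
    apply: n1_cI_le; [exact: cinteg_conv|by apply: integZ; exact: integ_triangle|move=> v].
    have [hv|hv] := eqVneq (triangle x v) 0.
      have h0 : n1 (K1 (x, v)) <= 0 by apply: le_trans (bK1 _ _) _; rewrite hv mulr0.
      by rewrite (n1_le0 h0) mul0r n1_0 hv mulr0.
    have [hv1 hv2] : 0 <= x <= pi /\ - (x / 2) <= v <= x / 2.
      move: hv; rewrite /triangle; have [a1|h] := boolP (0 <= x <= pi); last by rewrite (seg_out h) mul0r eqxx.
      by have [a2|h] := boolP (- (x / 2) <= v <= x / 2); last by rewrite (seg_out h) mulr0 eqxx.
    have k2 w : w = u - v \/ w = u + v -> n1 (K2 (x, w)) <= M2 * S.
      move=> hw; apply: le_trans (bK2 x w) _; apply: ler_wpM2l => //.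
      rewrite /triangle /S ler_wpM2l ?seg_ge0//.
      have [/andP[h1 h2]|h] := boolP (- (x / 2) <= w <= x / 2); last by rewrite (seg_out h) seg_ge0.
      rewrite [leRHS]seg_in ?seg_in ?h1//; case/andP: hv2 => h3 h4.
      by case: hw => hw; rewrite hw in h1 h2; apply/andP; split; lra.
    apply: (@le_trans _ _ (M1 * triangle x v * (M2 * S + M2 * S))).
      apply: n1M_le => //; apply: le_trans (n1D _ _) _; apply: lerD.
        by apply: k2; left.
      by apply: k2; right.
    by apply: ler_of_eq; ring.
  rewrite RIZ ?RI_triangle; last exact: integ_triangle.
  have hx : seg 0 pi x * x <= pi.
    have [/andP[a1 a2]|h] := boolP (0 <= x <= pi); last by rewrite (seg_out h) mul0r pi_ge0.
    by rewrite seg_in ?mul1r// a1.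
  apply: (@le_trans _ _ (2 * (M1 * M2) * S * pi)); last first.
    by apply: ler_of_eq; ring.
  by rewrite ler_wpM2l// !mulr_ge0.
rewrite /prodker /= n1Zr ger0_norm ?invr_ge0//.
have h1 := key (u - x / 2) M1 K1 M10 bK1 (or_introl erefl).
have h2 := key (u + x / 2) M1 K1 M10 bK1 (or_intror erefl).
have h3 := key (u - x / 2) M2 K2 M20 bK2 (or_introl erefl).
have h4 := key (u + x / 2) M2 K2 M20 bK2 (or_intror erefl).
rewrite mulrC ler_pdivrMr//.
apply: le_trans (n1D _ _) _; apply: le_trans (lerD (n1D _ _) kc) _.
apply: le_trans (lerD (lerD (n1D _ _) (n1D _ _)) (lexx _)) _.
rewrite /prodker_const; lra.
Qed.

Lemma product_formula rho x :
  ((cos (rho * x))%:C + cI (fun u => K1 (x, u) * (cos (2 * rho * u))%:C)) *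
  ((cos (rho * x))%:C + cI (fun u => K2 (x, u) * (cos (2 * rho * u))%:C)) =
  (2^-1 + 2^-1 * cos (2 * rho * x))%:C + cI (fun u => prodker (x, u) * (cos (2 * rho * u))%:C).
Proof.
have i1 := cinteg_sec x mK1 bK1; have i2 := cinteg_sec x mK2 bK2.
have e x' : rho * x' = 2 * rho * (x' / 2) by field.
set I1 := cI _; set I2 := cI (fun u => K2 _ * _).
have s1 := shift_cos (2 * rho) (x / 2) i1.
have s2 := shift_cos (2 * rho) (x / 2) i2.
have c12 := @conv_cos (fun u => K1 (x, u)) (fun u => K2 (x, u)) (2 * rho) (x / 2) M1 M2 (cmeas_section x mK1) (cmeas_section x mK2) M10 M20
  (bound_section x M10 bK1) (bound_section x M20 bK2).
rewrite -!e in s1 s2; rewrite -/I1 in s1 c12; rewrite -/I2 in s2 c12.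
have cc : ((cos (rho * x))%:C * (cos (rho * x))%:C : C) = (2^-1 + 2^-1 * cos (2 * rho * x))%:C.
  rewrite -rmorphM/= cos_cos subrr cos0; congr (_%:C).
  by rewrite (_ : rho * x + rho * x = 2 * rho * x); [ring|ring].
transitivity ((cos (rho * x))%:C * (cos (rho * x))%:C + ((cos (rho * x))%:C * I1 + (cos (rho * x))%:C * I2 + I1 * I2)).
  by ring.
rewrite cc; congr (_ + _); rewrite s1 s2 c12.
have tr K : cinteg (fun u => K (x, u) : C) -> cinteg (fun u => (2^-1)%:C * (K (x, u - x / 2) + K (x, u + x / 2)) * (cos (2 * rho * u))%:C).
  move=> iK; have [j1 _] := cI_trans (- (x / 2)) iK; have [j2 _] := cI_trans (x / 2) iK.
  by apply: cinteg_cos; apply: cintegZ; exact: cintegD.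
have icv : cinteg (fun u => (2^-1)%:C * cI (fun v => K1 (x, v) * (K2 (x, u - v) + K2 (x, u + v))) * (cos (2 * rho * u))%:C).
  apply: cinteg_cos; apply: cintegZ.
  have mP : cmeas (fun u => prodker (x, u)) by exact: (cmeas_section x cmeas_prodker).
  have iP : cinteg (fun u => prodker (x, u)).
    apply: (cinteg_le (g := fun u => prodker_const * seg 0 pi x * seg (- x) x u)) => //.
      by apply: integZ; exact: integ_seg.
    by move=> u; apply: le_trans (prodker_bound x u) _; rewrite mulrA.
  have [j1 _] := cI_trans (- (x / 2)) i1; have [j2 _] := cI_trans (x / 2) i1.
  have [j3 _] := cI_trans (- (x / 2)) i2; have [j4 _] := cI_trans (x / 2) i2.
  (* The convolution is twice [prodker] minus the four shifted kernels, and inherits integrability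
     from them. *)
  have := cintegB (cintegZ 2%:C iP) (cintegD (cintegD j1 j2) (cintegD j3 j4)).
  apply: cinteg_eq => u; rewrite /prodker /= mulrA -rmorphM/= divff ?pnatr_eq0// mul1r.
  by rewrite addrC addKr.
rewrite -cID; [|exact: tr|exact: tr].
rewrite -cID//; last by apply: cintegD; exact: tr.
by apply: eq_cI => u; rewrite /prodker /= -!mulrDl -!mulrDr.
Qed.

End ProductKernel.

(** * From a double integral to the cosine transform of one function *)

Section Folding.
Variable R : realType.
Local Notation C := R[i].
Implicit Types (x t u c : R).
Variables (p : R -> C) (V : R * R -> C) (M : R).
Hypotheses (ip : cinteg p) (p_supp : forall t, p t = (seg 0 pi t)%:C * p t).
Hypotheses (mV : cmeas V) (M0 : 0 <= M).
Hypothesis bV : forall x u, n1 (V (x, u)) <= M * (seg 0 pi x * seg (- x) x u).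

(** The cosine is even, so negative [u] are folded onto positive ones and the integral over [x] is
    carried out first. As [V] lives on |u| <= x, only [x >= u] contributes: this is p/2 plus a
    Volterra operator from the right endpoint. *)
Definition folded u : C := (2^-1)%:C * p u +
  (seg 0 pi u)%:C * cI (fun x => p x * (V (x, u) + V (x, - u))).

Let V2 (z : R * R) : C := V (z.1, z.2) + V (z.1, - z.2).

Let mV2 : cmeas V2.
Proof.
apply: cmeasD; first by apply: (cmeas_comp (F := V)) => //; meas_solve.
by apply: (cmeas_comp (F := V) (k := fun z : R * R => (z.1, - z.2))) => //; meas_solve.
Qed.

Let bVM x u : n1 (V (x, u)) <= M.
Proof.
apply: le_trans (bV x u) _; rewrite ler_piMr// mulr_ile1 ?seg_ge0//.
  by have /andP[] := seg01 0 pi x.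
by have /andP[] := seg01 (- x) x u.
Qed.

Let bV2 x u : n1 (V2 (x, u)) <= 2 * M.
Proof. by apply: le_trans (n1D _ _) _; rewrite mulr2n mulrDl !mul1r lerD. Qed.

Let V0 x u : ~~ (u <= x) || ~~ (- x <= u) || ~~ (0 <= x <= pi) -> V (x, u) = 0.
Proof.
move=> h; apply: n1_le0; apply: le_trans (bV x u) _.
have [xp|xp] := boolP (0 <= x <= pi); last by rewrite (seg_out xp) mul0r mulr0.
rewrite [seg (- x) x u]seg_out ?mulr0//; apply/negP => /andP[h1 h2].
by rewrite h1 h2 xp in h.
Qed.

Lemma fold_cos c x :
  cI (fun u => V (x, u) * (cos (c * u))%:C) =
  cI (fun u => (seg 0 pi u)%:C * (V2 (x, u) * (cos (c * u))%:C)).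
Proof.
have mx : cmeas (fun u => V (x, u)) by apply: (cmeas_comp (F := V) (k := fun u => (x, u))) => //; meas_solve.
have mc : cmeas (fun u => (cos (c * u))%:C : C) by apply: cmeas_real; exact: meas_cosM.
pose f u : C := V (x, u) * (cos (c * u))%:C.
have mf : cmeas f by exact: cmeasM.
have bf u : n1 (f u) <= M.
  by rewrite -[leRHS]mulr1; apply: n1M_le; rewrite ?n1_real ?cos_max.
have ic a b : cinteg (fun u => (seg a b u)%:C * f u) by exact: cinteg_segB bf.
transitivity (cI (fun u => (seg (- pi) pi u)%:C * f u)).
  apply: eq_cI => u; have [h|h] := boolP (- pi <= u <= pi); first by rewrite (seg_in h) mul1r.
  rewrite (seg_out h) mul0r V0 ?mul0r//; apply/negPn/negP.
  rewrite !negb_or !negbK => /andP[/andP[h1 h2] /andP[h3 h4]].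
  by case/negP: h; apply/andP; split; lra.
have p0 := pi_ge0 R; rewrite (@cI_split _ (- pi) 0 pi) ?oppr_le0 ?p0//.
have [i1 <-] := cI_refl (ic (- pi) 0).
rewrite -cID//; apply: eq_cI => u.
have -> : seg (- pi) 0 (- u) = seg 0 pi u.
  by rewrite /seg lerN2 oppr_le0 andbC.
by rewrite -mulrDr /f /V2 /= mulrN cosN addrC mulrDl.
Qed.

Let F c (z : R * R) : C := p z.1 * ((seg 0 pi z.2)%:C * (V2 z * (cos (c * z.2))%:C)).

Let mF c : cmeas (F c).
Proof.
apply: cmeasM; first by apply: (cmeas_comp (F := p)); [exact: cinteg_meas|meas_solve].
apply: cmeasM; first by apply: cmeas_real; meas_solve.
by apply: cmeasM => //; apply: cmeas_real; apply: (measurableT_comp (meas_cosM c)); meas_solve.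
Qed.

Let bF c x u : n1 (F c (x, u)) <= n1 (p x) * (seg 0 pi u * (2 * M)).
Proof.
apply: n1M_le => //; rewrite n1Zr ger0_norm ?seg_ge0// ler_wpM2l ?seg_ge0//.
by rewrite -[leRHS]mulr1; apply: n1M_le; rewrite ?n1_real ?cos_max.
Qed.

Let isegM : integ (fun u => seg 0 pi u * (2 * M)).
Proof. by apply: integ_eq (integZ (2 * M) (integ_seg 0 pi)) => u; rewrite mulrC. Qed.

Lemma cinteg_conv_V u : cinteg (fun x => p x * V2 (x, u)).
Proof.
apply: (cintegMb (M := 2 * M)); [exact: ip| |by move=> x; exact: bV2].
by apply: (cmeas_comp (F := V2)) => //; meas_solve.
Qed.

(** Exchange of [x] and [u] after folding. The variable of the term [2^-1 * cos (c * x)] is renamed,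
    so both contributions become transforms in [u]. *)
Lemma folded_cos c :
  cinteg (fun x => p x * ((2^-1 * cos (c * x))%:C + cI (fun u => V (x, u) * (cos (c * u))%:C))) /\
  cI (fun x => p x * ((2^-1 * cos (c * x))%:C + cI (fun u => V (x, u) * (cos (c * u))%:C))) =
  cI (fun u => folded u * (cos (c * u))%:C).
Proof.
have mc : cmeas (fun u => (cos (c * u))%:C : C) by apply: cmeas_real; exact: meas_cosM.
have ipc : cinteg (fun x => (2^-1)%:C * p x * (cos (c * x))%:C).
  apply: (cintegMb (M := 1)) => // [|u]; first exact: cintegZ.
  by rewrite n1_real cos_max.
have ibnd := cinteg_n1 ip.
have e x : (2^-1)%:C * p x * (cos (c * x))%:C + cI (fun u => F c (x, u)) =
    p x * ((2^-1 * cos (c * x))%:C + cI (fun u => V (x, u) * (cos (c * u))%:C)).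
  rewrite mulrDr rmorphM/= mulrA [p x * _]mulrC; congr (_ + _).
  rewrite fold_cos -cIZ//; apply: (@cinteg_segB R 0 pi _ (2 * M)).
    apply: cmeasM => //; apply: (cmeas_comp (F := V2) (k := fun u => (x, u))) => //; meas_solve.
  by move=> u; rewrite -[leRHS]mulr1; apply: n1M_le; rewrite ?n1_real ?cos_max.
have iF := cinteg_cI (mF c) (bF c) ibnd isegM.
split; first exact: cinteg_eq e (cintegD ipc iF).
rewrite -(eq_cI e) cID// (cI_swap (mF c) (bF c))//.
have iu : cinteg (fun u => cI (fun x => F c (x, u))).
  apply: (cinteg_cI (F := fun z => F c (z.2, z.1)) (g := fun u => seg 0 pi u * (2 * M)) (h := fun x => n1 (p x))) => //.
    by apply: (cmeas_comp (F := F c) (k := fun z : R * R => (z.2, z.1))) => //; meas_solve.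
  by move=> u x; rewrite mulrC; exact: bF.
rewrite -cID//; apply: eq_cI => u; rewrite /folded mulrDl; congr (_ + _).
have ic := cinteg_conv_V u.
rewrite -(cIZ _ ic) -(cIZr _ (cintegZ _ ic)).
by apply: eq_cI => x; rewrite /F /V2 /=; ring.
Qed.

Lemma folded_bound u : n1 (folded u - (2^-1)%:C * p u) <=
  seg 0 pi u * (2 * M * RI (fun x => seg u pi x * n1 (p x))).
Proof.
rewrite /folded addrAC subrr add0r n1Zr ger0_norm ?seg_ge0//.
have [/andP[u0 up]|h] := boolP (0 <= u <= pi); last by rewrite (seg_out h) !mul0r.
rewrite ler_wpM2l ?seg_ge0// -RIZ; last by apply: integ_segM; exact: cinteg_n1.
apply: n1_cI_le; first exact: cinteg_conv_V.
  by apply: integZ; apply: integ_segM; exact: cinteg_n1.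
move=> x; have [h|h] := boolP (u <= x <= pi).
  by rewrite (seg_in h) mul1r [leRHS]mulrC; apply: n1M_le => //; exact: bV2.
rewrite (seg_out h) mul0r mulr0.
have [/andP[ux xp]|h'] := boolP ((u <= x) && (x <= pi)); first by rewrite ux xp in h.
rewrite (p_supp x); have [/andP[x0 xp]|h2] := boolP (0 <= x <= pi); last first.
  by rewrite (seg_out h2) !mul0r n1_0.
rewrite xp andbT in h'.
rewrite !V0 ?addr0 ?mulr0 ?n1_0//; last by rewrite h'.
by rewrite lerN2 h' orbT.
Qed.

Lemma cmeas_folded : cmeas folded.
Proof.
apply: cmeasD; first by apply: cmeasM; [exact: cmeas_cst|exact: cinteg_meas].
apply: cmeasM; first by apply: cmeas_real; exact: meas_seg1.
apply: (cmeas_cI (F := fun z : R * R => p z.2 * V2 (z.2, z.1))).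
apply: cmeasM; first by apply: (cmeas_comp (F := p)); [exact: cinteg_meas|meas_solve].
by apply: (cmeas_comp (F := V2) (k := fun z : R * R => (z.2, z.1))) => //; meas_solve.
Qed.

Lemma folded_supp u : folded u = (seg 0 pi u)%:C * folded u.
Proof.
by rewrite /folded mulrDr [_ * (_ * p u)]mulrCA -p_supp mulrA -rmorphM/= seg_idem.
Qed.

End Folding.

(** * Reversal of the interval and the characteristic functions *)

Section Flip.
Variable R : realType.
Local Notation C := R[i].
Implicit Types (x t rho : R) (q f : R -> C) (z : C).

(** Only the values on [0, pi] are meaningful in the statement; extension by zero turns them into
    functions on the line. The companion [flip] also measures the variable from pi. *)
Definition ext f t : C := (seg 0 pi t)%:C * f t.
Definition flip q t : C := (seg 0 pi t)%:C * q (pi - t).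

Lemma csq_ge0 z : 0 <= csq z.
Proof. by rewrite addr_ge0 ?sqr_ge0. Qed.

Lemma csq_n1 z : csq z <= n1 z ^+ 2.
Proof.
rewrite /csq /n1 -[reC z ^+ 2]real_normK ?num_real// -[imC z ^+ 2]real_normK ?num_real//.
have := normr_ge0 (reC z); have := normr_ge0 (imC z); nra.
Qed.

Lemma n1_csq z : n1 z ^+ 2 <= 2 * csq z.
Proof.
rewrite /csq /n1 -[reC z ^+ 2]real_normK ?num_real// -[imC z ^+ 2]real_normK ?num_real//.
by have := sqr_ge0 (`|reC z| - `|imC z|); nra.
Qed.

Lemma cabs_n1 z : cabs z <= n1 z.
Proof. by rewrite /cabs -[leRHS]ger0_norm ?n1_ge0// -sqrtr_sqr ler_wsqrtr// csq_n1. Qed.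

Lemma n1_cabs z : n1 z <= 2 * cabs z.
Proof.
have h : n1 z ^+ 2 <= (2 * cabs z) ^+ 2.
  apply: le_trans (n1_csq z) _; rewrite exprMn sqr_sqrtr ?csq_ge0//.
  by rewrite ler_wpM2r ?csq_ge0// expr2; lra.
by rewrite -ler_sqr ?nnegrE ?n1_ge0 ?mulr_ge0 ?sqrtr_ge0.
Qed.

Lemma csq_real x z : csq (x%:C * z) = x ^+ 2 * csq z.
Proof. by rewrite /csq !cE; ring. Qed.

Lemma csq_ext f t : csq (ext f t) = seg 0 pi t * csq (f t).
Proof. by rewrite csq_real expr2 seg_idem. Qed.

Lemma flip_ext q t : flip q t = ext q (pi - t).
Proof.
by rewrite /flip /ext; congr (_%:C * _); rewrite /seg subr_ge0 gerBl andbC.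
Qed.

Lemma flip_supp q t : flip q t = (seg 0 pi t)%:C * flip q t.
Proof. by rewrite /flip mulrA -rmorphM/= seg_idem. Qed.

Lemma L2normE f : L2norm f ^+ 2 = RI (fun t => csq (ext f t)).
Proof.
rewrite /L2norm RI_seg sqr_sqrtr; last first.
  by apply: RI_ge0 => t; rewrite mulr_ge0 ?seg_ge0 ?csq_ge0.
by apply: eq_RI => t; rewrite csq_ext.
Qed.

Lemma meas_ext (f : R -> R) : measurable_fun (@Ipi R) f ->
  measurable_fun setT (fun t => seg 0 pi t * f t).
Proof.
move=> mf; have := (measurable_restrictT f (measurable_itv _)).1 mf.
apply: eq_measurable_fun => t _; rewrite /patch segE mem_setE.
by case: ifP => _; rewrite ?mul1r ?mul0r.
Qed.

Lemma L2_ext f : L2 f -> cmeas (ext f) /\ integ (fun t => csq (ext f t)).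
Proof.
move=> [m1 [m2 f2]]; split.
  split; [apply: eq_measurable_fun (meas_ext m1)|apply: eq_measurable_fun (meas_ext m2)] => t _;
  by rewrite cE.
apply: (integ_eq (f := fun t => seg 0 pi t * csq (f t))) => [t|]; first by rewrite csq_ext.
apply/integ_segP/integrableP; split.
  by apply/measurable_EFinP; apply: measurable_funD; exact: measurable_funX.
apply: le_lt_trans f2; rewrite le_eqVlt; apply/orP; left; apply/eqP/eq_integral => t _ /=.
by rewrite ger0_norm ?csq_ge0.
Qed.

Lemma L2_flip f : L2 f -> L2pot (flip f) /\
  RI (fun t => n1 (flip f t) ^+ 2) <= 2 * L2norm f ^+ 2.
Proof.
move=> /L2_ext[mf f2].
have mflip : cmeas (flip f).
  have := cmeas_comp (F := ext f) (k := fun t => pi - t) mf.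
  rewrite (_ : (fun t => ext f (pi - t)) = flip f); first by apply; meas_solve.
  by apply/funext => t; rewrite flip_ext.
have [g2 e2] := integ_flip pi f2.
have i2 : integ (fun t => 2 * csq (flip f t)).
  by apply: integ_eq (integZ 2 g2) => t; rewrite flip_ext.
have h t : n1 (flip f t) ^+ 2 <= 2 * csq (flip f t) by exact: n1_csq.
have i1 : integ (fun t => n1 (flip f t) ^+ 2).
  apply: integ_le i2 _; first by apply: measurable_funX; exact: meas_n1.
  by move=> t; rewrite ger0_norm ?sqr_ge0.
split; first by split=> //; exact: flip_supp.
apply: le_trans (RI_le i1 i2 h) _.
rewrite RIZ; last by apply: integ_eq g2 => t; rewrite flip_ext.
rewrite L2normE -e2 ler_wpM2l//; apply: ler_of_eq.
by apply: eq_RI => t; rewrite flip_ext.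
Qed.

Lemma cI_flipE q : L2 q -> cI (flip q) = cint 0 pi q.
Proof.
move=> /L2_flip[hq _]; rewrite cintE.
have [_ <-] := cI_flip pi (cinteg_q hq); apply: eq_cI => t.
by rewrite flip_ext /ext opprB addrC subrK.
Qed.

Lemma acont_flip (F f : R -> C) : acont F f -> acont (fun x => F (pi - x)) (fun x => - f (pi - x)).
Proof.
move=> [i1 h]; have sp x : seg 0 pi (pi - x) = seg 0 pi x by rewrite /seg subr_ge0 gerBl andbC.
have [i2 _] := cI_flip pi i1.
split; first by apply: cinteg_eq (cintegN i2) => x; rewrite sp mulrN.
have p0 := pi_ge0 R.
move=> x /andP[x0 xp]; rewrite subr0 (h pi) ?p0 ?lexx// (h (pi - x)); last by rewrite subr_ge0 gerBl xp.
have xp2 : 0 <= pi - x <= pi by rewrite subr_ge0 gerBl xp.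
have i3 := cinteg_seg 0 x i2.
have i4 : cinteg (fun t => (seg (pi - x) pi t)%:C * f t).
  apply: cinteg_eq (cinteg_seg (pi - x) pi i1) => t.
  by rewrite mulrA -rmorphM/= seg_sub// subr_ge0.
have [i5 e5] := cI_flip pi i4.
have e t : (seg (pi - x) pi (pi - t))%:C * f (pi - t) = (seg 0 x t)%:C * f (pi - t).
  by congr (_%:C * _); rewrite /seg lerD2l lerN2 gerBl andbC.
have i6 : cinteg (fun t => (seg 0 x t)%:C * f (pi - t)) by apply: cinteg_eq i5.
have gen (a b c d : C) : c + d = 0 -> a + b = a + (b + c) + d.
  by move=> cd; rewrite -[LHS]addr0 -cd; ring.
rewrite (cI_split xp2 i1); apply: gen.
rewrite -e5 (eq_cI e) [X in _ + X](eq_cI (g := fun t => - ((seg 0 x t)%:C * f (pi - t)))).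
  by rewrite cIN// subrr.
by move=> t; rewrite mulrN.
Qed.

Lemma solves_flip q rho (y yd : R -> C) : solves (flip q) rho%:C y yd ->
  is_solution q rho%:C (fun x => y (pi - x)) (fun x => - yd (pi - x)).
Proof.
move=> [a1 a2]; apply: solves_is_solution; split; first exact: acont_flip a1.
apply: acont_eq (acontZ (-1) (acont_flip a2)) => x xp; first by rewrite mulN1r.
have xp2 : 0 <= pi - x <= pi by case/andP: xp => x0 xp; rewrite subr_ge0 gerBl xp.
by rewrite mulN1r opprK /flip (seg_in xp2) mul1r (_ : pi - (pi - x) = x)// opprB addrC subrK.
Qed.

Lemma ccos_real x : ccos x%:C = (cos x)%:C.
Proof.
rewrite /ccos /= /coshR /sinhR oppr0 expR0 subrr mul0r mulr0 oppr0.
by apply: complex_ext => //=; field.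
Qed.

Lemma csin_real x : csin x%:C = (sin x)%:C.
Proof.
rewrite /csin /= /coshR /sinhR oppr0 expR0 subrr mul0r mulr0.
by apply: complex_ext => //=; field.
Qed.

Section Characteristic.
Variables (q : R -> C) (lam : R) (h H : C) (rho : R).
Hypothesis hq : L2pot (flip q).
Hypothesis lam0 : 0 < lam.
Hypothesis hlam : 4 * pi ^+ 2 * RI (fun t => n1 (flip q t) ^+ 2) <= 2 * lam.
Hypothesis rho0 : 0 < rho.

Let y := sol (flip q) 1 H rho.
Let yd := dsol (flip q) 1 H rho.
Let s := sol (flip q) 0 1 rho.
Let sd := dsol (flip q) 0 1 rho.

Let unit_wronskian : y pi * sd pi - yd pi * s pi = 1.
Proof.
have w := wronskian (solution_solves 1 H hq lam0 hlam rho0) (solution_solves 0 1 hq lam0 hlam rho0).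
have p : 0 <= (pi : R) <= pi by rewrite lexx pi_ge0.
have := acont_const w _ p; rewrite !(sol0 _ _ hq lam0 hlam rho0).1 !(sol0 _ _ hq lam0 hlam rho0).2.
rewrite -/y -/yd -/s -/sd mulr0 mulr1 add0r => e.
by rewrite -[RHS]opprK -e ?opprB// => x _; rewrite subrr mul0r.
Qed.

(** The hypotheses on the Cauchy data quantify over solutions with prescribed data at 0, so one must
    be exhibited. It is a combination of the two solutions started at pi; the boundary form then
    needs only their data there. *)
Lemma characteristic (a b : C) : exists z zd : R -> C,
  [/\ is_solution q rho%:C z zd, z 0 = a, zd 0 = b &
   zd pi + H * z pi = yd pi * a + y pi * b].
Proof.
have sy := solution_solves 1 H hq lam0 hlam rho0.
have ss := solution_solves 0 1 hq lam0 hlam rho0.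
have := solves_flip (solves_comb (sd pi * a + s pi * b) (- (yd pi * a + y pi * b)) sy ss).
rewrite -/y -/yd -/s -/sd => sol_z.
exists (fun x => (sd pi * a + s pi * b) * y (pi - x) + - (yd pi * a + y pi * b) * s (pi - x)).
exists (fun x => - ((sd pi * a + s pi * b) * yd (pi - x) + - (yd pi * a + y pi * b) * sd (pi - x))).
have [y0 yd0] := sol0 1 H hq lam0 hlam rho0.
have [s0 sd0] := sol0 0 1 hq lam0 hlam rho0.
have w := unit_wronskian.
(* Cramer's rule for matching the data at 0: the determinant is the Wronskian, which is 1. *)
have gen (A B D E F G : C) : A * E - B * D = 1 ->
    (E * F + D * G) * A + - (B * F + A * G) * D = F /\
    - ((E * F + D * G) * B + - (B * F + A * G) * E) = G.
  move=> e; split.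
    by rewrite -[RHS]mul1r -e; ring.
  by rewrite -[RHS]mul1r -e; ring.
have [g1 g2] := gen _ _ _ _ a b w.
have gen2 (A B : C) : - (A * H + - B * 1) + H * (A * 1 + - B * 0) = B by ring.
split; [exact: sol_z|by rewrite subr0; exact: g1|by rewrite subr0; exact: g2|].
by rewrite subrr /y /yd /s /sd y0 yd0 s0 sd0; exact: gen2.
Qed.

(** [characteristic] with data (1, h) identifies the left side as Delta; on the real axis the
    complex sine and cosine are the real ones. *)
Lemma cauchyN_real (N : R -> C) : cauchyN q h H N ->
  yd pi + h * y pi = - rho%:C * (sin (rho * pi))%:C + omega q h H * (cos (rho * pi))%:C +
    cI (fun t => ext N t * (cos (rho * t))%:C).
Proof.
move=> cN; have [z [zd [sz z0 zd0 e]]] := characteristic 1 h.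
have r0 : rho%:C != 0 :> C by rewrite (fmorph_eq0 (real_complex R)) gt_eqF.
have := cN _ _ _ r0 sz z0 zd0; rewrite e mulr1 [y pi * h]mulrC => ->.
rewrite -rmorphM/= csin_real ccos_real cintE; congr (_ + _).
by apply: eq_cI => t; rewrite -rmorphM/= ccos_real mulrA.
Qed.

(** With data (0, 1) the boundary form is [y pi] itself, which is therefore Delta_0; the identity is
    multiplied by [rho] to clear denominators. *)
Lemma cauchyN0_real (N0 : R -> C) : cauchyN0 q H N0 ->
  rho%:C * y pi = rho%:C * (cos (rho * pi))%:C + omega0 q H * (sin (rho * pi))%:C +
    cI (fun t => ext N0 t * (sin (rho * t))%:C).
Proof.
move=> cN; have [z [zd [sz z0 zd0 e]]] := characteristic 0 1.
have r0 : rho%:C != 0 :> C by rewrite (fmorph_eq0 (real_complex R)) gt_eqF.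
have := cN _ _ _ r0 sz z0 zd0; rewrite e mulr0 mulr1 add0r => ->.
have gen (r c o v I : C) : r != 0 -> r * (c + o * v / r + I / r) = r * c + o * v + I.
  by move=> r00; field.
rewrite gen// -!rmorphM/= csin_real ccos_real cintE rmorphM/=; congr (_ + _).
by apply: eq_cI => t; rewrite -rmorphM/= csin_real mulrA.
Qed.

End Characteristic.

End Flip.

(** * Gronwall's inequality in norm and summation over frequencies *)

Section Estimates.
Variable R : realType.
Local Notation C := R[i].
Implicit Types (x t u : R).

Lemma sqint_le (f g : R -> R) : measurable_fun setT f -> sqint g -> (forall x, `|f x| <= g x) -> sqint f.
Proof.
move=> mf [mg g2] fg; split => //.
apply: integ_le g2 _; first exact: measurable_funX.
move=> x; rewrite normrX ler_sqr ?nnegrE//; exact: le_trans (fg x).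
Qed.

Lemma RI_sq_le (f g : R -> R) : sqint f -> sqint g -> (forall x, `|f x| <= g x) ->
  RI (fun x => f x ^+ 2) <= RI (fun x => g x ^+ 2).
Proof.
move=> [_ f2] [_ g2] fg; apply: RI_le => // x.
rewrite -[f x ^+ 2]ger0_norm ?sqr_ge0// normrX ler_sqr ?nnegrE//; exact: le_trans (fg x).
Qed.

(* Against the weight [expR (2 * lam * u)] the Volterra term loses a factor
   [1 / (2 * lam)]. *)
Lemma volterra_bound (P w : R -> R) (M : R) : sqint P -> sqint w ->
  (forall t, 0 <= P t) -> (forall t, P t = seg 0 pi t * P t) ->
  (forall u, P u <= w u + seg 0 pi u * (M * RI (fun x => seg u pi x * P x))) ->
  RI (fun t => P t ^+ 2) <= 4 * expR (2 * (2 * M ^+ 2 * pi + 1) * pi) * RI (fun t => w t ^+ 2).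
Proof.
(* Chosen so that [2 * M ^+ 2 * pi <= lam], which gives the Volterra term the factor 1/2; the
   summand 1 makes it positive even for [M = 0]. *)
move=> sP sw P0 Ps hP; set lam := 2 * M ^+ 2 * pi + 1.
have p0 : 0 < pi :> R := pi_gt0 R.
have l1 : 0 < lam by rewrite /lam ltr_wpDl// mulr_ge0 ?pi_ge0// mulr_ge0 ?sqr_ge0.
pose m t := seg 0 pi t * expR (lam * t).
have mE := meas_expM lam.
have mm : measurable_fun setT m by apply: measurable_funM => //; exact: meas_seg1.
have m0 t : 0 <= m t by rewrite mulr_ge0 ?seg_ge0 ?expR_ge0.
have mM t : `|m t| <= expR (lam * pi).
  rewrite ger0_norm// /m; have [/andP[t0 tp]|h] := boolP (0 <= t <= pi).
    by rewrite seg_in ?t0// mul1r ler_expR ler_pM2l.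
  by rewrite (seg_out h) mul0r expR_ge0.
have sPm := sqint_bdd sP mm mM; have swm := sqint_bdd sw mm mM.
pose N := RI (fun t => (P t * m t) ^+ 2).
have [mP P2] := sP; have [_ i1] := sPm; have [_ i2] := swm.
have N0 : 0 <= N by apply: RI_ge0 => t; exact: sqr_ge0.
(* Cauchy-Schwarz of the weighted [P] against the inverse weight on [u, pi]: the integral of e^(-2
   lam x) there is at most e^(-2 lam u) / (2 lam), and the prefactor cancels the exponential. *)
have G u : 0 <= u <= pi -> expR (lam * u) ^+ 2 * RI (fun x => seg u pi x * P x) ^+ 2 <= N / (2 * lam).
  move=> /andP[u0 up]; pose g t := seg u pi t * expR (- lam * t).
  have mg := meas_expM (- lam).
  have g2 t : g t ^+ 2 = seg u pi t * expR (- (2 * lam) * t).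
    by rewrite /g exprMn expr2 seg_idem -expRM_natl; congr (_ * expR _); ring.
  have sg : sqint g.
    apply: (sqint_le (g := fun t => 1 * seg u pi t)); first by apply: measurable_funM => //; exact: meas_seg1.
      by apply: sqintZ; exact: sqint_seg.
    move=> t; rewrite ger0_norm ?mulr_ge0 ?seg_ge0 ?expR_ge0// mul1r /g.
    have [/andP[t0 tp]|h] := boolP (u <= t <= pi); last by rewrite (seg_out h) mul0r.
    rewrite seg_in ?t0// mul1r -expR0 ler_expR mulNr oppr_le0 mulr_ge0 ?(ltW l1)//.
    exact: le_trans t0.
  have cs := cauchy_schwarz sPm sg.
  rewrite (@eq_RI _ _ (fun x => seg u pi x * P x)) in cs; last first.
    move=> t; rewrite /m /g; have [/andP[t0 tp]|h] := boolP (u <= t <= pi); last first.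
      by rewrite (seg_out h) !mul0r mulr0.
    rewrite (@seg_in _ u) ?t0// (@seg_in _ 0) ?(le_trans u0)// !mul1r -mulrA -expRD.
    by rewrite mulNr subrr expR0 mulr1.
  rewrite (eq_RI g2) RI_expM// in cs; last by rewrite oppr_eq0 gt_eqF// mulr_gt0.
  apply: le_trans (_ : expR (lam * u) ^+ 2 * (N * (expR (- (2 * lam) * u) / (2 * lam))) <= _).
    rewrite ler_wpM2l ?sqr_ge0//; apply: le_trans cs _; rewrite ler_wpM2l//.
    rewrite invrN mulrN -mulNr opprB ler_wpM2r ?invr_ge0 ?mulr_ge0 ?(ltW l1)//.
    by rewrite gerBl expR_ge0.
  apply: ler_of_eq.
  have e1 : expR (lam * u) ^+ 2 * expR (- (2 * lam) * u) = 1.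
    by rewrite -expRM_natl -expRD -[RHS]expR0; congr expR; ring.
  by rewrite mulrCA; congr (_ * _); rewrite mulrA e1 mul1r.
(* The last summand is absorbed on the left, because [N] is finite. *)
have hN : N <= 2 * RI (fun t => (w t * m t) ^+ 2) + 2^-1 * N.
  pose k := 2 * M ^+ 2 * (N / (2 * lam)).
  have hk : k * pi <= 2^-1 * N.
    rewrite /k (_ : _ * pi = (N / (2 * lam)) * (2 * M ^+ 2 * pi)); last by ring.
    rewrite mulrAC ler_pdivrMr ?mulr_gt0// [leRHS]mulrAC.
    rewrite (_ : 2^-1 * (2 * lam) * N = N * lam); last by field.
    by rewrite ler_wpM2l// /lam lerDl.
  apply: (@le_trans _ _ (RI (fun t => 2 * (w t * m t) ^+ 2 + k * seg 0 pi t))); last first.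
    rewrite RID ?RIZ ?RI_seg1 ?subr0 ?lerD2l//; try exact: integ_seg; try exact: ltW.
    - exact: integZ.
    - by apply: integZ; exact: integ_seg.
  apply: RI_le => //; first by apply: integD; [exact: integZ|by apply: integZ; exact: integ_seg].
  move=> t; have [tp|h] := boolP (0 <= t <= pi); last first.
    by rewrite /m (seg_out h) mul0r !mulr0 expr0n mulr0 addr0.
  have h1 := hP t; rewrite (seg_in tp) mul1r in h1.
  have h2 := G t tp; rewrite /m (seg_in tp) mul1r mulr1 /k.
  set I := RI _ in h1 h2; move: (expR_gt0 (lam * t)) h2; set E := expR _ => E0 h2.
  have h3 : P t ^+ 2 <= 2 * w t ^+ 2 + 2 * (M * I) ^+ 2.
    have h4 : P t ^+ 2 <= (w t + M * I) ^+ 2.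
      by rewrite ler_sqr ?nnegrE// (le_trans (P0 t)).
    by have := sqr_ge0 (w t - M * I); nra.
  apply: (@le_trans _ _ (E ^+ 2 * (2 * w t ^+ 2 + 2 * (M * I) ^+ 2))).
    by rewrite exprMn mulrC ler_wpM2l ?sqr_ge0.
  rewrite mulrDr lerD//; first by apply: ler_of_eq; ring.
  apply: (@le_trans _ _ (2 * M ^+ 2 * (E ^+ 2 * I ^+ 2))).
    by apply: ler_of_eq; ring.
  by rewrite ler_wpM2l// mulr_ge0 ?sqr_ge0.
apply: (@le_trans _ _ N).
  apply: RI_sq_le => // t; rewrite ger0_norm// /m {1}Ps.
  have [/andP[t0 tp]|h] := boolP (0 <= t <= pi); last by rewrite (seg_out h) !mul0r mulr0.
  by rewrite seg_in ?t0// !mul1r ler_peMr// -expR0 ler_expR mulr_ge0// ltW.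
apply: (@le_trans _ _ (4 * RI (fun t => (w t * m t) ^+ 2))); first by lra.
rewrite -mulrA ler_wpM2l// -RIZ; last by case: sw.
apply: RI_le => // [|t]; first by apply: integZ; case: sw.
rewrite exprMn mulrC ler_wpM2r ?sqr_ge0//.
apply: (@le_trans _ _ (expR (lam * pi) ^+ 2)).
  by rewrite ler_sqr ?nnegrE ?expR_ge0// -[leLHS]ger0_norm.
by rewrite -expRM_natl mulrA.
Qed.

(** Bessel's inequality for the indicator of [0, pi]: its coefficients are sin(theta pi)/theta, and
    sin^2(theta pi) = 1. *)
Lemma theta_sum n : \sum_(k < n) (theta R k) ^- 2 <= pi ^+ 2 / 2.
Proof.
have p0 := pi_ge0 R; have ss := sqint_seg 0 (pi : R).
have := bessel_cos n (ltr01 : (0 : R) < 1) ss.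
rewrite (@eq_RI _ (fun x => seg 0 pi x ^+ 2) (seg 0 pi)); last by move=> x; rewrite expr2 seg_idem.
rewrite RI_seg1// subr0 mulr1 mulrAC -expr2; apply: le_trans.
apply: ler_sum => k _; rewrite RI_ecos1_seg ?p0 ?lexx// exprMn exprVn.
rewrite (_ : sin (theta R k * pi) ^+ 2 = 1) ?mul1r//.
rewrite sin2cos2 (_ : cos _ = 0) ?expr0n ?subr0//.
elim: (nat_of_ord k) => [|j IH].
  by rewrite /theta add0r mulrC cos_pihalf.
by rewrite (_ : theta R j.+1 * pi = theta R j * pi + pi) ?cosDpi ?IH ?oppr0// /theta -natr1; ring.
Qed.

Lemma csq_sqint (f : R -> C) : cmeas f -> integ (fun t => csq (f t)) ->
  [/\ sqint (fun t => reC (f t)), sqint (fun t => imC (f t)) &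
  RI (fun t => reC (f t) ^+ 2) + RI (fun t => imC (f t) ^+ 2) = RI (fun t => csq (f t))].
Proof.
move=> [m1 m2] f2.
have i1 : integ (fun t => reC (f t) ^+ 2).
  apply: integ_le f2 _; first exact: measurable_funX.
  by move=> t; rewrite ger0_norm ?sqr_ge0// lerDl sqr_ge0.
have i2 : integ (fun t => imC (f t) ^+ 2).
  apply: integ_le f2 _; first exact: measurable_funX.
  by move=> t; rewrite ger0_norm ?sqr_ge0// lerDr sqr_ge0.
by split=> //; rewrite -RID.
Qed.

(** The functions live on [0, pi] but the system is orthogonal on (0, 2 pi), where Bessel's constant
    is pi. The remaining factor 2 compares [n1 z ^+ 2] with [csq z]. *)
Lemma bessel_csq n (f : R -> C) (e : nat -> R -> R) :
  cmeas f -> integ (fun t => csq (f t)) -> (forall t, f t = (seg 0 pi t)%:C * f t) ->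
  (forall g : R -> R, sqint g -> \sum_(k < n) RI (fun t => g t * (seg 0 (2 * pi) t * e k t)) ^+ 2 <= pi * RI (fun t => g t ^+ 2)) ->
  \sum_(k < n) n1 (cI (fun t => f t * (e k t)%:C)) ^+ 2 <= 2 * pi * RI (fun t => csq (f t)).
Proof.
move=> mf f2 fs he; have [s1 s2 <-] := csq_sqint mf f2.
have h1 := he _ s1; have h2 := he _ s2.
have ss t : seg 0 pi t * seg 0 (2 * pi) t = seg 0 pi t :> R.
  by rewrite seg_sub// ler_peMl ?pi_ge0// ler1n.
apply: (@le_trans _ _ (2 * (pi * RI (fun t => reC (f t) ^+ 2) + pi * RI (fun t => imC (f t) ^+ 2)))); last first.
  by apply: ler_of_eq; ring.
apply: (@le_trans _ _ (\sum_(k < n) 2 * (RI (fun t => reC (f t) * (seg 0 (2 * pi) t * e k t)) ^+ 2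
   + RI (fun t => imC (f t) * (seg 0 (2 * pi) t * e k t)) ^+ 2))); last first.
  by rewrite -mulr_sumr big_split ler_wpM2l// lerD.
apply: ler_sum => k _; apply: le_trans (n1_csq _) _; rewrite ler_wpM2l// /csq /=.
apply: ler_of_eq.
congr (_ ^+ 2 + _ ^+ 2); apply: eq_RI => t; rewrite [_ * (e k t)%:C]mulrC fs !cE -[in LHS]ss; ring.
Qed.

Lemma bessel_ccos n (f : R -> C) :
  cmeas f -> integ (fun t => csq (f t)) -> (forall t, f t = (seg 0 pi t)%:C * f t) ->
  \sum_(k < n) n1 (cI (fun t => f t * (cos (2^-1 * theta R k * t))%:C)) ^+ 2 <= 2 * pi * RI (fun t => csq (f t)).
Proof.
move=> mf f2 fs; apply: (bessel_csq (e := fun k t => cos (2^-1 * theta R k * t))) => // g sg.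
have := @bessel_cos R (2^-1) n g; rewrite invr_gt0 divff// divr1.
by rewrite /ecos (_ : pi / 2^-1 = 2 * pi) ?invrK 1?mulrC//; exact.
Qed.

Lemma bessel_csin n (f : R -> C) :
  cmeas f -> integ (fun t => csq (f t)) -> (forall t, f t = (seg 0 pi t)%:C * f t) ->
  \sum_(k < n) n1 (cI (fun t => f t * (sin (2^-1 * theta R k * t))%:C)) ^+ 2 <= 2 * pi * RI (fun t => csq (f t)).
Proof.
move=> mf f2 fs; apply: (bessel_csq (e := fun k t => sin (2^-1 * theta R k * t))) => // g sg.
have := @bessel_sin R (2^-1) n g; rewrite invr_gt0 divff// divr1.
by rewrite /esin (_ : pi / 2^-1 = 2 * pi) ?invrK 1?mulrC//; exact.
Qed.

(** Real and imaginary parts each contribute [2 / pi * A]; passing from [csq] to the square of [n1]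
    doubles the sum. *)
Lemma parseval_n1 (W : R -> C) (A : R) : cmeas W -> integ (fun t => n1 (W t) ^+ 2) ->
  (forall t, W t = (seg 0 pi t)%:C * W t) ->
  (forall n, \sum_(k < n) n1 (cI (fun t => W t * (cos (theta R k * t))%:C)) ^+ 2 <= A) ->
  RI (fun t => n1 (W t) ^+ 2) <= 8 / pi * A.
Proof.
move=> mW W2 Ws hA; have p0 : 0 < pi :> R := pi_gt0 R.
have c2 : integ (fun t => csq (W t)).
  apply: integ_le W2 _; last by move=> t; rewrite ger0_norm ?csq_ge0// csq_n1.
  by case: mW => m1 m2; apply: measurable_funD; exact: measurable_funX.
have [s1 s2 e] := csq_sqint mW c2.
have b1 : RI (fun t => reC (W t) ^+ 2) <= 2 / pi * A.
  apply: (parseval_bound s1) => [t|n]; first by rewrite {1}Ws cE.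
  apply: le_trans (hA n); apply: ler_sum => k _.
  rewrite -[leLHS]ger0_norm ?sqr_ge0// normrX ler_sqr ?nnegrE ?n1_ge0//.
  apply: le_trans (re_n1 _); apply: ler_of_eq; congr `|_|.
  by apply: eq_RI => t; rewrite ecos1 [RHS]/= mulrC Ws !cE [in RHS]Ws !cE; ring.
have b2 : RI (fun t => imC (W t) ^+ 2) <= 2 / pi * A.
  apply: (parseval_bound s2) => [t|n]; first by rewrite {1}Ws cE.
  apply: le_trans (hA n); apply: ler_sum => k _.
  rewrite -[leLHS]ger0_norm ?sqr_ge0// normrX ler_sqr ?nnegrE ?n1_ge0//.
  apply: le_trans (im_n1 _); apply: ler_of_eq; congr `|_|.
  by apply: eq_RI => t; rewrite ecos1 [RHS]/= mulrC Ws !cE [in RHS]Ws !cE; ring.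
apply: (@le_trans _ _ (RI (fun t => 2 * csq (W t)))).
  by apply: RI_le => // [|t]; [exact: integZ|exact: n1_csq].
rewrite RIZ// -e; apply: (@le_trans _ _ (2 * (2 / pi * A + 2 / pi * A))).
  by rewrite ler_wpM2l// lerD.
by apply: ler_of_eq; ring.
Qed.

End Estimates.

(** * The algebra of a single coefficient *)

Section Algebra.
Variable R : realType.
Local Notation C := R[i].

(* [a], [d], [a + h d] are the values of the two solutions at the far endpoint; [W0]
   is the coefficient in question and [e = a - c] its small factors. *)
Lemma coefficient_algebra (a1 a2 d1 d2 c s dO dO0 n m h1 h2 J dH W0 r r' : C) :
    r * r' = 1 -> c ^+ 2 + s ^+ 2 = 1 -> dO = h1 - h2 + dO0 -> dO0 = dH + J ->
    d1 * a2 - a1 * d2 = dH + J + W0 -> d1 + h1 * a1 = d2 + h2 * a2 + dO * c + n ->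
    r * (a1 - a2) = dO0 * s + m ->
  W0 = dO * c * (a2 - c) + n * a2 + m * s - r' * ((dO0 * s + m) * (d2 + h2 * a2 + r * s))
    - (h1 - h2) * (c * (a1 - c + (a2 - c)) + (a1 - c) * (a2 - c)).
Proof.
move=> hr hcs hdO hdO0 hw hn hm.
have -> : W0 = d1 * a2 - a1 * d2 - dO0 by rewrite hdO0 hw; ring.
have -> : d1 = d2 + h2 * a2 + dO * c + n - h1 * a1 by rewrite -hn; ring.
have -> : r' * ((dO0 * s + m) * (d2 + h2 * a2 + r * s)) =
    (a1 - a2) * (d2 + h2 * a2) + (dO0 * s + m) * s.
  transitivity ((r * r') * ((a1 - a2) * (d2 + h2 * a2) + (dO0 * s + m) * s)); last by rewrite hr mul1r.
  by rewrite -hm; ring.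
have -> : (dO0 * s + m) * s = dO0 * (1 - c ^+ 2) + m * s by rewrite -hcs; ring.
by rewrite hdO; ring.
Qed.

(** Here [r] is 1/rho. Every term contains [n] or [m], or carries [r] next to [dO] or [dO0],
    explicitly or through a small factor [e1], [e2]. The bound [r <= 4] serves only to replace
    further powers of [r] by constants. *)
Lemma coefficient_estimate (dO dO0 n m c s e1 e2 a2 D2 dh : C) (r B : R) :
    0 <= r -> r <= 4 -> 0 <= B -> n1 c <= 1 -> n1 s <= 1 ->
    n1 e1 <= r * B -> n1 e2 <= r * B -> n1 a2 <= 1 + 4 * B ->
    n1 D2 <= B + B * (1 + 4 * B) -> n1 dh <= n1 dO + n1 dO0 ->
  n1 (dO * c * e2 + n * a2 + m * s - r%:C * ((dO0 * s + m) * D2) - dh * (c * (e1 + e2) + e1 * e2))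
    <= (1 + 4 * B) ^+ 2 * (n1 n + n1 m + r * (n1 dO + n1 dO0)).
Proof.
move=> r0 r4 B0 nc ns E1 E2 Y2 nD2 nh.
have rB : r * B <= 4 * B by rewrite ler_wpM2r.
have t1 : n1 (dO * c * e2) <= n1 dO * 1 * (r * B) by apply: n1M_le => //; exact: n1M_le.
have t2 : n1 (n * a2) <= n1 n * (1 + 4 * B) by exact: n1M_le.
have t3 : n1 (m * s) <= n1 m * 1 by exact: n1M_le.
have t4 : n1 (r%:C * ((dO0 * s + m) * D2)) <= r * ((n1 dO0 * 1 + n1 m) * (B + B * (1 + 4 * B))).
  rewrite n1Zr ger0_norm// ler_wpM2l//; apply: n1M_le => //; apply: le_trans (n1D _ _) _.
  by apply: lerD => //; exact: n1M_le.
have t5 : n1 (dh * (c * (e1 + e2) + e1 * e2)) <=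
    (n1 dO + n1 dO0) * (1 * (r * B + r * B) + (r * B) * (4 * B)).
  apply: n1M_le => //; apply: le_trans (n1D _ _) _; apply: lerD.
    by apply: n1M_le => //; apply: le_trans (n1D _ _) _; exact: lerD.
  by apply: n1M_le => //; exact: le_trans E2 rB.
apply: le_trans (n1B _ _) _; apply: le_trans (lerD (n1B _ _) t5) _.
apply: le_trans (lerD (lerD (n1D _ _) t4) (lexx _)) _.
apply: le_trans (lerD (lerD (lerD (n1D _ _) t3) (lexx _)) (lexx _)) _.
apply: le_trans (lerD (lerD (lerD (lerD t1 t2) (lexx _)) (lexx _)) (lexx _)) _.
have := n1_ge0 n; have := n1_ge0 m; have := n1_ge0 dO; have := n1_ge0 dO0.
move: (n1 n) (n1 m) (n1 dO) (n1 dO0) => x y w w0 w00 w1 y0 x0.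
(* The difference of the two sides, written as a polynomial with nonnegative coefficients in
   nonnegative quantities, [4 - r] included. *)
rewrite -subr_ge0 (_ : _ - _ = x * (4 * B + 16 * B ^+ 2) + (4 - r) * y * (2 * B + 4 * B ^+ 2) +
  (r * w * (1 + 5 * B + 12 * B ^+ 2) + r * w0 * (1 + 4 * B + 8 * B ^+ 2))); last by ring.
have r4' : 0 <= 4 - r by rewrite subr_ge0.
have B2 : 0 <= B ^+ 2 by exact: sqr_ge0.
have c1 (i j k : nat) : 0 <= i%:R + j%:R * B + k%:R * B ^+ 2.
  by rewrite !addr_ge0// ?mulr_ge0.
have c2 (j k : nat) : 0 <= j%:R * B + k%:R * B ^+ 2.
  by rewrite !addr_ge0// ?mulr_ge0.
by apply: addr_ge0; apply: addr_ge0; apply: mulr_ge0; rewrite ?mulr_ge0 ?(c1 1%N) ?c2.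
Qed.

End Algebra.

(** * Comparison of two problems with common bounds *)

Section TwoProblems.
Variable R : realType.
Local Notation C := R[i].
Implicit Types (x t u rho D : R).

Lemma cinteg_sin (k : R -> C) c : cinteg k -> cinteg (fun u => k u * (sin (c * u))%:C).
Proof.
move=> ik; apply: (cintegMb (M := 1)) => // [|u].
  by apply: cmeas_real; exact: meas_sinM.
by rewrite n1_real sin_max.
Qed.

Lemma ext_supp (f : R -> C) t : ext f t = (seg 0 pi t)%:C * ext f t.
Proof. by rewrite /ext mulrA -rmorphM/= seg_idem. Qed.

Lemma L2pot_ext (f : R -> C) : L2 f -> L2pot (ext f).
Proof.
move=> /L2_ext[mf f2]; split=> //; last exact: ext_supp.
apply: integ_le (integZ 2 f2) _; first by apply: measurable_funX; exact: meas_n1.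
by move=> t; rewrite ger0_norm ?sqr_ge0// n1_csq.
Qed.

Lemma cinteg_ext (f : R -> C) : L2 f -> cinteg (ext f).
Proof. by move=> /L2pot_ext; exact: cinteg_q. Qed.

Lemma extB (f g : R -> C) t : ext (fun t => f t - g t) t = ext f t - ext g t.
Proof. by rewrite /ext mulrBr. Qed.

Lemma L2_extB (f g : R -> C) : L2 f -> L2 g ->
  cmeas (ext (fun t => f t - g t)) /\ integ (fun t => csq (ext (fun t => f t - g t) t)).
Proof.
move=> /L2_ext[mf f2] /L2_ext[mg g2].
have m : cmeas (ext (fun t => f t - g t)).
  by rewrite (_ : ext _ = fun t => ext f t - ext g t); [exact: cmeasB|apply/funext => t; exact: extB].
split=> //; apply: integ_le (integD (integZ 2 f2) (integZ 2 g2)) _.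
  by case: m => m1 m2; apply: measurable_funD; exact: measurable_funX.
move=> t; rewrite ger0_norm ?csq_ge0// extB /csq !cE.
move: (seg 0 pi t * _) (seg 0 pi t * _) (seg 0 pi t * _) (seg 0 pi t * _) => a b c d.
by have := sqr_ge0 (a + b); have := sqr_ge0 (c + d); nra.
Qed.

Variables (q1 q2 N1 N01 N2 N02 : R -> C) (h1 H1 h2 H2 : C) (lam M B : R).
Hypotheses (L2q1 : L2 q1) (L2q2 : L2 q2).
Hypotheses (L2N1 : L2 N1) (L2N01 : L2 N01) (L2N2 : L2 N2) (L2N02 : L2 N02).
Hypothesis lam0 : 0 < lam.
Hypothesis hlam1 : 4 * pi ^+ 2 * RI (fun t => n1 (flip q1 t) ^+ 2) <= 2 * lam.
Hypothesis hlam2 : 4 * pi ^+ 2 * RI (fun t => n1 (flip q2 t) ^+ 2) <= 2 * lam.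
Hypothesis hM1 : 4 * kbound (flip q1) 1 H1 * expR (lam * pi) <= M.
Hypothesis hM2 : 4 * kbound (flip q2) 1 H2 * expR (lam * pi) <= M.
Hypotheses (hB1 : sol_const (flip q1) lam 1 H1 <= B) (hB2 : sol_const (flip q2) lam 1 H2 <= B).
Hypotheses (hh1 : n1 h1 <= B) (hh2 : n1 h2 <= B).
Hypotheses (cN1 : cauchyN q1 h1 H1 N1) (cN01 : cauchyN0 q1 H1 N01).
Hypotheses (cN2 : cauchyN q2 h2 H2 N2) (cN02 : cauchyN0 q2 H2 N02).

Let pot1 : L2pot (flip q1). Proof. by case: (L2_flip L2q1). Qed.
Let pot2 : L2pot (flip q2). Proof. by case: (L2_flip L2q2). Qed.

Let M0 : 0 <= M.
Proof. by apply: le_trans hM1; rewrite !mulr_ge0 ?kbound_ge0 ?expR_ge0. Qed.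

Let B0 : 0 <= B. Proof. exact: le_trans (n1_ge0 _) hh1. Qed.

Let K1 := transmutation (flip q1) 1 H1.
Let K2 := transmutation (flip q2) 1 H2.

Let bK1 x u : n1 (K1 (x, u)) <= M * triangle x u.
Proof.
apply: le_trans (transmutation_bound 1 H1 pot1 lam0 hlam1 x u) _.
by rewrite ler_wpM2r// mulr_ge0 ?seg_ge0.
Qed.

Let bK2 x u : n1 (K2 (x, u)) <= M * triangle x u.
Proof.
apply: le_trans (transmutation_bound 1 H2 pot2 lam0 hlam2 x u) _.
by rewrite ler_wpM2r// mulr_ge0 ?seg_ge0.
Qed.

Let mK1 : cmeas K1. Proof. by case: (good_transmutation pot1 lam0 hlam1 1 H1). Qed.
Let mK2 : cmeas K2. Proof. by case: (good_transmutation pot2 lam0 hlam2 1 H2). Qed.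

Let V := prodker K1 K2.
Let MV := prodker_const M M.

Let MV0 : 0 <= MV.
Proof. by rewrite /MV /prodker_const addr_ge0 ?addr_ge0 ?mulr_ge0 ?pi_ge0. Qed.

Let mV : cmeas V. Proof. exact: cmeas_prodker. Qed.

Let bV x u : n1 (V (x, u)) <= MV * (seg 0 pi x * seg (- x) x u).
Proof. exact: prodker_bound. Qed.

Definition dpot t : C := flip q1 t - flip q2 t.
Local Notation p := dpot.

Let ip : cinteg p. Proof. by apply: cintegB; exact: cinteg_q. Qed.

Let p_supp t : p t = (seg 0 pi t)%:C * p t.
Proof. by rewrite /p mulrBr -!flip_supp. Qed.

Let W := folded p V.
Let dO := omega q1 h1 H1 - omega q2 h2 H2.
Let dO0 := omega0 q1 H1 - omega0 q2 H2.
Let nu rho := cI (fun t => ext (fun t => N1 t - N2 t) t * (cos (rho * t))%:C).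
Let mv rho := cI (fun t => ext (fun t => N01 t - N02 t) t * (sin (rho * t))%:C).

(** The constant 1/2 in the product of two solutions contributes exactly this mean, so [dO0] is the
    part of the Wronskian at the far endpoint that does not depend on [rho]. *)
Let dO0E : dO0 = H1 - H2 + 2^-1 * cI p.
Proof.
rewrite /dO0 /omega0 /p (cIB (cinteg_q pot1) (cinteg_q pot2)) -!cI_flipE//.
by field.
Qed.

Let dOE : dO = h1 - h2 + dO0.
Proof. by rewrite /dO /dO0 /omega /omega0; ring. Qed.

Section Coefficient.
Variable rho : R.
Hypothesis rho0 : 0 < rho.
Local Notation y1 := (sol (flip q1) 1 H1 rho).
Local Notation d1 := (dsol (flip q1) 1 H1 rho).
Local Notation y2 := (sol (flip q2) 1 H2 rho).
Local Notation d2 := (dsol (flip q2) 1 H2 rho).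
Local Notation c := ((cos (rho * pi))%:C : C).
Local Notation s := ((sin (rho * pi))%:C : C).

Let pip : 0 <= (pi : R) <= pi. Proof. by rewrite pi_ge0 lexx. Qed.

(** The data (1, H1) and (1, H2) give [H1 - H2] at the start; along the way the density
    [p * (y1 * y2)] is integrated by the product formula and folded. *)
Let wronskian_identity :
  d1 pi * y2 pi - y1 pi * d2 pi = H1 - H2 + 2^-1 * cI p + cI (fun u => W u * (cos (2 * rho * u))%:C).
Proof.
have [_ w] := wronskian (solution_solves 1 H1 pot1 lam0 hlam1 rho0) (solution_solves 1 H2 pot2 lam0 hlam2 rho0).
rewrite (w _ pip).
have [-> ->] := sol0 1 H1 pot1 lam0 hlam1 rho0.
have [-> ->] := sol0 1 H2 pot2 lam0 hlam2 rho0.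
rewrite mulr1 mul1r -[RHS]addrA; congr (_ + _).
have [iJ <-] := folded_cos ip mV MV0 bV (2 * rho).
rewrite -(cIZ _ ip) -cID//; last exact: cintegZ.
apply: eq_cI => x; rewrite -/(p x) mulrA -p_supp.
have -> : y1 x = (cos (rho * x))%:C + cI (fun u => K1 (x, u) * (cos (2 * rho * u))%:C).
  by rewrite /sol mul1r.
have -> : y2 x = (cos (rho * x))%:C + cI (fun u => K2 (x, u) * (cos (2 * rho * u))%:C).
  by rewrite /sol mul1r.
rewrite (product_formula mK1 mK2 M0 M0 bK1 bK2) rmorphD -addrA mulrDr; congr (_ + _).
by rewrite mulrC fmorphV rmorphMn.
Qed.

Let nuE : d1 pi + h1 * y1 pi = d2 pi + h2 * y2 pi + dO * c + nu rho.
Proof.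
have gen (A1 A2 x o1 o2 cc n1 n2 n : C) : A1 = x + o1 * cc + n1 -> A2 = x + o2 * cc + n2 ->
    n = n1 - n2 -> A1 = A2 + (o1 - o2) * cc + n by move=> -> -> ->; ring.
apply: gen (cauchyN_real pot1 lam0 hlam1 rho0 cN1) (cauchyN_real pot2 lam0 hlam2 rho0 cN2) _.
rewrite -cIB; [|by apply: cinteg_cos; exact: cinteg_ext|by apply: cinteg_cos; exact: cinteg_ext].
by apply: eq_cI => t; rewrite extB mulrBl.
Qed.

Let mvE : rho%:C * (y1 pi - y2 pi) = dO0 * s + mv rho.
Proof.
have gen (r A1 A2 x o1 o2 cc n1 n2 n : C) : r * A1 = x + o1 * cc + n1 -> r * A2 = x + o2 * cc + n2 ->
    n = n1 - n2 -> r * (A1 - A2) = (o1 - o2) * cc + n.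
  by move=> e1 e2 ->; rewrite mulrBr e1 e2; ring.
apply: gen (cauchyN0_real pot1 lam0 hlam1 rho0 cN01) (cauchyN0_real pot2 lam0 hlam2 rho0 cN02) _.
rewrite -cIB; [|by apply: cinteg_sin; exact: cinteg_ext|by apply: cinteg_sin; exact: cinteg_ext].
by apply: eq_cI => t; rewrite extB mulrBl.
Qed.

(** Subtracting [dO0] from the Wronskian removes the mean. The rest is small because the solutions
    at pi differ from cos(rho pi) by O(1/rho), and their difference is obtained from [mvE] after
    division by [rho]. *)
Lemma coefficient_bound : 4^-1 <= rho ->
  n1 (cI (fun u => W u * (cos (2 * rho * u))%:C)) <=
  (1 + 4 * B) ^+ 2 * (n1 (nu rho) + n1 (mv rho) + rho^-1 * (n1 dO + n1 dO0)).
Proof.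
move=> rho4.
have r1 : rho%:C * (rho^-1)%:C = 1 :> C by rewrite -rmorphM/= divff// gt_eqF.
have csE : c ^+ 2 + s ^+ 2 = 1 by rewrite -!rmorphXn -rmorphD/= cos2Dsin2.
rewrite (coefficient_algebra r1 csE dOE dO0E wronskian_identity nuE mvE).
have ri0 : 0 <= rho^-1 by rewrite invr_ge0 ltW.
have ri4 : rho^-1 <= 4 by rewrite -[leRHS]invrK lef_pV2 ?posrE ?invr_gt0.
have [a1 b1] := sol_asymptotics 1 H1 pot1 lam0 hlam1 rho0 pip.
have [a2 b2] := sol_asymptotics 1 H2 pot2 lam0 hlam2 rho0 pip.
rewrite mul1r in b1; rewrite mul1r in b2; rewrite mul1r in a2.
have E1 : n1 (y1 pi - c) <= rho^-1 * B by apply: le_trans b1 _; rewrite ler_wpM2l.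
have E2 : n1 (y2 pi - c) <= rho^-1 * B by apply: le_trans b2 _; rewrite ler_wpM2l.
have nc : n1 c <= 1 by rewrite n1_real cos_max.
have ns : n1 s <= 1 by rewrite n1_real sin_max.
have rB : rho^-1 * B <= 4 * B by rewrite ler_wpM2r.
have Y2 : n1 (y2 pi) <= 1 + 4 * B.
  by rewrite -[y2 pi](subrK c) addrC; apply: le_trans (n1D _ _) _; apply: lerD => //; exact: le_trans E2 rB.
have nD2 : n1 (d2 pi + h2 * y2 pi + rho%:C * s) <= B + B * (1 + 4 * B).
  rewrite addrAC; apply: le_trans (n1D _ _) _; apply: lerD; last exact: n1M_le.
  by apply: le_trans hB2; rewrite -rmorphM.
have gen (x y z : C) : x = y + z -> n1 y <= n1 x + n1 z.
  by move=> ->; rewrite -{1}[y](addrK z) n1B.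
exact: coefficient_estimate ri0 ri4 B0 nc ns E1 E2 Y2 nD2 (gen _ _ _ dOE).
Qed.

End Coefficient.

Variable D : R.
Hypothesis hN : L2norm (fun t => N1 t - N2 t) <= D.
Hypothesis hN0 : L2norm (fun t => N01 t - N02 t) <= D.
Hypothesis hO : cabs dO + cabs dO0 <= D.

Let D0 : 0 <= D. Proof. exact: le_trans (sqrtr_ge0 _) hN. Qed.

Let csq_le (f g : R -> C) : L2norm (fun t => f t - g t) <= D ->
  RI (fun t => csq (ext (fun t => f t - g t) t)) <= D ^+ 2.
Proof. by move=> h; rewrite -L2normE ler_sqr ?nnegrE ?sqrtr_ge0. Qed.

Let hX : n1 dO + n1 dO0 <= 2 * D.
Proof.
apply: le_trans (lerD (n1_cabs _) (n1_cabs _)) _.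
by rewrite -mulrDr ler_wpM2l.
Qed.

(** At [rho = theta / 2] the differences of N and N_0 contribute Bessel sums for the half
    frequencies, each at most 2 pi D^2, and the differences of the omegas contribute 4 X^2 /
    theta^2, summable by [theta_sum]. *)
Lemma coefficient_sum n :
  \sum_(k < n) n1 (cI (fun u => W u * (cos (theta R k * u))%:C)) ^+ 2 <=
  3 * (1 + 4 * B) ^+ 4 * (4 * pi + 8 * pi ^+ 2) * D ^+ 2.
Proof.
pose r k : R := 2^-1 * theta R k; pose X := n1 dO + n1 dO0.
have X0 : 0 <= X by rewrite addr_ge0 ?n1_ge0.
have XD : X ^+ 2 <= 4 * D ^+ 2.
  rewrite (_ : 4 * D ^+ 2 = (2 * D) ^+ 2); last by ring.
  by rewrite ler_sqr ?nnegrE ?mulr_ge0.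
have [m1 i1] := L2_extB L2N1 L2N2; have [m2 i2] := L2_extB L2N01 L2N02.
have s1 := bessel_ccos n m1 i1 (@ext_supp _).
have s2 := bessel_csin n m2 i2 (@ext_supp _).
have b1 := csq_le hN; have b2 := csq_le hN0.
have s3 := theta_sum R n.
have p0 := pi_ge0 R.
pose G := (1 + 4 * B) ^+ 4.
have G0 : 0 <= G by rewrite exprn_ge0// addr_ge0// mulr_ge0.
(* The factor 3 comes from (a + b + c)^2 <= 3 (a^2 + b^2 + c^2), the 4 from 1/rho = 2/theta. *)
apply: (@le_trans _ _ (\sum_(k < n) 3 * G * (n1 (nu (r k)) ^+ 2 + n1 (mv (r k)) ^+ 2 + 4 * X ^+ 2 * theta R k ^- 2))).
  apply: ler_sum => k _.
  have t0 := theta_gt0 R k.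
  have r0 : 0 < r k by rewrite mulr_gt0.
  have r4 : 4^-1 <= r k.
    rewrite /r /theta; have : 0 <= k%:R :> R by []; lra.
  have := coefficient_bound r0 r4.
  rewrite (_ : 2 * r k = theta R k); last by rewrite /r; field.
  rewrite (_ : (r k)^-1 = 2 * (theta R k)^-1); last by rewrite /r invfM invrK.
  rewrite -/X => h.
  apply: (@le_trans _ _ (((1 + 4 * B) ^+ 2 * (n1 (nu (r k)) + n1 (mv (r k)) + 2 * (theta R k)^-1 * X)) ^+ 2)).
    by rewrite ler_sqr ?nnegrE ?n1_ge0//; exact: le_trans (n1_ge0 _) h.
  rewrite exprMn -exprM -/G mulrC -exprVn.
  rewrite [leRHS](_ : _ = 3 * (n1 (nu (r k)) ^+ 2 + n1 (mv (r k)) ^+ 2 + (2 * (theta R k)^-1 * X) ^+ 2) * G); last by ring.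
  rewrite ler_wpM2r//.
  move: (n1 _) (n1 _) (2 * _ * X) => a b c.
  by have := sqr_ge0 (a - b); have := sqr_ge0 (a - c); have := sqr_ge0 (b - c); nra.
have G3 : 0 <= 3 * G by exact: mulr_ge0.
rewrite -mulr_sumr -[leRHS]mulrA -/G (ler_wpM2l G3)//.
rewrite !big_split -mulr_sumr /=.
apply: (@le_trans _ _ (2 * pi * D ^+ 2 + 2 * pi * D ^+ 2 + 4 * (4 * D ^+ 2) * (pi ^+ 2 / 2))).
  apply: lerD; first apply: lerD.
  - by apply: le_trans s1 _; rewrite ler_wpM2l// mulr_ge0.
  - by apply: le_trans s2 _; rewrite ler_wpM2l// mulr_ge0.
  - apply: ler_pM => //; first by rewrite !mulr_ge0 ?sqr_ge0.
      by apply: sumr_ge0 => k _; rewrite invr_ge0 exprn_ge0// ltW// theta_gt0.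
    by rewrite ler_wpM2l.
by apply: ler_of_eq; field.
Qed.

Let Pn t := n1 (p t).

Let sqint_P : sqint Pn.
Proof.
apply: (@sqint_le _ _ (fun t => n1 (flip q1 t) + n1 (flip q2 t))).
- exact: meas_n1 (cinteg_meas ip).
- by apply: sqintD; exact: sqint_n1.
- by move=> t; rewrite ger0_norm ?n1_ge0// n1B.
Qed.

Let mW : cmeas W. Proof. exact: cmeas_folded. Qed.

Let bW u : n1 (W u - (2^-1)%:C * p u) <= seg 0 pi u * (2 * MV * RI (fun x => seg u pi x * Pn x)).
Proof. exact: folded_bound. Qed.

Let sqint_W : sqint (fun u => n1 (W u)).
Proof.
have iP := cinteg_n1 ip.
apply: (@sqint_le _ _ (fun t => 2^-1 * Pn t + 2 * MV * RI Pn * seg 0 pi t)).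
- exact: meas_n1.
- by apply: sqintD; apply: sqintZ => //; exact: sqint_seg.
- move=> u; rewrite ger0_norm ?n1_ge0// -[W u](subrK ((2^-1)%:C * p u)) addrC.
  apply: le_trans (n1D _ _) _; rewrite n1Zr ger0_norm ?invr_ge0// lerD2l.
  apply: le_trans (bW u) _; rewrite mulrC ler_wpM2r ?seg_ge0// ler_wpM2l ?mulr_ge0//.
  apply: RI_le => // [|t]; first exact: integ_segM.
  by rewrite ler_piMl ?n1_ge0//; have /andP[] := seg01 u pi t.
Qed.

Definition potential_const (M B : R) : R :=
  16 * expR (2 * (2 * (4 * prodker_const M M) ^+ 2 * pi + 1) * pi) *
  (8 / pi * (3 * (1 + 4 * B) ^+ 4 * (4 * pi + 8 * pi ^+ 2))).

(** Completeness turns the summed coefficients into a norm bound for [W]; [p] is recovered from [W]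
    by inverting one half of the identity plus a Volterra operator. *)
Lemma potential_bound : RI (fun t => n1 (p t) ^+ 2) <= potential_const M B * D ^+ 2.
Proof.
have hW : RI (fun u => n1 (W u) ^+ 2) <= 8 / pi * (3 * (1 + 4 * B) ^+ 4 * (4 * pi + 8 * pi ^+ 2) * D ^+ 2).
  apply: parseval_n1 => //; first by case: sqint_W.
  - exact: folded_supp.
  - exact: coefficient_sum.
(* Doubling undoes the 1/2 in front of [p]: the source becomes twice [W] and the Volterra constant
   [2 * MV] becomes [4 * MV]. *)
have sw := sqintZ 2 sqint_W.
have := volterra_bound (M := 4 * MV) sqint_P sw (fun t => n1_ge0 _).
set E := expR _ => vb.
apply: le_trans (vb _ _) _.
- by move=> t; rewrite /Pn {1}p_supp n1Zr ger0_norm ?seg_ge0.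
- move=> u; have h : Pn u = 2 * n1 ((2^-1)%:C * p u).
    by rewrite n1Zr ger0_norm ?invr_ge0// mulrA divff// mul1r.
  have hw : n1 ((2^-1)%:C * p u) <= n1 (W u) + n1 (W u - (2^-1)%:C * p u).
    have gen (y z : C) : n1 y <= n1 z + n1 (z - y).
      by rewrite -{1}[y](subKr z) n1B.
    exact: gen.
  rewrite h; apply: (@le_trans _ _ (2 * (n1 (W u) + seg 0 pi u * (2 * MV * RI (fun x => seg u pi x * Pn x))))).
    by rewrite ler_wpM2l//; apply: le_trans hw _; rewrite lerD2l.
  by apply: ler_of_eq; ring.
rewrite (@eq_RI _ _ (fun t => 4 * n1 (W t) ^+ 2)); last by move=> t; ring.
rewrite RIZ; last by case: sqint_W.
rewrite /potential_const -/MV -/E.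
apply: (@le_trans _ _ (4 * E * (4 * (8 / pi * (3 * (1 + 4 * B) ^+ 4 * (4 * pi + 8 * pi ^+ 2) * D ^+ 2))))).
  by rewrite ler_wpM2l ?mulr_ge0 ?expR_ge0// ler_wpM2l.
apply: ler_of_eq.
have gen (a e b c d : R) : 4 * e * (4 * (a * (3 * b * c * d))) = 16 * e * (a * (3 * b * c)) * d.
  by ring.
exact: gen.
Qed.

(** The first summand is for the potentials, the 4 collects twice [D] from each of h and H, and the
    last bounds the mean of the potential difference that enters H. *)
Definition stability_const (M B : R) : R :=
  (1 + potential_const M B) + 4 + (1 + pi) * (1 + potential_const M B).

Lemma potential_const_ge0 : 0 <= potential_const M B.
Proof.
rewrite /potential_const !mulr_ge0 ?expR_ge0 ?invr_ge0 ?pi_ge0 ?exprn_ge0 ?addr_ge0 ?mulr_ge0 ?pi_ge0 ?sqr_ge0//.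
Qed.

Lemma stability :
  L2norm (fun t => q1 t - q2 t) + cabs (h1 - h2) + cabs (H1 - H2) <= stability_const M B * D.
Proof.
have S0 := potential_const_ge0; set S := potential_const M B in S0 *.
have hp := potential_bound; rewrite -/S in hp.
have p0 := pi_ge0 R.
(* Replacing [S] by the larger [(1 + S) ^+ 2] avoids a square root in the constant. *)
have SD : S * D ^+ 2 <= ((1 + S) * D) ^+ 2.
  by rewrite exprMn ler_wpM2r ?sqr_ge0//; nra.
have SD0 : 0 <= (1 + S) * D by rewrite mulr_ge0 ?addr_ge0.
have [mq i2] := L2_extB L2q1 L2q2.
have hq : L2norm (fun t => q1 t - q2 t) <= (1 + S) * D.
  rewrite -ler_sqr ?nnegrE ?sqrtr_ge0// L2normE; apply: le_trans SD; apply: le_trans hp.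
  have [i3 <-] := integ_flip pi i2.
  apply: RI_le => // [|t]; first by case: sqint_P.
  by apply: le_trans (csq_n1 _) _; rewrite /p !flip_ext extB.
have hh : cabs (h1 - h2) <= 2 * D.
  apply: le_trans (cabs_n1 _) _; apply: le_trans hX.
  have gen (x y z : C) : x = y + z -> n1 y <= n1 x + n1 z.
    by move=> ->; rewrite -{1}[y](addrK z) n1B.
  exact: gen dOE.
(* Cauchy-Schwarz on [0, pi] gives the factor sqrt pi, which is enlarged to [1 + pi]. *)
have hP : RI Pn <= (1 + pi) * ((1 + S) * D).
  have [iP hP] := RI_seg_sqint p0 sqint_P.
  rewrite (@eq_RI _ _ Pn) in hP; last first.
    by move=> t; rewrite ger0_norm ?n1_ge0// /Pn [in RHS]p_supp n1Zr ger0_norm ?seg_ge0.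
  have P1 : 0 <= RI Pn by apply: RI_ge0 => t; exact: n1_ge0.
  have C1 := mulr_ge0 (addr_ge0 ler01 p0) SD0.
  rewrite -ler_sqr ?nnegrE//; apply: le_trans hP _; rewrite subr0 exprMn.
  apply: ler_pM => //; [by apply: RI_ge0 => t; exact: sqr_ge0|by nra|exact: le_trans hp SD].
have hH : cabs (H1 - H2) <= 2 * D + (1 + pi) * ((1 + S) * D).
  apply: le_trans (cabs_n1 _) _.
  rewrite (_ : H1 - H2 = dO0 - (2^-1)%:C * cI p); last first.
    by rewrite dO0E fmorphV rmorphMn; move: (cI p) => z; rewrite addrK.
  apply: le_trans (n1B _ _) _; rewrite n1Zr ger0_norm ?invr_ge0//.
  apply: lerD; first by apply: le_trans hX; rewrite lerDr n1_ge0.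
  apply: le_trans hP; apply: le_trans (n1_cI ip); rewrite ler_piMl ?n1_ge0//.
  by rewrite invf_le1// ler1n.
rewrite /stability_const -/S; nra.
Qed.

End TwoProblems.

(** * Constants depending on Q alone *)

Section Uniform.
Variable R : realType.
Local Notation C := R[i].
Variable Q : R.
Hypothesis Q0 : 0 < Q.

(** Large enough for [weight_half]: the squared norm of the flipped potential in [n1] is at most
    [2 * Q ^+ 2], the 2 being the price of [n1]. *)
Definition PQ_lam : R := 4 * pi ^+ 2 * Q ^+ 2 + 1.
(** Bounds the integral N of |q|: N^2 <= 2 pi Q^2 by Cauchy-Schwarz, and N <= 1 + N^2. *)
Definition PQ_norm1 : R := 1 + 2 * pi * Q ^+ 2.
Definition PQ_ker : R := 4 * (2 * Q + PQ_norm1) * expR (PQ_lam * pi).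
Definition PQ_sol : R := 2 * Q + 2 * (PQ_norm1 * (1 + PQ_ker * pi)).

Lemma PQ_lam_gt0 : 0 < PQ_lam.
Proof. by rewrite ltr_wpDl// mulr_ge0 ?sqr_ge0// mulr_ge0 ?sqr_ge0. Qed.

Lemma PQ_bounds (q : R -> C) (h H : C) : in_PQ Q q h H ->
  [/\ 4 * pi ^+ 2 * RI (fun t => n1 (flip q t) ^+ 2) <= 2 * PQ_lam,
      4 * kbound (flip q) 1 H * expR (PQ_lam * pi) <= PQ_ker,
      sol_const (flip q) PQ_lam 1 H <= PQ_sol & n1 h <= PQ_sol].
Proof.
move=> [L2q hQ]; have [hq q2] := L2_flip L2q; have p0 := pi_ge0 R.
have [l0 [c0 d0]] : 0 <= L2norm q /\ 0 <= cabs h /\ 0 <= cabs H by rewrite !sqrtr_ge0.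
have Q00 := ltW Q0.
have lq : L2norm q ^+ 2 <= Q ^+ 2 by rewrite ler_sqr ?nnegrE//; lra.
have hh : n1 h <= 2 * Q by have := n1_cabs h; lra.
have hH : n1 H <= 2 * Q by have := n1_cabs H; lra.
have b2 : RI (fun t => n1 (flip q t) ^+ 2) <= 2 * Q ^+ 2.
  by apply: le_trans q2 _; rewrite ler_wpM2l.
set N := RI (fun t => n1 (flip q t)).
have N0 : 0 <= N by apply: RI_ge0 => t; exact: n1_ge0.
have N1 : N <= PQ_norm1.
  have [iP hP] := RI_seg_sqint p0 (sqint_n1 hq).
  rewrite (@eq_RI _ _ (fun t => n1 (flip q t))) -/N ?subr0 in hP; last first.
    by move=> t; rewrite ger0_norm ?n1_ge0// [in RHS]flip_supp n1Zr ger0_norm ?seg_ge0.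
  have : pi * RI (fun t => n1 (flip q t) ^+ 2) <= pi * (2 * Q ^+ 2) by rewrite ler_wpM2l.
  rewrite /PQ_norm1; have := sqr_ge0 (N - 1); nra.
have P1 : 0 <= PQ_norm1 by exact: le_trans N1.
have n11 : n1 (1 : C) = 1 by rewrite (n1_real 1) normr1.
have kb : kbound (flip q) 1 H <= 2 * Q + PQ_norm1.
  by rewrite /kbound n11 mul1r lerD.
have k0 : 0 <= kbound (flip q) 1 H by exact: kbound_ge0.
have hk : 4 * kbound (flip q) 1 H * expR (PQ_lam * pi) <= PQ_ker.
  by rewrite /PQ_ker ler_wpM2r ?expR_ge0// ler_wpM2l.
have ker0 : 0 <= PQ_ker.
  by apply: le_trans hk; rewrite mulr_ge0 ?expR_ge0// mulr_ge0.
have kp : 0 <= 1 + PQ_ker * pi by rewrite addr_ge0// mulr_ge0.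
split=> //.
- have : 4 * pi ^+ 2 * RI (fun t => n1 (flip q t) ^+ 2) <= 4 * pi ^+ 2 * (2 * Q ^+ 2).
    by rewrite ler_wpM2l// mulr_ge0 ?sqr_ge0.
  rewrite /PQ_lam; lra.
- rewrite /sol_const /PQ_sol n11 -/N lerD// ler_wpM2l//; apply: ler_pM => //.
    by rewrite addr_ge0// mulr_ge0// mulr_ge0 ?expR_ge0// mulr_ge0.
  by rewrite lerD2l ler_wpM2r.
- by apply: le_trans hh _; rewrite lerDl mulr_ge0// mulr_ge0.
Qed.

End Uniform.

Theorem theorem2p7 (R : realType) (Q : R) : 0 < Q ->
  exists C : R, forall (q1 q2 : R -> R[i]) (h1 H1 h2 H2 : R[i])
    (N1 N01 N2 N02 : R -> R[i]),
    in_PQ Q q1 h1 H1 -> in_PQ Q q2 h2 H2 ->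
    L2 N1 -> L2 N01 -> L2 N2 -> L2 N02 ->
    cauchyN q1 h1 H1 N1 -> cauchyN0 q1 H1 N01 ->
    cauchyN q2 h2 H2 N2 -> cauchyN0 q2 H2 N02 ->
    L2norm (fun t => q1 t - q2 t) + cabs (h1 - h2) + cabs (H1 - H2) <=
    C * (L2norm (fun t => N1 t - N2 t) + L2norm (fun t => N01 t - N02 t)
         + cabs (omega q1 h1 H1 - omega q2 h2 H2)
         + cabs (omega0 q1 H1 - omega0 q2 H2)).
Proof.
move=> Q0; exists (stability_const (PQ_ker Q) (PQ_sol Q)).
move=> q1 q2 h1 H1 h2 H2 N1 N01 N2 N02 PQ1 PQ2 L1 L01 L2' L02 cN1 cN01 cN2 cN02.
have [l1 k1 s1 b1] := PQ_bounds Q0 PQ1; have [l2 k2 s2 b2] := PQ_bounds Q0 PQ2.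
have [Lq1 _] := PQ1; have [Lq2 _] := PQ2.
have a1 : 0 <= L2norm (fun t => N1 t - N2 t) by exact: sqrtr_ge0.
have a2 : 0 <= L2norm (fun t => N01 t - N02 t) by exact: sqrtr_ge0.
have a3 : 0 <= cabs (omega q1 h1 H1 - omega q2 h2 H2) by exact: sqrtr_ge0.
have a4 : 0 <= cabs (omega0 q1 H1 - omega0 q2 H2) by exact: sqrtr_ge0.
(* Here [D] is the whole sum on the right, which dominates each norm and the sum of the two omega
   terms. *)
apply: (stability Lq1 Lq2 L1 L01 L2' L02 (PQ_lam_gt0 Q) l1 l2 k1 k2 s1 s2 b1 b2 cN1 cN01 cN2 cN02).
- lra.
- lra.
- lra.
Qed.
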